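(* Let $\Phi:\mathbb{D}\to\mathbb{R}^3$ be a smooth conformal immersion, and $X$ (respectively $Z$) its representation in $\mathbb{S}^3$ (respectively $\mathbb{H}^3$) through $\pi$ (respectively $\tilde\pi$). Let $Y$ be its conformal Gauss map. Assume that the set of umbilic points of $\Phi$ (or equivalently of $X$ or $Z$) is nowhere dense. Then: (1) $\Phi$ is conformally CMC (respectively minimal) in $\mathbb{R}^3$ if and only if $Y$ lies in an affine (respectively linear) hyperplane of $\mathbb{R}^{4,1}$ with lightlike normal. (2) $X$ is conformally CMC (respectively minimal) in $\mathbb{S}^3$ if and only if $Y$ lies in an affine (respectively linear) hyperplane of $\mathbb{R}^{4,1}$ with timelike normal. (3) $Z$ is conformally CMC (respectively minimal) in $\mathbb{H}^3$ if and only if $Y$ lies in an affine (respectively linear) hyperplane of $\mathbb{R}^{4,1}$ with spacelike normal.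
   Context: $\mathbb{D}$ is the unit disk, with complex coordinate $z=x+iy$. $\mathbb{R}^{m,1}$ is $\mathbb{R}^{m+1}$ with the Lorentzian product $\langle u,v\rangle=\sum_{i=1}^m u_iv_i-u_{m+1}v_{m+1}$; a nonzero vector $v$ is spacelike, lightlike or timelike when $\langle v,v\rangle>0$, $=0$, $<0$ respectively. The affine hyperplane of $\mathbb{R}^{4,1}$ with normal $v\neq0$ and constant $\eta\in\mathbb{R}$ is $\{y:\langle y,v\rangle=\eta\}$; it is linear if $\eta=0$. For the conformal immersion $\Phi$: $|\Phi_z|^2=\langle\Phi_z,\Phi_{\bar z}\rangle$, the Gauss map is $\vec n=\frac{\Phi_z\times\Phi_{\bar z}}{i|\Phi_z|^2}$, the mean curvature is $H=\left\langle\frac{\Phi_{z\bar z}}{|\Phi_z|^2},\vec n\right\rangle$, the tracefree curvature is $\Omega=2\langle\Phi_{zz},\vec n\rangle$, and umbilic points are the zeros of $\Omega$. The conformal Gauss map is $$Y=H\begin{pmatrix}\Phi\\ \frac{|\Phi|^2-1}{2}\\ \frac{|\Phi|^2+1}{2}\end{pmatrix}+\begin{pmatrix}\vec n\\ \langle\vec n,\Phi\rangle\\ \langle\vec n,\Phi\rangle\end{pmatrix}\in\mathbb{R}^{4,1}.$$ Representations: $X=\pi^{-1}\circ\Phi=\frac{1}{1+|\Phi|^2}(2\Phi,|\Phi|^2-1)\in\mathbb{S}^3\subset\mathbb{R}^4$, where $\pi(x,y,z,t)=\frac{1}{1-t}(x,y,z)$ is the stereographic projection from the north pole. $Z=\tilde\pi^{-1}\circ\Phi=\frac{1}{1-|\Phi|^2}(2\Phi,|\Phi|^2+1)\in\mathbb{H}^3=\{(x,y,z,t)\in\mathbb{R}^{3,1}: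 x^2+y^2+z^2-t^2+1=0,\ t\ge0\}$, where $\tilde\pi:\mathbb{H}^3\to B_1(0)$, $\tilde\pi(x,y,z,t)=\frac{1}{1+t}(x,y,z)$, and $B_1(0)$ is the unit ball of $\mathbb{R}^3$; $Z$ is considered whenever $\Phi(\mathbb{D})\subset B_1(0)$. Definition: $\Phi$ (respectively $X$, $Z$) is conformally CMC (respectively minimal) if and only if there exists a conformal diffeomorphism $\varphi$ of $\mathbb{R}^3\cup\{\infty\}$ (respectively of $\mathbb{S}^3$, of $\mathbb{H}^3$) such that $\varphi\circ\Phi$ (respectively $\varphi\circ X$, $\varphi\circ Z$) has constant mean curvature (respectively is minimal, i.e. has zero mean curvature) in $\mathbb{R}^3$ (respectively $\mathbb{S}^3$, $\mathbb{H}^3$).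
   Formalization: In (3), φ is a conformal diffeomorphism of R³∪{∞} (not of H³, whose only ones are isometries: (3) then fails, e.g. for a cone); φ∘Z may cross the sphere at infinity into −H³, with mean curvature required off that sphere. In (1), φ∘Φ may take the value ∞, with H required where finite. *)

(* Defs.v *)
From HB Require Import structures.
From mathcomp Require Import all_boot all_order all_algebra.
From mathcomp Require Import all_classical all_reals all_analysis.
From mathcomp Require Import complex.
Set Implicit Arguments.
Unset Strict Implicit.
Unset Printing Implicit Defensive.
Import Order.TTheory GRing.Theory Num.Theory.
Import numFieldNormedType.Exports.

Local Open Scope classical_set_scope.
Local Open Scope ring_scope.
Local Open Scope complex_scope.

(* Bilinear forms.  They are used over R and over R[i]; over R[i] they are the
   complex bilinear (not Hermitian) extensions. *)

Definition dot (K : comNzRingType) (n : nat) (u v : 'rV[K]_n) : K :=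
  \sum_(i < n) u 0 i * v 0 i.

Definition lorentz (K : comNzRingType) (m : nat) (u v : 'rV[K]_m.+1) : K :=
  \sum_(i < m) u 0 (widen_ord (leqnSn m) i) * v 0 (widen_ord (leqnSn m) i)
  - u 0 ord_max * v 0 ord_max.

(* Indices are taken modulo 3. *)
Definition cross (K : comNzRingType) (u v : 'rV[K]_3) : 'rV[K]_3 :=
  \row_(j < 3) (u 0 (j + 1) * v 0 (j + 2) - u 0 (j + 2) * v 0 (j + 1)).

(* The triple vector products of R^4 and of R^{3,1}: dot (cross4 a b c) w and
   lorentz (lcross4 a b c) w are both equal to the determinant of (a; b; c; w). *)
Definition cross4 (K : comNzRingType) (a b c : 'rV[K]_4) : 'rV[K]_4 :=
  \row_(j < 4)
    \det (col_mx (col_mx a b) (col_mx c (delta_mx 0 j)) : 'M[K]_(1 + 1 + (1 + 1))).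

Definition lcross4 (K : comNzRingType) (a b c : 'rV[K]_4) : 'rV[K]_4 :=
  \row_(j < 4) (if j == ord_max then - cross4 a b c 0 j else cross4 a b c 0 j).

(* C^infinity regularity on an open set U: every iterated directional
   derivative is differentiable at every point of U. *)
Definition smooth_on (R : realType) (n m : nat) (U : set 'rV[R]_n)
    (f : 'rV[R]_n -> 'rV[R]_m) : Prop :=
  forall (vs : seq 'rV[R]_n) (p : 'rV[R]_n), U p ->
    differentiable (foldr (fun v g => 'D_v g) f vs) p.

(* The point z = x + iy is the row vector (x, y). *)
Definition disk (R : realType) : set 'rV[R]_2 := [set z | dot z z < 1].

Definition toC (R : realType) (n : nat) (u : 'rV[R]_n) : 'rV[R[i]]_n :=
  map_mx (fun x => x%:C) u.
Definition reC (R : realType) (n : nat) (u : 'rV[R[i]]_n) : 'rV[R]_n :=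
  map_mx (@complex.Re R) u.
Definition imC (R : realType) (n : nat) (u : 'rV[R[i]]_n) : 'rV[R]_n :=
  map_mx (@complex.Im R) u.

Definition Ic (R : realType) : R[i] := 0 +i* 1.

Definition partialC (R : realType) (n : nat) (k : 'I_2)
    (g : 'rV[R]_2 -> 'rV[R[i]]_n) (z : 'rV[R]_2) : 'rV[R[i]]_n :=
  toC ('D_(delta_mx 0 k) (@reC R n \o g) z)
  + Ic R *: toC ('D_(delta_mx 0 k) (@imC R n \o g) z).

Definition dz (R : realType) (n : nat) (g : 'rV[R]_2 -> 'rV[R[i]]_n)
    (z : 'rV[R]_2) : 'rV[R[i]]_n :=
  2^-1 *: (partialC 0 g z - Ic R *: partialC 1 g z).

Definition dzbar (R : realType) (n : nat) (g : 'rV[R]_2 -> 'rV[R[i]]_n)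
    (z : 'rV[R]_2) : 'rV[R[i]]_n :=
  2^-1 *: (partialC 0 g z + Ic R *: partialC 1 g z).

Definition smooth_conformal_immersion (R : realType) (n : nat)
    (Phi : 'rV[R]_2 -> 'rV[R]_n) : Prop :=
  [/\ smooth_on (@disk R) Phi,
      forall z v, disk z -> v != 0 -> 'D_v Phi z != 0
    & forall z, disk z -> dot (dz (@toC R n \o Phi) z) (dz (@toC R n \o Phi) z) = 0].

Definition conf_factor (R : realType) (Phi : 'rV[R]_2 -> 'rV[R]_3)
    (z : 'rV[R]_2) : R[i] :=
  dot (dz (@toC R 3 \o Phi) z) (dzbar (@toC R 3 \o Phi) z).

Definition gaussC (R : realType) (Phi : 'rV[R]_2 -> 'rV[R]_3)
    (z : 'rV[R]_2) : 'rV[R[i]]_3 :=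
  (Ic R * conf_factor Phi z)^-1 *:
    cross (dz (@toC R 3 \o Phi) z) (dzbar (@toC R 3 \o Phi) z).

Definition meanC (R : realType) (Phi : 'rV[R]_2 -> 'rV[R]_3)
    (z : 'rV[R]_2) : R[i] :=
  dot ((conf_factor Phi z)^-1 *: dz (dzbar (@toC R 3 \o Phi)) z) (gaussC Phi z).

Definition tracefree (R : realType) (Phi : 'rV[R]_2 -> 'rV[R]_3)
    (z : 'rV[R]_2) : R[i] :=
  2 * dot (dz (dz (@toC R 3 \o Phi)) z) (gaussC Phi z).

Definition umbilic (R : realType) (Phi : 'rV[R]_2 -> 'rV[R]_3) : set 'rV[R]_2 :=
  [set z | disk z /\ tracefree Phi z = 0].

(* For a conformal immersion gaussC and meanC take real values; taking real
   parts only changes the type. *)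
Definition gauss (R : realType) (Phi : 'rV[R]_2 -> 'rV[R]_3)
    (z : 'rV[R]_2) : 'rV[R]_3 := reC (gaussC Phi z).
Definition mean (R : realType) (Phi : 'rV[R]_2 -> 'rV[R]_3)
    (z : 'rV[R]_2) : R := complex.Re (meanC Phi z).

Definition conformal_gauss (R : realType) (Phi : 'rV[R]_2 -> 'rV[R]_3)
    (z : 'rV[R]_2) : 'rV[R]_5 :=
  let p := Phi z in let n := gauss Phi z in
  mean Phi z *: (row_mx (row_mx p (((dot p p - 1) / 2)%:M : 'rV_1))
                        (((dot p p + 1) / 2)%:M : 'rV_1) : 'rV[R]_(3 + 1 + 1))
  + (row_mx (row_mx n ((dot n p)%:M : 'rV_1))
            ((dot n p)%:M : 'rV_1) : 'rV[R]_(3 + 1 + 1)).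

(* Mean curvature in S^3 of a conformal immersion X into S^3, by the same
   formula as in R^3; the unit normal of X inside S^3 is the normalised triple
   product of X, X_z, X_zbar, and the component of X_{z zbar} normal to S^3 is
   orthogonal to it. *)
Definition mean_S3 (R : realType) (X : 'rV[R]_2 -> 'rV[R]_4) (z : 'rV[R]_2) : R :=
  let XC := @toC R 4 \o X in
  let e := dot (dz XC z) (dzbar XC z) in
  let N := (Ic R * e)^-1 *: cross4 (XC z) (dz XC z) (dzbar XC z) in
  complex.Re (dot (e^-1 *: dz (dzbar XC) z) N).

(* The same for the hyperboloid <Z,Z> = -1 of R^{3,1}. *)
Definition mean_H3 (R : realType) (Z : 'rV[R]_2 -> 'rV[R]_4) (z : 'rV[R]_2) : R :=
  let ZC := @toC R 4 \o Z in
  let e := lorentz (dz ZC z) (dzbar ZC z) in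
  let N := (Ic R * e)^-1 *: lcross4 (ZC z) (dz ZC z) (dzbar ZC z) in
  complex.Re (lorentz (e^-1 *: dz (dzbar ZC) z) N).

Definition first3 (R : realType) (p : 'rV[R]_4) : 'rV[R]_3 :=
  @lsubmx R 1 3 1 (p : 'rV[R]_(3 + 1)).

Definition mk4 (R : realType) (x : 'rV[R]_3) (t : R) : 'rV[R]_4 :=
  row_mx x (t%:M : 'rV_1).

Definition S3 (R : realType) : set 'rV[R]_4 := [set p | dot p p = 1].

Definition stereo_inv (R : realType) (x : 'rV[R]_3) : 'rV[R]_4 :=
  (1 + dot x x)^-1 *: mk4 (2 *: x) (dot x x - 1).

Definition hyp_inv (R : realType) (x : 'rV[R]_3) : 'rV[R]_4 :=
  (1 - dot x x)^-1 *: mk4 (2 *: x) (dot x x + 1).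

(* R^3 with a point at infinity is option 'rV[R]_3, None being infinity.  The
   maps below extend the stereographic projections pi and pi~ and their inverses.
   The formulas for pi~ and its inverse identify the complement of the unit
   sphere of R^3 + {oo} with the two-sheeted hyperboloid <y,y> = -1: the unit
   ball goes to H^3, its exterior to -H^3, and oo to (0, 0, 0, -1). *)
Definition stereo_oo (R : realType) (p : 'rV[R]_4) : option 'rV[R]_3 :=
  if p 0 ord_max == 1 then None else Some ((1 - p 0 ord_max)^-1 *: first3 p).

Definition stereo_inv_oo (R : realType) (w : option 'rV[R]_3) : 'rV[R]_4 :=
  if w is Some x then stereo_inv x else mk4 0 1.

Definition hyp_oo (R : realType) (y : 'rV[R]_4) : option 'rV[R]_3 :=
  if y 0 ord_max == -1 then None else Some ((1 + y 0 ord_max)^-1 *: first3 y).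

Definition hyp_inv_oo (R : realType) (w : option 'rV[R]_3) : 'rV[R]_4 :=
  if w is Some x then hyp_inv x else mk4 0 (-1).

Definition on_unit_sphere (R : realType) (w : option 'rV[R]_3) : Prop :=
  if w is Some x then dot x x = 1 else False.

(* F is a smooth extension of f|S^3 to the open neighbourhood U of p in R^4. *)
Definition local_extension (R : realType) (f : 'rV[R]_4 -> 'rV[R]_4)
    (p : 'rV[R]_4) (U : set 'rV[R]_4) (F : 'rV[R]_4 -> 'rV[R]_4) : Prop :=
  [/\ open U, U p, smooth_on U F & forall q, S3 q -> U q -> F q = f q].

Definition smooth_S3 (R : realType) (f : 'rV[R]_4 -> 'rV[R]_4) : Prop :=
  forall p, S3 p -> exists U F, local_extension f p U F.

(* On the tangent space of S^3 at p, the derivative of F is that of f. *)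
Definition conformal_S3 (R : realType) (f : 'rV[R]_4 -> 'rV[R]_4) : Prop :=
  forall p, S3 p -> exists U F, local_extension f p U F /\
    exists2 lambda : R, 0 < lambda &
      forall u w, dot u p = 0 -> dot w p = 0 ->
        dot ('D_u F p) ('D_w F p) = lambda * dot u w.

Definition conformal_diffeo_S3 (R : realType) (f : 'rV[R]_4 -> 'rV[R]_4) : Prop :=
  [/\ forall p, S3 p -> S3 (f p), smooth_S3 f, conformal_S3 f
    & exists g : 'rV[R]_4 -> 'rV[R]_4,
        [/\ forall p, S3 p -> S3 (g p), smooth_S3 g,
            forall p, S3 p -> g (f p) = p & forall p, S3 p -> f (g p) = p]].

(* The smooth and conformal structure of R^3 + {oo} is that of S^3. *)
Definition conformal_diffeo_R3oo (R : realType)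
    (phi : option 'rV[R]_3 -> option 'rV[R]_3) : Prop :=
  conformal_diffeo_S3 (@stereo_inv_oo R \o phi \o @stereo_oo R).

(* phi o Phi may take the value oo; its mean curvature in R^3 is considered
   where it is finite.  An immersion takes the value oo at isolated points
   only. *)
Definition has_mean_R3 (R : realType) (psi : 'rV[R]_2 -> option 'rV[R]_3)
    (c : R) : Prop :=
  forall z, disk z -> psi z <> None -> mean (odflt 0 \o psi) z = c.

Definition conformally_CMC_R3 (R : realType) (Phi : 'rV[R]_2 -> 'rV[R]_3) : Prop :=
  exists2 phi, conformal_diffeo_R3oo phi &
    exists c, has_mean_R3 (phi \o Some \o Phi) c.

Definition conformally_minimal_R3 (R : realType)
    (Phi : 'rV[R]_2 -> 'rV[R]_3) : Prop :=
  exists2 phi, conformal_diffeo_R3oo phi & has_mean_R3 (phi \o Some \o Phi) 0.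

Definition has_mean_S3 (R : realType) (X : 'rV[R]_2 -> 'rV[R]_4) (c : R) : Prop :=
  forall z, disk z -> mean_S3 X z = c.

Definition conformally_CMC_S3 (R : realType) (X : 'rV[R]_2 -> 'rV[R]_4) : Prop :=
  exists2 phi, conformal_diffeo_S3 phi & exists c, has_mean_S3 (phi \o X) c.

Definition conformally_minimal_S3 (R : realType)
    (X : 'rV[R]_2 -> 'rV[R]_4) : Prop :=
  exists2 phi, conformal_diffeo_S3 phi & has_mean_S3 (phi \o X) 0.

(* The conformal diffeomorphisms from H^3 onto itself are its isometries, so
   they do not change the mean curvature.  As in the case of R^3, phi is
   therefore a conformal diffeomorphism of the conformal compactification
   R^3 + {oo} of H^3, acting on Z through pi~.  The image of the surface may
   cross the sphere at infinity: its mean curvature is considered off that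
   sphere, in the hyperboloid H^3 + (-H^3), with the unit normal given on both
   sheets by the triple product of R^{3,1}. *)
Definition has_mean_H3 (R : realType) (psi : 'rV[R]_2 -> option 'rV[R]_3)
    (c : R) : Prop :=
  forall z, disk z -> ~ on_unit_sphere (psi z) -> mean_H3 (@hyp_inv_oo R \o psi) z = c.

Definition conformally_CMC_H3 (R : realType) (Z : 'rV[R]_2 -> 'rV[R]_4) : Prop :=
  exists2 phi, conformal_diffeo_R3oo phi &
    exists c, has_mean_H3 (phi \o @hyp_oo R \o Z) c.

Definition conformally_minimal_H3 (R : realType)
    (Z : 'rV[R]_2 -> 'rV[R]_4) : Prop :=
  exists2 phi, conformal_diffeo_R3oo phi & has_mean_H3 (phi \o @hyp_oo R \o Z) 0.

Definition spacelike (R : realType) (m : nat) (v : 'rV[R]_m.+1) : Prop :=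
  v != 0 /\ 0 < lorentz v v.
Definition lightlike (R : realType) (m : nat) (v : 'rV[R]_m.+1) : Prop :=
  v != 0 /\ lorentz v v = 0.
Definition timelike (R : realType) (m : nat) (v : 'rV[R]_m.+1) : Prop :=
  v != 0 /\ lorentz v v < 0.

Definition in_affine_hyperplane (R : realType) (m : nat) (kind : 'rV[R]_m.+1 -> Prop)
    (Y : 'rV[R]_2 -> 'rV[R]_m.+1) : Prop :=
  exists2 v, kind v & exists eta : R, forall z, disk z -> lorentz (Y z) v = eta.

Definition in_linear_hyperplane (R : realType) (m : nat) (kind : 'rV[R]_m.+1 -> Prop)
    (Y : 'rV[R]_2 -> 'rV[R]_m.+1) : Prop :=
  exists2 v, kind v & forall z, disk z -> lorentz (Y z) v = 0.

Definition nowhere_dense (R : realType) (A : set 'rV[R]_2) : Prop :=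
  interior (closure A) = set0.

(* Main.v *)
(* A point x of R^3 is represented by the null vector
   light x = (x, (|x|^2 - 1)/2, (|x|^2 + 1)/2) of R^{4,1}, and likewise a point of
   S^3 or of H^3 by a multiple of such a vector. For a null lift L of a surface, the
   linear form 2 det(L, L_x, L_y, Delta L, v) / (<L_x, L_x> + <L_y, L_y>)^2 in v does
   not change when L is multiplied by a function, and a Lorentz transformation A
   changes it only by det A = 1 or -1. For L = light o Phi it is - <Y, v>, and its
   values at v = (0, 1, 1), (0, 0, 1), (0, 1, 0) are, up to sign, the mean curvatures in
   R^3, S^3 and H^3. A conformal diffeomorphism of S^3 acts on null lifts as a
   Lorentz transformation (Liouville): rescaling the lift of the map makes it an
   isometric immersion of R^3 into the light cone, and such an immersion has constant
   second derivatives, hence is x |-> light x A. So the transformed surface has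
   constant mean curvature exactly when Y lies in the hyperplane with normal
   v = w A^-1, where w is one of the three vectors above, and the Lorentz group is
   transitive on lightlike lines, timelike lines and spacelike lines. Where
   <light o Phi, v> = 0 the transformed surface meets infinity and its mean curvature
   is undefined; the umbilic hypothesis makes this set nowhere dense. *)

(* Mean curvatures are built from derivatives, so null lifts must be known up to a smooth factor on
   open sets, not only at points. In each of the three geometries the lift of the transformed
   surface is normalised by its product -1 with the vector w of that geometry; hence it equals - u /
   <u, w>, where u = (light o Phi) A. This one formula yields the domain on which the transformed
   surface is finite, its smoothness there, and its mean curvature, and it lets the three cases
   share one proof.

   In Liouville's theorem, the metric determines the second derivatives of an isometric immersion M
   of R^3 into the cone only up to multiples of M: their products with M and with the first
   derivatives of M follow from <M, M> = 0 and from Koszul's argument. The remaining multiples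
   vanish by the symmetry of the third derivatives, which needs three distinct directions. In
   dimension 2 the statement fails: the complex exponential is a conformal immersion of the plane
   that is not a Moebius transformation. *)
Require Import Defs.
From mathcomp Require Import all_boot all_order all_algebra.
From mathcomp Require Import all_classical all_reals all_analysis.
From mathcomp Require Import complex ring lra.
Set Implicit Arguments.
Unset Strict Implicit.
Unset Printing Implicit Defensive.
Import Order.TTheory GRing.Theory Num.Theory.
Import numFieldNormedType.Exports.
Local Open Scope classical_set_scope.
Local Open Scope ring_scope.

(** * Smooth functions on open sets *)

Section Smooth.
Context {R : realType}.

(* Weaker than C^k: the derivatives of order at most k are only required to be
   differentiable, as in smooth_on. *)
Fixpoint Ck (V : normedModType R) (k : nat) (U : set V) (f : V -> R) : Prop :=
  (forall p, U p -> differentiable f p) /\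
  (if k is k'.+1 then forall v, Ck k' U ('D_v f) else True).

Lemma Ck_differentiable (V : normedModType R) k (U : set V) f p :
  Ck k U f -> U p -> differentiable f p.
Proof. by case: k => [|k] /= [+ _]; exact. Qed.

Lemma CkS (V : normedModType R) k (U : set V) f : Ck k.+1 U f -> Ck k U f.
Proof.
elim: k f => [|k IH] f [fU fv]; split=> // v.
by apply: IH; exact: fv.
Qed.

Lemma near_of_open (V : normedModType R) (U : set V) (P : V -> Prop) p :
  open U -> U p -> (forall q, U q -> P q) -> \forall q \near p, P q.
Proof.
by move=> oU Up UP; apply: filterS UP _; exact: open_nbhs_nbhs.
Qed.

Lemma derive_eq_on (V W : normedModType R) (U : set V) (f g : V -> W) p v :
  open U -> U p -> (forall q, U q -> f q = g q) -> 'D_v f p = 'D_v g p.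
Proof. by move=> oU Up fg; apply: near_eq_derive; exact: near_of_open fg. Qed.

(** The little-o expansion of [f] at [p] is also one of [g], since the functions agree near [p];
    uniqueness of the differential then identifies ['d g p] with ['d f p]. *)
Lemma differentiable_eq_on (V : normedModType R) (U : set V) (f g : V -> R) p :
  open U -> U p -> (forall q, U q -> f q = g q) ->
  differentiable f p -> differentiable g p.
Proof.
move=> oU Up fg df.
have fgp : \forall q \near (0 : V), f (q + p) = g (q + p).
  have := near_of_open oU Up fg.
  by rewrite (near_shift 0 p) /= subr0.
have gE : g \o shift p = cst (g p) + ('d f p : V -> R) +o_ (0 : V) id.
  apply/eqaddoP => e e0.
  have := diff_locally df => /eqaddoP /(_ e e0) H; near=> x.
  have -> : (g \o shift p - (cst (g p) + 'd f p)) x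
      = (f \o shift p - (cst (f p) + 'd f p)) x.
    rewrite /GRing.add /GRing.opp /= (fg p Up); congr (_ - _).
    by apply/esym; near: x.
  by near: x.
have E : 'd g p = 'd f p :> (V -> R) by apply: diff_unique gE; exact: diff_continuous.
by apply/diff_locallyP; rewrite E; split=> //; exact: diff_continuous.
Unshelve. all: by end_near. Qed.

Lemma Ck_eq (V : normedModType R) k (U : set V) (f g : V -> R) :
  open U -> (forall q, U q -> f q = g q) -> Ck k U f -> Ck k U g.
Proof.
move=> oU; elim: k f g => [|k IH] f g fg [fU fv]; split=> //;
  try by move=> p Up; apply: differentiable_eq_on fg _ => //; exact: fU.
by move=> v; apply: IH (fv v) => q Uq; exact: derive_eq_on fg.
Qed.

Lemma Ck_sub (V : normedModType R) k (U U' : set V) (f : V -> R) :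
  U' `<=` U -> Ck k U f -> Ck k U' f.
Proof.
move=> UU; elim: k f => [|k IH] f [fU fv]; split=> //; try by move=> p /UU/fU.
by move=> v; exact/IH/fv.
Qed.

Lemma Ck_local (V : normedModType R) k (U : set V) (f : V -> R) :
  (forall p, U p -> exists2 U', U' p & Ck k U' f) -> Ck k U f.
Proof.
elim: k f => [|k IH] f fU; split=> //;
  try by move=> p /fU[U' U'p [fU' _]]; exact: fU'.
by move=> v; apply: IH => p /fU[U' U'p [_ fv]]; exists U' => //; exact: fv.
Qed.

Lemma Ck_cst (V : normedModType R) k (U : set V) (a : R) : Ck k U (fun=> a).
Proof.
elim: k a => [|k IH] a; split=> //; try by move=> p _; exact: differentiable_cst.
by move=> v; rewrite (_ : 'D_v _ = fun=> 0) //; apply/funext => p; exact: derive_cst.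
Qed.

Lemma CkD (V : normedModType R) k (U : set V) (f g : V -> R) : open U ->
  Ck k U f -> Ck k U g -> Ck k U (fun x => f x + g x).
Proof.
move=> oU; elim: k f g => [|k IH] f g [fU fv] [gU gv];
  split=> //; try by move=> p Up; apply: differentiableD; [exact: fU|exact: gU].
move=> v; apply: (@Ck_eq _ _ _ (fun x => 'D_v f x + 'D_v g x)) => //; last by apply: IH; [exact: fv|exact: gv].
by move=> q Uq; rewrite -deriveD //; apply: diff_derivable; first [exact: fU|exact: gU].
Qed.

Lemma CkM (V : normedModType R) k (U : set V) (f g : V -> R) : open U ->
  Ck k U f -> Ck k U g -> Ck k U (fun x => f x * g x).
Proof.
move=> oU; elim: k f g => [|k IH] f g fk gk;
  have [fU fv] := fk; have [gU gv] := gk;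
  split=> //; try by move=> p Up; apply: differentiableM; [exact: fU|exact: gU].
move=> v; apply: (@Ck_eq _ _ _ (fun x => f x * 'D_v g x + g x * 'D_v f x)) => //.
  by move=> q Uq; rewrite -deriveM //; apply: diff_derivable; first [exact: fU|exact: gU].
by apply: CkD => //; apply: IH; first [exact: fv|exact: gv|exact: CkS].
Qed.

Lemma Ck_sum (V : normedModType R) k (U : set V) n (f : 'I_n -> V -> R) : open U ->
  (forall i, Ck k U (f i)) -> Ck k U (fun x => \sum_(i < n) f i x).
Proof.
move=> oU fk; elim: n f fk => [|n IH] f fk.
  by under eq_fun do rewrite big_ord0; exact: Ck_cst.
by under eq_fun do rewrite big_ord_recl; apply: CkD => //; exact: IH.
Qed.

Lemma CkV (V : normedModType R) k (U : set V) (f : V -> R) : open U ->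
  (forall x, U x -> f x != 0) -> Ck k U f -> Ck k U (fun x => (f x)^-1).
Proof.
move=> oU f0; elim: k => [|k IH] fk; have [fU fv] := fk;
  split=> //; try by move=> p Up; apply: differentiableV; [exact: fU|exact: f0].
move=> v; apply: (@Ck_eq _ _ _ (fun x => (-1) * ((f x)^-1 * (f x)^-1) * 'D_v f x)) => //.
  move=> q Uq; rewrite deriveV; [|exact: f0|apply: diff_derivable; exact: fU].
  by rewrite /GRing.scale /= expr2 invfM mulN1r.
have fk' := CkS fk; apply: CkM => //; last exact: fv.
by apply: CkM => //; [exact: Ck_cst|apply: CkM => //; exact: IH].
Qed.

Lemma derive_comp_real (V : normedModType R) (g : V -> R) (f : R -> R) p v :
  differentiable g p -> derivable f (g p) 1 ->
  'D_v (fun x => f (g x)) p = 'D_1 f (g p) * 'D_v g p.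
Proof.
move=> dg /derivable1_diffP df.
have dfg : differentiable (f \o g) p by exact: differentiable_comp.
rewrite (deriveE v dfg) diff_comp //= !deriveE //.
by rewrite -{1}(mulr1 ('d g p v)) [LHS]linearZ mulrC.
Qed.

Lemma Ck_sqrt (V : normedModType R) k (U : set V) (f : V -> R) : open U ->
  (forall x, U x -> 0 < f x) -> Ck k U f -> Ck k U (fun x => Num.sqrt (f x)).
Proof.
move=> oU f0; elim: k => [|k IH] fk; have [fU fv] := fk.
all: have dU p : U p -> differentiable (fun x => Num.sqrt (f x)) p.
all: try by (move=> Up; apply: (@differentiable_comp _ _ _ _ f (@Num.sqrt R));
  [exact: fU|apply/derivable1_diffP; have [] := is_derive1_sqrt (f0 _ Up)]).
all: split=> // v.
apply: (@Ck_eq _ _ _ (fun x => 2^-1 * (Num.sqrt (f x))^-1 * 'D_v f x)) => //.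
  move=> q Uq; rewrite derive_comp_real; last 2 first.
  - exact: fU.
  - by have [] := is_derive1_sqrt (f0 _ Uq).
  by rewrite derive_sqrt ?f0 // invfM.
apply: CkM => //; last exact: fv.
apply: CkM => //; first exact: Ck_cst.
apply: CkV => //; last exact/IH/CkS.
by move=> x Ux; rewrite gt_eqF // sqrtr_gt0 f0.
Qed.

Lemma Ck_coord k n (U : set 'rV[R]_n) j : Ck k U (fun x => x 0 j).
Proof.
case: k => [|k]; split=> //; try by move=> p _; exact: differentiable_coord.
move=> v; rewrite (_ : 'D_v _ = fun=> v 0 j); first exact: Ck_cst.
apply/funext => p; rewrite -[in RHS](derive_id p v).
rewrite derive_mx; last exact: derivable_id.
by rewrite mxE.
Qed.

Lemma differentiable_row (V : normedModType R) n (f : V -> 'rV[R]_n) p :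
  (forall j, differentiable (fun x => f x 0 j) p) -> differentiable f p.
Proof.
move=> df; rewrite (_ : f = \sum_(j < n) (fun x => f x 0 j *: delta_mx 0 j)).
  by apply: differentiable_sum => j; apply: differentiableZl.
by apply/funext => x; rewrite fct_sumE [LHS]row_sum_delta.
Qed.

Lemma derive_coord (V : normedModType R) n (f : V -> 'rV[R]_n) p v j :
  differentiable f p -> 'D_v f p 0 j = 'D_v (fun x => f x 0 j) p.
Proof. by move=> df; rewrite derive_mx ?mxE //; exact: diff_derivable. Qed.

Lemma differentiable_coord_comp (V : normedModType R) n (f : V -> 'rV[R]_n) p j :
  differentiable f p -> differentiable (fun x => f x 0 j) p.
Proof.
move=> df; apply: (@differentiable_comp _ _ _ _ f (fun M : 'rV[R]_n => M 0 j)) => //.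
exact: differentiable_coord.
Qed.

Lemma derive_comp (V V' W : normedModType R) (g : V -> V') (f : V' -> W) p v :
  differentiable g p -> differentiable f (g p) ->
  'D_v (fun x => f (g x)) p = 'D_('D_v g p) f (g p).
Proof.
move=> dg df; have dfg : differentiable (f \o g) p by exact: differentiable_comp.
by rewrite (deriveE v dfg) diff_comp //= !deriveE.
Qed.

Lemma derive_row_sum n (W : normedModType R) (f : 'rV[R]_n -> W) p v :
  differentiable f p -> 'D_v f p = \sum_(j < n) v 0 j *: 'D_(delta_mx 0 j) f p.
Proof.
move=> df; rewrite deriveE // [in LHS](row_sum_delta v) linear_sum.
by apply: eq_bigr => j _; rewrite linearZ /= deriveE.
Qed.

(** Chain rule in coordinates: a derivative of the composite is a sum of products of a derivative of
    [g] with a partial derivative of [f] composed with [g], so the induction on [k] keeps [g] fixed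
    and lets [f] vary. *)
Lemma Ck_comp (V : normedModType R) k n (U : set V) (W : set 'rV[R]_n)
    (g : V -> 'rV[R]_n) (f : 'rV[R]_n -> R) : open U ->
  (forall x, U x -> W (g x)) -> (forall j, Ck k U (fun x => g x 0 j)) ->
  Ck k W f -> Ck k U (fun x => f (g x)).
Proof.
move=> oU gW; elim: k f => [|k IH] f gk fk; have [fU fv] := fk.
all: have dg p : U p -> differentiable g p
  by move=> Up; apply: differentiable_row => j; exact: Ck_differentiable (gk j) Up.
all: have dU p : U p -> differentiable (fun x => f (g x)) p
  by move=> Up; apply: differentiable_comp; [exact: dg|exact/fU/gW].
all: split=> // v.
apply: (@Ck_eq _ _ _
  (fun x => \sum_(j < n) 'D_v (fun x => g x 0 j) x * 'D_(delta_mx 0 j) f (g x))) => //.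
  move=> q Uq; rewrite derive_comp; [|exact: dg|exact/fU/gW].
  rewrite derive_row_sum; last exact/fU/gW.
  by apply: eq_bigr => j _; rewrite derive_coord //; exact: dg.
apply: Ck_sum => // j; apply: CkM => //; first by have [_ gkv] := gk j; exact: gkv.
by apply: (IH ('D_(delta_mx 0 j) f)); [move=> i; exact: CkS|exact: fv].
Qed.

End Smooth.

Section SmoothRow.
Context {R : realType}.

Definition smooth (V : normedModType R) (U : set V) (f : V -> R) : Prop :=
  forall k, Ck k U f.

Definition row_smooth (V : normedModType R) n (U : set V) (f : V -> 'rV[R]_n) : Prop :=
  forall j, smooth U (fun x => f x 0 j).

Section ClosedUnder.
Context {V : normedModType R} {U : set V} (oU : open U).

Lemma smooth_derive f v : smooth U f -> smooth U ('D_v f).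
Proof. by move=> fU k; have [_] := fU k.+1; apply. Qed.

Lemma smooth_eq f g : (forall q, U q -> f q = g q) -> smooth U f -> smooth U g.
Proof. by move=> fg fU k; exact: Ck_eq (fU k). Qed.

Lemma smooth_cst a : smooth U (fun=> a).
Proof. by move=> k; exact: Ck_cst. Qed.

Lemma smoothD f g : smooth U f -> smooth U g -> smooth U (fun x => f x + g x).
Proof. by move=> fU gU k; exact: CkD. Qed.

Lemma smoothM f g : smooth U f -> smooth U g -> smooth U (fun x => f x * g x).
Proof. by move=> fU gU k; exact: CkM. Qed.

Lemma smoothN f : smooth U f -> smooth U (fun x => - f x).
Proof.
move=> fU; apply: (@smooth_eq (fun x => -1 * f x)) => [q _|]; first by rewrite mulN1r.
by apply: smoothM => //; exact: smooth_cst.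
Qed.

Lemma smoothB f g : smooth U f -> smooth U g -> smooth U (fun x => f x - g x).
Proof. by move=> fU gU; apply: smoothD => //; exact: smoothN. Qed.

Lemma smooth_sum n (f : 'I_n -> V -> R) : (forall i, smooth U (f i)) ->
  smooth U (fun x => \sum_(i < n) f i x).
Proof. by move=> fU k; apply: Ck_sum => // i; exact: fU. Qed.

Lemma smoothV f : (forall x, U x -> f x != 0) -> smooth U f ->
  smooth U (fun x => (f x)^-1).
Proof. by move=> f0 fU k; exact: CkV. Qed.

Lemma smooth_sqrt f : (forall x, U x -> 0 < f x) -> smooth U f ->
  smooth U (fun x => Num.sqrt (f x)).
Proof. by move=> f0 fU k; exact: Ck_sqrt. Qed.

Lemma smooth_comp n (W : set 'rV[R]_n) (g : V -> 'rV[R]_n) (f : 'rV[R]_n -> R) :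
  (forall x, U x -> W (g x)) -> row_smooth U g -> smooth W f ->
  smooth U (fun x => f (g x)).
Proof. by move=> UW gU fW k; apply: Ck_comp (fW k) => // j; exact: gU. Qed.

Lemma smooth_differentiable f p : smooth U f -> U p -> differentiable f p.
Proof. by move=> fU; exact: Ck_differentiable (fU 0). Qed.

Lemma row_smooth_differentiable n (f : V -> 'rV[R]_n) p :
  row_smooth U f -> U p -> differentiable f p.
Proof.
by move=> fU Up; apply: differentiable_row => j; exact: smooth_differentiable (fU j) Up.
Qed.

Lemma row_smooth_derivable n (f : V -> 'rV[R]_n) p v :
  row_smooth U f -> U p -> derivable f p v.
Proof. by move=> fU Up; apply: diff_derivable; exact: row_smooth_differentiable. Qed.

Lemma row_smooth_derive n (f : V -> 'rV[R]_n) v :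
  row_smooth U f -> row_smooth U ('D_v f).
Proof.
move=> fU j; apply: smooth_eq (smooth_derive v (fU j)) => q Uq.
by rewrite derive_coord //; exact: row_smooth_differentiable.
Qed.

Lemma row_smooth_eq n (f g : V -> 'rV[R]_n) :
  (forall q, U q -> f q = g q) -> row_smooth U f -> row_smooth U g.
Proof. by move=> fg fU j; apply: smooth_eq (fU j) => q /fg ->. Qed.

Lemma row_smooth_comp m n (W : set 'rV[R]_n) (g : V -> 'rV[R]_n)
    (f : 'rV[R]_n -> 'rV[R]_m) :
  (forall x, U x -> W (g x)) -> row_smooth U g -> row_smooth W f ->
  row_smooth U (fun x => f (g x)).
Proof. by move=> UW gU fW j; exact: smooth_comp (fW j). Qed.

Lemma row_smooth_cst n (a : 'rV[R]_n) : row_smooth U (fun=> a).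
Proof. by move=> j; exact: smooth_cst. Qed.

Lemma row_smoothZ n f (L : V -> 'rV[R]_n) :
  smooth U f -> row_smooth U L -> row_smooth U (fun z => f z *: L z).
Proof.
by move=> fU LU j; under eq_fun do rewrite mxE; exact: smoothM.
Qed.

Lemma row_smoothD n (L M : V -> 'rV[R]_n) :
  row_smooth U L -> row_smooth U M -> row_smooth U (fun z => L z + M z).
Proof.
by move=> fU LU j; under eq_fun do rewrite mxE; exact: smoothD.
Qed.

Lemma row_smooth_mulmx m n (L : V -> 'rV[R]_n) (A : 'M[R]_(n, m)) :
  row_smooth U L -> row_smooth U (fun z => L z *m A).
Proof.
move=> LU j; under eq_fun do rewrite mxE.
by apply: smooth_sum => i; apply: smoothM => //; exact: smooth_cst.
Qed.

Lemma smooth_dot n (L M : V -> 'rV[R]_n) :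
  row_smooth U L -> row_smooth U M -> smooth U (fun z => dot (L z) (M z)).
Proof. by move=> LU MU; apply: smooth_sum => i; exact: smoothM. Qed.

Lemma smooth_lorentz n (L M : V -> 'rV[R]_n.+1) :
  row_smooth U L -> row_smooth U M -> smooth U (fun z => lorentz (L z) (M z)).
Proof.
move=> LU MU; apply: smoothB; last exact: smoothM.
by apply: smooth_sum => i; exact: smoothM.
Qed.

End ClosedUnder.

Lemma smooth_sub (V : normedModType R) (U U' : set V) f :
  U' `<=` U -> smooth U f -> smooth U' f.
Proof. by move=> UU fU k; exact: Ck_sub (fU k). Qed.

Lemma row_smooth_sub (V : normedModType R) n (U U' : set V) (f : V -> 'rV[R]_n) :
  U' `<=` U -> row_smooth U f -> row_smooth U' f.
Proof. by move=> UU fU j; exact: smooth_sub (fU j). Qed.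

Lemma row_smooth_local (V : normedModType R) n (U : set V) (f : V -> 'rV[R]_n) :
  (forall p, U p -> exists2 U', U' p & row_smooth U' f) -> row_smooth U f.
Proof.
move=> fU j k; apply: Ck_local => p /fU[U' U'p fU'].
by exists U' => //; exact: fU'.
Qed.

Lemma row_smooth_id n (U : set 'rV[R]_n) : row_smooth U id.
Proof. by move=> j k; exact: Ck_coord. Qed.

Lemma smooth_onP n m (U : set 'rV[R]_n) (f : 'rV[R]_n -> 'rV[R]_m) : open U ->
  smooth_on U f <-> row_smooth U f.
Proof.
move=> oU; split=> [|fU vs]; last first.
  suff H : row_smooth U (foldr (fun v g => 'D_v g) f vs).
    by move=> p Up; apply: row_smooth_differentiable Up.
  by elim: vs => //= v vs IH; exact: row_smooth_derive.
move=> fU j k; elim: k f fU => [|k IH] f fU; split=> //;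
  try by move=> p Up; apply: differentiable_coord_comp; exact: (fU [::]).
move=> v; apply: (@Ck_eq _ _ _ _ (fun x => 'D_v f x 0 j)) => //.
  by move=> q Uq; rewrite derive_coord //; exact: (fU [::]).
(* [foldr] applies the last vector of its list first, so one more inner derivative appends [v] at
   the end. *)
apply: IH => vs p Up; rewrite (_ : foldr _ _ _ = foldr (fun v g => 'D_v g) f (rcons vs v)).
  exact: fU.
by rewrite foldr_rcons.
Qed.

(** * Product rules for vector-valued functions *)

Section Leibniz.
Context {V : normedModType R}.

Lemma derive_scale n (f : V -> R) (L : V -> 'rV[R]_n) p v :
  differentiable f p -> differentiable L p ->
  'D_v (fun z => f z *: L z) p = f p *: 'D_v L p + 'D_v f p *: L p.
Proof.
move=> df dL; have dLj j := differentiable_coord_comp j dL.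
have dfL : differentiable (fun z => f z *: L z) p.
  apply: differentiable_row => j; under eq_fun do rewrite mxE.
  exact: differentiableM.
apply/rowP => j; rewrite derive_coord // !mxE derive_coord //.
under eq_fun do rewrite mxE.
rewrite deriveM; [|exact: diff_derivable|exact: diff_derivable].
by rewrite [X in _ + X]mulrC.
Qed.

Lemma derive_mulmx m n (L : V -> 'rV[R]_n) (A : 'M[R]_(n, m)) p v :
  differentiable L p -> 'D_v (fun z => L z *m A) p = 'D_v L p *m A.
Proof.
move=> dL; have dLj j := differentiable_coord_comp j dL.
have H j : (fun z => (L z *m A) 0 j) = \sum_i (fun z => A i j * L z 0 i).
  apply/funext => z; rewrite fct_sumE mxE.
  by apply: eq_bigr => i _; rewrite mulrC.
have dLA : differentiable (fun z => L z *m A) p.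
  apply: differentiable_row => j; rewrite H; apply: differentiable_sum => i.
  by apply: differentiableM => //; exact: differentiable_cst.
apply/rowP => j; rewrite derive_coord // H derive_sum => [|i]; last first.
  by apply: diff_derivable; apply: differentiableM => //; exact: differentiable_cst.
rewrite mxE; apply: eq_bigr => i _.
by rewrite deriveMl ?derive_coord //; [exact: mulrC|exact: diff_derivable].
Qed.

Lemma derive_lorentz n (L M : V -> 'rV[R]_n.+1) p v :
  differentiable L p -> differentiable M p ->
  'D_v (fun z => lorentz (L z) (M z)) p =
    lorentz ('D_v L p) (M p) + lorentz (L p) ('D_v M p).
Proof.
move=> dL dM; have dLj j := differentiable_coord_comp j dL.
have dMj j := differentiable_coord_comp j dM.
have d j : derivable (fun z => L z 0 j * M z 0 j) p v.
  by apply: derivableM; exact: diff_derivable.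
have E j : 'D_v (fun z => L z 0 j * M z 0 j) p =
    'D_v L p 0 j * M p 0 j + L p 0 j * 'D_v M p 0 j.
  rewrite deriveM; [|exact: diff_derivable|exact: diff_derivable].
  by rewrite !derive_coord // addrC; congr (_ + _); exact: mulrC.
rewrite (_ : (fun z => _) = (\sum_(i < n)
    (fun z => L z 0 (widen_ord (leqnSn n) i) * M z 0 (widen_ord (leqnSn n) i)))
    - (fun z => L z 0 ord_max * M z 0 ord_max)); last first.
  by apply/funext => z; rewrite /lorentz /GRing.add /GRing.opp /= fct_sumE.
rewrite deriveB //; last exact: derivable_sum.
rewrite derive_sum // E /lorentz.
under eq_bigr do rewrite E.
by rewrite big_split /= opprD addrACA.
Qed.

Lemma derive_dot n (L M : V -> 'rV[R]_n) p v :
  differentiable L p -> differentiable M p ->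
  'D_v (fun z => dot (L z) (M z)) p =
    dot ('D_v L p) (M p) + dot (L p) ('D_v M p).
Proof.
move=> dL dM; have dLj j := differentiable_coord_comp j dL.
have dMj j := differentiable_coord_comp j dM.
rewrite (_ : (fun z => _) = \sum_(i < n) (fun z => L z 0 i * M z 0 i)); last first.
  by apply/funext => z; rewrite fct_sumE.
rewrite derive_sum => [|i]; last by apply: derivableM; exact: diff_derivable.
rewrite -big_split; apply: eq_bigr => i _ /=.
rewrite deriveM; [|exact: diff_derivable|exact: diff_derivable].
by rewrite !derive_coord // addrC; congr (_ + _); exact: mulrC.
Qed.

End Leibniz.

End SmoothRow.

(** * Symmetry of second derivatives *)

Section Schwarz.
Context {R : realType} {V : normedModType R}.

Lemma is_derive_line (f : V -> R) (p u : V) (t : R) :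
  differentiable f (p + t *: u) ->
  is_derive t (1 : R) (fun t => f (p + t *: u)) ('D_u f (p + t *: u)).
Proof.
move=> df; have dz : differentiable (fun t : R => t *: u) t.
  by apply: (differentiableZl (k := @id R)).
have dl : differentiable (fun t : R => p + t *: u) t.
  exact: differentiableD.
have E : 'D_1 (fun t : R => p + t *: u) t = u.
  rewrite deriveE // diffD // diff_cst (diffZl (k := @id R)) //= diff_val.
  by rewrite [LHS]add0r scale1r.
apply: DeriveDef; first by apply: diff_derivable; exact: differentiable_comp.
by rewrite derive_comp // E.
Qed.

Lemma mvt_line (f : V -> R) (p u : V) (h : R) : (forall q, differentiable f q) ->
  0 < h -> exists2 c, 0 < c < h & f (p + h *: u) - f p = 'D_u f (p + c *: u) * h.
Proof.
move=> df h0.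
have dl t : is_derive t (1 : R) (fun t => f (p + t *: u)) ('D_u f (p + t *: u)).
  exact: is_derive_line.
have [] := MVT h0 (fun x _ => dl x).
  apply: continuous_subspaceT => t.
  by apply: differentiable_continuous; apply/derivable1_diffP; have [] := dl t.
by move=> c; rewrite in_itv /= scale0r addr0 subr0 => ch e; exists c.
Qed.

Lemma derive_eq0_cst (f : V -> R) : (forall q, differentiable f q) ->
  (forall q v, 'D_v f q = 0) -> forall x y, f x = f y.
Proof.
move=> df f0 x y; have [c _] := mvt_line y (x - y) df ltr01.
by rewrite f0 mul0r scale1r [y + _]addrC subrK => /eqP; rewrite subr_eq0 => /eqP.
Qed.

(** The mean value theorem is used twice: along [u] for the increment q |-> f (q + h v) - f q, then
    along [v] for ['D_u f]. The left side is symmetric in [u] and [v], which is what [derive_swap]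
    exploits. *)
Lemma second_difference (f : V -> R) (p u v : V) (h : R) :
  (forall q, differentiable f q) -> (forall q, differentiable ('D_u f) q) ->
  0 < h -> exists c d, [/\ 0 < c < h, 0 < d < h &
    (f (p + h *: v + h *: u) - f (p + h *: u)) - (f (p + h *: v) - f p) =
    'D_v ('D_u f) (p + c *: u + d *: v) * h * h].
Proof.
move=> df duf h0; pose g q := f (q + h *: v) - f q.
have dfv q : differentiable (fun q => f (q + h *: v)) q.
  by apply: (@differentiable_comp _ _ _ _ (fun q => q + h *: v) f) => //; exact: differentiableD.
have dg q : differentiable g q by exact: differentiableB.
have [c ch E1] := mvt_line p u dg h0.
have [d dh E2] := mvt_line (p + c *: u) v duf h0.
exists c, d; split=> //; rewrite -E2.
have -> : 'D_u f (p + c *: u + h *: v) - 'D_u f (p + c *: u) = 'D_u g (p + c *: u).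
  rewrite deriveB; [|exact: diff_derivable|exact: diff_derivable]; congr (_ - _).
  have dsh q : differentiable (fun q : V => q + h *: v) q by exact: differentiableD.
  rewrite (derive_comp (g := fun q : V => q + h *: v)) //.
  by rewrite deriveD // derive_id derive_cst addr0.
rewrite -E1 /g; do 2![congr (_ - _)]; first by rewrite addrAC.
Qed.

Lemma derive_swap (f : V -> R) (p u v : V) : smooth setT f ->
  'D_v ('D_u f) p = 'D_u ('D_v f) p.
Proof.
move=> fs; apply/eqP; rewrite -subr_eq0; apply/negPn/negP => ne.
have dd (w : V) (g : V -> R) : smooth setT g -> forall q, differentiable ('D_w g) q.
  by move=> gs q; apply: smooth_differentiable (smooth_derive w gs) _.
have df q : differentiable f q by exact: smooth_differentiable fs _.
(* Half of the supposed gap: if each mixed derivative varies by less than [e] near [p], the gap is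
   less than [e + e], that is, less than itself. *)
pose e := `|'D_v ('D_u f) p - 'D_u ('D_v f) p| / 2.
have e0 : 0 < e by rewrite divr_gt0 ?normr_gt0.
have cont w w' : \forall q \near p, `|'D_w ('D_w' f) p - 'D_w ('D_w' f) q| < e.
  have c : {for p, continuous ('D_w ('D_w' f))}.
    by apply: differentiable_continuous; apply: dd; exact: smooth_derive.
  by move/cvgrPdist_lt: c; apply.
have /nbhs_ballP[r1 /= r10 H1] := cont v u.
have /nbhs_ballP[r2 /= r20 H2] := cont u v.
pose r := Num.min r1 r2.
have r0 : 0 < r by rewrite lt_min r10.
have H q : ball p r q -> `|'D_v ('D_u f) p - 'D_v ('D_u f) q| < e /\
                         `|'D_u ('D_v f) p - 'D_u ('D_v f) q| < e.
  move=> rq; split; [apply: H1|apply: H2]; apply: le_ball rq.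
    by rewrite ge_min lexx.
  by rewrite ge_min lexx orbT.
have N0 : 0 < `|u| + `|v| + 1 by rewrite ltr_wpDl // addr_ge0.
(* The summand 1 keeps the denominator positive, and for c, d between 0 and h the points p + c u + d
   v stay in the ball of radius [r]. *)
pose h := r / (`|u| + `|v| + 1).
have h0 : 0 < h by rewrite divr_gt0.
have near_p (c d : R) (a b : V) : `|a| + `|b| = `|u| + `|v| -> 0 < c < h -> 0 < d < h ->
    ball p r (p + c *: a + d *: b).
  move=> ab /andP[c0 ch] /andP[d0 dh]; rewrite -ball_normE /= opprD addrA opprD addrA subrr sub0r.
  rewrite -opprD normrN (le_lt_trans (ler_normD _ _)) // !normrZ !gtr0_norm //.
  apply: (@le_lt_trans _ _ (h * (`|u| + `|v|))).
    by rewrite -ab mulrDr lerD // ler_wpM2r // ltW.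
  rewrite /h mulrAC ltr_pdivrMr // ltr_pM2l //; by rewrite ltrDl.
have [c [d [ch dh E]]] := second_difference p v df (dd u f fs) h0.
have [c' [d' [ch' dh' E']]] := second_difference p u df (dd v f fs) h0.
have := E; rewrite [X in X = _](_ : _ =
  'D_u ('D_v f) (p + c' *: v + d' *: u) * h * h); last first.
  by rewrite -E' (addrAC p); ring.
move=> /(mulIf (lt0r_neq0 h0)) /(mulIf (lt0r_neq0 h0)) EE.
have [h1 _] := H _ (near_p _ _ _ _ erefl ch dh).
have [_ h2] := H _ (near_p _ _ _ _ (addrC _ _) ch' dh').
have : `|'D_v ('D_u f) p - 'D_u ('D_v f) p| < e + e.
  rewrite -EE in h1.
  apply: le_lt_trans (ler_distD ('D_u ('D_v f) (p + c' *: v + d' *: u)) _ _) _.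
  by apply: ltrD; [exact: h1|rewrite distrC; exact: h2].
by rewrite -mulr2n /e -[_ / 2 *+ 2]mulr_natr divfK ?ltxx // pnatr_eq0.
Qed.

End Schwarz.

(** * Explicit determinants and bilinear forms *)

Section Explicit.
Context {K : comNzRingType}.

(** Rows given by lists: once all vectors have this form, identities between products and
    determinants become polynomial identities in the entries, which [ring] decides. *)
Definition rowl n (s : seq K) : 'rV[K]_n := \row_(j < n) nth 0 s j.

Lemma row3E (u : 'rV[K]_3) : exists a b c, u = rowl 3 [:: a; b; c].
Proof.
exists (u 0 (inord 0)), (u 0 (inord 1)), (u 0 (inord 2)).
by apply/rowP => -[[|[|[|]]] // j3]; rewrite mxE /=; congr (u _ _); apply/val_inj; rewrite /= inordK.
Qed.

Lemma row4E (u : 'rV[K]_4) : exists a b c d, u = rowl 4 [:: a; b; c; d].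
Proof.
exists (u 0 (inord 0)), (u 0 (inord 1)), (u 0 (inord 2)), (u 0 (inord 3)).
by apply/rowP => -[[|[|[|[|]]]] // j3]; rewrite mxE /=; congr (u _ _); apply/val_inj; rewrite /= inordK.
Qed.

Lemma row5E (u : 'rV[K]_5) : exists a b c d e, u = rowl 5 [:: a; b; c; d; e].
Proof.
exists (u 0 (inord 0)), (u 0 (inord 1)), (u 0 (inord 2)), (u 0 (inord 3)), (u 0 (inord 4)).
by apply/rowP => -[[|[|[|[|[|]]]]] // j3]; rewrite mxE /=; congr (u _ _); apply/val_inj; rewrite /= inordK.
Qed.

(** Entries are indexed by natural numbers so that iterated expansion along the first row computes,
    minors being obtained by shifting and [bump]. *)
Definition detn n (f : nat -> nat -> K) : K := \det (\matrix_(i < n, j < n) f i j).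

Lemma detn_rec n (f : nat -> nat -> K) :
  detn n.+1 f =
  \sum_(j < n.+1) f 0%N j * ((-1) ^+ j * detn n (fun i k => f i.+1 (bump j k))).
Proof.
rewrite /detn (expand_det_row _ ord0); apply: eq_bigr => j _.
rewrite /cofactor !mxE add0n; do 2![congr (_ * _)]; congr (\det _).
by apply/matrixP => i k; rewrite !mxE.
Qed.

Lemma detn0 (f : nat -> nat -> K) : detn 0 f = 1.
Proof. exact: det_mx00. Qed.

Definition det3s (f : nat -> nat -> K) : K :=
  f 0%N 0%N * (f 1%N 1%N * f 2%N 2%N - f 1%N 2%N * f 2%N 1%N) - f 0%N 1%N * (f 1%N 0%N * f 2%N 2%N - f 1%N 2%N * f 2%N 0%N)
  + f 0%N 2%N * (f 1%N 0%N * f 2%N 1%N - f 1%N 1%N * f 2%N 0%N).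

Lemma detn3 (f : nat -> nat -> K) : detn 3 f = det3s f.
Proof.
do 3![rewrite !detn_rec !big_ord_recl !big_ord0].
rewrite !detn0 /= /det3s /bump /=; ring.
Qed.

Definition det4s (f : nat -> nat -> K) : K :=
  f 0%N 0%N * det3s (fun i j => f i.+1 j.+1) - f 0%N 1%N * det3s (fun i j => f i.+1 (bump 1 j))
  + f 0%N 2%N * det3s (fun i j => f i.+1 (bump 2 j)) - f 0%N 3%N * det3s (fun i j => f i.+1 j).

Lemma detn4 (f : nat -> nat -> K) : detn 4 f = det4s f.
Proof.
rewrite detn_rec !big_ord_recl !big_ord0 !detn3 /= /det4s /det3s /bump /=; ring.
Qed.

Definition det5s (f : nat -> nat -> K) : K :=
  f 0%N 0%N * det4s (fun i j => f i.+1 j.+1) - f 0%N 1%N * det4s (fun i j => f i.+1 (bump 1 j))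
  + f 0%N 2%N * det4s (fun i j => f i.+1 (bump 2 j)) - f 0%N 3%N * det4s (fun i j => f i.+1 (bump 3 j))
  + f 0%N 4%N * det4s (fun i j => f i.+1 j).

Lemma detn5 (f : nat -> nat -> K) : detn 5 f = det5s f.
Proof.
rewrite detn_rec !big_ord_recl !big_ord0 !detn4 /= /det5s /det4s /det3s /bump /=; ring.
Qed.

End Explicit.

Section Bilinear.
Context {K : comNzRingType}.

Definition gram_mx n : 'M[K]_n.+1 :=
  diag_mx (\row_j (if j == ord_max then -1 else 1)).

Lemma lorentzE n (u v : 'rV[K]_n.+1) : lorentz u v = (u *m gram_mx n *m v^T) 0 0.
Proof.
rewrite mxE big_ord_recr /=; congr (_ + _).
  apply: eq_bigr => i _; rewrite mul_mx_diag !mxE /= -val_eqE /= ltn_eqF ?mulr1 //.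
by rewrite mul_mx_diag !mxE eqxx mulrN1 mulNr.
Qed.

Lemma lorentzC n (u v : 'rV[K]_n.+1) : lorentz u v = lorentz v u.
Proof. by rewrite /lorentz; congr (_ - _); [apply: eq_bigr => i _|]; rewrite mulrC. Qed.

Lemma lorentzDl n (u u' v : 'rV[K]_n.+1) : lorentz (u + u') v = lorentz u v + lorentz u' v.
Proof. by rewrite !lorentzE !mulmxDl mxE. Qed.

Lemma lorentzZl n a (u v : 'rV[K]_n.+1) : lorentz (a *: u) v = a * lorentz u v.
Proof. by rewrite !lorentzE -!scalemxAl mxE. Qed.

Lemma lorentzDr n (u u' v : 'rV[K]_n.+1) : lorentz v (u + u') = lorentz v u + lorentz v u'.
Proof. by rewrite ![lorentz v _]lorentzC lorentzDl. Qed.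

Lemma lorentzZr n a (u v : 'rV[K]_n.+1) : lorentz v (a *: u) = a * lorentz v u.
Proof. by rewrite ![lorentz v _]lorentzC lorentzZl. Qed.

Lemma lorentzNl n (u v : 'rV[K]_n.+1) : lorentz (- u) v = - lorentz u v.
Proof. by rewrite -scaleN1r lorentzZl mulN1r. Qed.

Lemma lorentzNr n (u v : 'rV[K]_n.+1) : lorentz v (- u) = - lorentz v u.
Proof. by rewrite ![lorentz v _]lorentzC lorentzNl. Qed.

Lemma lorentz0l n (v : 'rV[K]_n.+1) : lorentz 0 v = 0.
Proof. by rewrite -(scale0r 0) lorentzZl mul0r. Qed.

Lemma lorentz0r n (v : 'rV[K]_n.+1) : lorentz v 0 = 0.
Proof. by rewrite lorentzC lorentz0l. Qed.

Definition lorentz_bilin := (lorentzDl, lorentzDr, lorentzZl, lorentzZr,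
  lorentzNl, lorentzNr, lorentz0l, lorentz0r).

Lemma dotC n (u v : 'rV[K]_n) : dot u v = dot v u.
Proof. by apply: eq_bigr => i _; rewrite mulrC. Qed.

Lemma dotE n (u v : 'rV[K]_n) : dot u v = (u *m v^T) 0 0.
Proof. by rewrite mxE; apply: eq_bigr => i _; rewrite mxE. Qed.

Lemma dotDl n (u u' v : 'rV[K]_n) : dot (u + u') v = dot u v + dot u' v.
Proof. by rewrite !dotE mulmxDl mxE. Qed.

Lemma dotZl n a (u v : 'rV[K]_n) : dot (a *: u) v = a * dot u v.
Proof. by rewrite !dotE -scalemxAl mxE. Qed.

Lemma dotDr n (u u' v : 'rV[K]_n) : dot v (u + u') = dot v u + dot v u'.
Proof. by rewrite ![dot v _]dotC dotDl. Qed.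

Lemma dotZr n a (u v : 'rV[K]_n) : dot v (a *: u) = a * dot v u.
Proof. by rewrite ![dot v _]dotC dotZl. Qed.

Lemma dotNl n (u v : 'rV[K]_n) : dot (- u) v = - dot u v.
Proof. by rewrite -scaleN1r dotZl mulN1r. Qed.

Lemma dotNr n (u v : 'rV[K]_n) : dot v (- u) = - dot v u.
Proof. by rewrite ![dot v _]dotC dotNl. Qed.

Lemma dot0l n (v : 'rV[K]_n) : dot 0 v = 0.
Proof. by rewrite -(scale0r 0) dotZl mul0r. Qed.

Lemma dot0r n (v : 'rV[K]_n) : dot v 0 = 0.
Proof. by rewrite dotC dot0l. Qed.

Lemma lorentz_rowl5 a b c d e a' b' c' d' e' :
  @lorentz K 4 (rowl 5 [:: a; b; c; d; e]) (rowl 5 [:: a'; b'; c'; d'; e']) =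
  a * a' + b * b' + c * c' + d * d' - e * e'.
Proof. by rewrite /lorentz !big_ord_recl big_ord0 !mxE /= addr0 !addrA. Qed.

Lemma dot_rowl3 a b c a' b' c' :
  @dot K 3 (rowl 3 [:: a; b; c]) (rowl 3 [:: a'; b'; c']) = a * a' + b * b' + c * c'.
Proof. by rewrite /dot !big_ord_recl big_ord0 !mxE /= addr0 !addrA. Qed.

Lemma dot_rowl4 a b c d a' b' c' d' :
  @dot K 4 (rowl 4 [:: a; b; c; d]) (rowl 4 [:: a'; b'; c'; d']) =
  a * a' + b * b' + c * c' + d * d'.
Proof. by rewrite /dot !big_ord_recl big_ord0 !mxE /= addr0 !addrA. Qed.

Lemma rowl_add n (s t : seq K) : size s = size t ->
  rowl n s + rowl n t = rowl n [seq x.1 + x.2 | x <- zip s t].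
Proof.
move=> st; apply/rowP => j; rewrite !mxE.
have [js|js] := ltnP j (size s).
  by rewrite (nth_map (0, 0)) ?size_zip ?st ?minnn -?st // nth_zip.
by rewrite !nth_default ?addr0 // ?size_map ?size_zip -?st // minnn.
Qed.

Lemma rowl_scale n a (s : seq K) : a *: rowl n s = rowl n [seq a * x | x <- s].
Proof.
apply/rowP => j; rewrite !mxE.
have [js|js] := ltnP j (size s); first by rewrite (nth_map 0).
by rewrite !nth_default ?mulr0 // size_map.
Qed.

End Bilinear.

(** * The Lorentz group *)

Section LorentzGroup.
Context {R : realType}.

Definition lorentz_isom n (A : 'M[R]_n.+1) : Prop :=
  forall u v, lorentz (u *m A) (v *m A) = lorentz u v.

Lemma gram_mxK n : gram_mx n *m gram_mx n = 1%:M :> 'M[R]_n.+1.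
Proof.
apply/matrixP => i j; rewrite mul_mx_diag !mxE.
have [->|_] := eqVneq i j; last by rewrite !mulr0n mul0r.
by case: (j == ord_max); rewrite ?mulrNN mulr1.
Qed.

Lemma lorentz_isomP n (A : 'M[R]_n.+1) :
  lorentz_isom A <-> A *m gram_mx n *m A^T = gram_mx n.
Proof.
split=> [iA|AJ u v]; last first.
  by rewrite !lorentzE trmx_mul !mulmxA -2!(mulmxA u) AJ.
apply/matrixP => i j.
have := iA (delta_mx 0 i) (delta_mx 0 j).
rewrite !lorentzE trmx_mul !mulmxA -2!(mulmxA (delta_mx 0 i)).
by rewrite trmx_delta -!rowE -!colE !mxE.
Qed.

Lemma lorentz_isom_unit n (A : 'M[R]_n.+1) : lorentz_isom A -> A \in unitmx.
Proof.
move=> /lorentz_isomP AJ; have : A *m (gram_mx n *m A^T *m gram_mx n) = 1%:M.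
  by rewrite !mulmxA AJ gram_mxK.
by case/mulmx1_unit.
Qed.

Lemma lorentz_isomV n (A : 'M[R]_n.+1) : lorentz_isom A -> lorentz_isom (invmx A).
Proof. by move=> iA u v; rewrite -iA !mulmxKV //; exact: lorentz_isom_unit. Qed.

Lemma lorentz_isom_adj n (A : 'M[R]_n.+1) u v : lorentz_isom A ->
  lorentz (u *m A) v = lorentz u (v *m invmx A).
Proof. by move=> iA; rewrite -[RHS]iA mulmxKV //; exact: lorentz_isom_unit. Qed.

Lemma lorentz_isom_det n (A : 'M[R]_n.+1) : lorentz_isom A -> \det A * \det A = 1.
Proof.
move=> /lorentz_isomP /(congr1 determinant); rewrite !det_mulmx det_tr => E.
have J0 : \det (gram_mx n : 'M[R]_n.+1) != 0.
  by rewrite -unitfE -unitmxE; case/mulmx1_unit: (@gram_mxK n).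
by apply: (mulIf J0); rewrite mul1r -[RHS]E mulrAC.
Qed.

Lemma lorentz_isom1 n : lorentz_isom (1%:M : 'M[R]_n.+1).
Proof. by move=> u v; rewrite !mulmx1. Qed.

Lemma lorentz_reflection n (a : 'rV[R]_n.+1) : lorentz a a != 0 ->
  exists2 A, lorentz_isom A &
    forall u, u *m A = u - (2 * lorentz u a / lorentz a a) *: a.
Proof.
move=> a0; pose A : 'M[R]_n.+1 := 1%:M - (2 / lorentz a a) *: (gram_mx n *m a^T *m a).
have AE u : u *m A = u - (2 * lorentz u a / lorentz a a) *: a.
  rewrite mulmxBr mulmx1 -scalemxAr !mulmxA [u *m _ *m _]mx11_scalar -lorentzE.
  by rewrite mul_scalar_mx scalerA mulrAC.
exists A => // u v; rewrite !AE !lorentz_bilin (lorentzC a v).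
by field.
Qed.

(* At least one of v - w and v + w is not null, since the sum of their squares
   is 4 <v, v>; the reflection in it maps v to w or to - w. *)
Lemma lorentz_transitive n (v w : 'rV[R]_n.+1) : lorentz v v = lorentz w w ->
  lorentz v v != 0 -> exists2 A, lorentz_isom A & v *m A = w \/ v *m A = - w.
Proof.
move=> vw v0; have [e|ne] := eqVneq (lorentz (v - w) (v - w)) 0; last first.
  have [A iA AE] := lorentz_reflection ne; exists A => //; left.
  rewrite AE; have -> : 2 * lorentz v (v - w) = lorentz (v - w) (v - w).
    by rewrite !lorentz_bilin (lorentzC w v) -vw; ring.
  by rewrite divff // scale1r opprB addrC subrK.
have ne : lorentz (v + w) (v + w) != 0.
  have E : lorentz (v - w) (v - w) + lorentz (v + w) (v + w) = 4 * lorentz v v.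
    by rewrite !lorentz_bilin (lorentzC w v) -vw; ring.
  by rewrite e add0r in E; rewrite E mulf_neq0 // pnatr_eq0.
have [A iA AE] := lorentz_reflection ne; exists A => //; right.
rewrite AE; have -> : 2 * lorentz v (v + w) = lorentz (v + w) (v + w).
  by rewrite !lorentz_bilin (lorentzC w v) -vw; ring.
by rewrite divff // scale1r opprD addrA subrr sub0r.
Qed.

(** Here <v - w, v - w> = - 2 <v, w> does not vanish, so the reflection in [v - w] exists, and it
    maps [v] to [w]. *)
Lemma lorentz_transitive_null n (v w : 'rV[R]_n.+1) : lorentz v v = 0 ->
  lorentz w w = 0 -> lorentz v w != 0 -> exists2 A, lorentz_isom A & v *m A = w.
Proof.
move=> v0 w0 vw; have E : lorentz (v - w) (v - w) = 2 * lorentz v (v - w).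
  by rewrite !lorentz_bilin (lorentzC w v) v0 w0; ring.
have ne : lorentz (v - w) (v - w) != 0.
  by rewrite E !lorentz_bilin v0 sub0r mulf_neq0 ?oppr_eq0 // pnatr_eq0.
have [A iA AE] := lorentz_reflection ne; exists A => //.
by rewrite AE -E divff // scale1r opprB addrC subrK.
Qed.

Definition frame (a b c d v : 'rV[R]_5) : 'M[R]_5 :=
  \matrix_(i < 5) nth 0 [:: a; b; c; d; v] i.

Lemma frame_mulmx a b c d v (A : 'M[R]_5) :
  frame (a *m A) (b *m A) (c *m A) (d *m A) (v *m A) = frame a b c d v *m A.
Proof.
apply/row_matrixP => i; rewrite row_mul !rowK.
by case: i => [[|[|[|[|[|]]]]]].
Qed.

(** The rows on the left are those obtained when a lift is multiplied by a function with value [r]: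
    the Leibniz terms only add multiples of earlier rows. The matrix [T] is triangular with diagonal
    r, r, r, r, 1. *)
Lemma frame_scale a b c d v (r p q s t u : R) :
  \det (frame (r *: a) (r *: b + p *: a) (r *: c + q *: a)
    (r *: d + (s *: b + t *: c) + u *: a) v) = r ^+ 4 * \det (frame a b c d v).
Proof.
pose f i j : R := nth 0 (nth [::]
  [:: [:: r]; [:: p; r]; [:: q; 0; r]; [:: u; s; t; r]; [:: 0; 0; 0; 0; 1]] i) j.
pose T : 'M[R]_5 := \matrix_(i < 5, j < 5) f i j.
rewrite (_ : frame _ _ _ _ _ = T *m frame a b c d v).
  rewrite det_mulmx; congr (_ * _); rewrite -[LHS]/(detn 5 f) detn5 /det5s /det4s /det3s /bump /f /=.
  by ring.
apply/matrixP => -[i i5] j; rewrite !mxE /= !big_ord_recl big_ord0 !mxE /=.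
case: i i5 => [|[|[|[|[|]]]]] //= _; rewrite ?mxE /f /=; ring.
Qed.

Lemma det_frame s1 s2 s3 s4 s5 :
  \det (frame (rowl 5 s1) (rowl 5 s2) (rowl 5 s3) (rowl 5 s4) (rowl 5 s5)) =
  det5s (fun i j => nth 0 (nth [::] [:: s1; s2; s3; s4; s5] i) j).
Proof.
rewrite -detn5 /detn; congr (\det _); apply/matrixP => -[i i5] j; rewrite !mxE /=.
by case: i i5 => [|[|[|[|[|]]]]] //= _; rewrite mxE.
Qed.

End LorentzGroup.

(** * The light cone model *)

Section ConeLift.
Context {R : realType}.

Definition lift5 (p : 'rV[R]_4) (t : R) : 'rV[R]_5 := row_mx p (t%:M : 'rV_1).

(* The null lift of the point x; it is the vector multiplied by H in the
   definition of the conformal Gauss map. *)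
Definition light (x : 'rV[R]_3) : 'rV[R]_5 :=
  lift5 (mk4 x ((dot x x - 1) / 2)) ((dot x x + 1) / 2).

Lemma mk4_rowl a b c t : mk4 (rowl 3 [:: a; b; c]) t = rowl 4 [:: a; b; c; t] :> 'rV[R]_4.
Proof.
apply/rowP => j; have [i ->|i ->] := (@split_ordP 3 1 j).
  by rewrite [LHS]row_mxEl !mxE /=; case: i => -[|[|[|]]].
by rewrite [LHS]row_mxEr !mxE !ord1.
Qed.

Lemma lift5_rowl a b c d t : lift5 (rowl 4 [:: a; b; c; d]) t = rowl 5 [:: a; b; c; d; t].
Proof.
apply/rowP => j; have [i ->|i ->] := (@split_ordP 4 1 j).
  by rewrite [LHS]row_mxEl !mxE /=; case: i => -[|[|[|[|]]]].
by rewrite [LHS]row_mxEr !mxE !ord1.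
Qed.

Lemma lift5_lorentz p q s t : lorentz (lift5 p s) (lift5 q t) = dot p q - s * t.
Proof.
have [a [b [c [d ->]]]] := row4E p; have [a' [b' [c' [d' ->]]]] := row4E q.
by rewrite !lift5_rowl lorentz_rowl5 dot_rowl4.
Qed.

Lemma mk4_dot x y s t : dot (mk4 x s) (mk4 y t) = dot x y + s * t :> R.
Proof.
have [a [b [c ->]]] := row3E x; have [a' [b' [c' ->]]] := row3E y.
by rewrite !mk4_rowl dot_rowl4 dot_rowl3.
Qed.

Lemma mk4_max x t : mk4 x t 0 ord_max = t :> R.
Proof. by have [a [b [c ->]]] := row3E x; rewrite mk4_rowl mxE. Qed.

Lemma lift5_max p t : lift5 p t 0 ord_max = t.
Proof. by have [a [b [c [d ->]]]] := row4E p; rewrite lift5_rowl mxE. Qed.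

Lemma first3_mk4 x t : first3 (mk4 x t) = x :> 'rV[R]_3.
Proof. exact: row_mxKl. Qed.

Lemma mk4D x y s t : mk4 x s + mk4 y t = mk4 (x + y) (s + t) :> 'rV[R]_4.
Proof. by apply: (etrans (@add_row_mx _ 1 3 1 _ _ _ _)); rewrite -raddfD. Qed.

Lemma mk4Z a x s : a *: mk4 x s = mk4 (a *: x) (a * s) :> 'rV[R]_4.
Proof. by apply: (etrans (@scale_row_mx _ 1 3 1 _ _ _)); rewrite scale_scalar_mx. Qed.

Lemma lift5D x y s t : lift5 x s + lift5 y t = lift5 (x + y) (s + t).
Proof. by apply: (etrans (@add_row_mx _ 1 4 1 _ _ _ _)); rewrite -raddfD. Qed.

Lemma lift5Z a x s : a *: lift5 x s = lift5 (a *: x) (a * s).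
Proof. by apply: (etrans (@scale_row_mx _ 1 4 1 _ _ _)); rewrite scale_scalar_mx. Qed.

Lemma lift5_surj (u : 'rV[R]_5) : exists p t, u = lift5 p t.
Proof.
have [a [b [c [d [e ->]]]]] := row5E u.
by exists (rowl 4 [:: a; b; c; d]), e; rewrite lift5_rowl.
Qed.

Lemma mk4_surj (u : 'rV[R]_4) : exists x t, u = mk4 x t.
Proof.
have [a [b [c [d ->]]]] := row4E u.
by exists (rowl 3 [:: a; b; c]), d; rewrite mk4_rowl.
Qed.

Lemma dot_ge0 n (v : 'rV[R]_n) : 0 <= dot v v.
Proof. by apply: sumr_ge0 => i _; rewrite -expr2 sqr_ge0. Qed.

Lemma dot_eq0 n (v : 'rV[R]_n) : dot v v = 0 -> v = 0.
Proof.
move=> /eqP; rewrite psumr_eq0 => [/allP v0|i _]; last by rewrite -expr2 sqr_ge0.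
apply/rowP => i; rewrite mxE; have := v0 i (mem_index_enum _).
by rewrite /= mulf_eq0 orbb => /eqP.
Qed.

Lemma dot1D_neq0 n (x : 'rV[R]_n) : 1 + dot x x != 0.
Proof. by rewrite gt_eqF // ltr_wpDr // dot_ge0. Qed.

Lemma light_null x : lorentz (light x) (light x) = 0.
Proof. by rewrite lift5_lorentz mk4_dot; field. Qed.

(* lift5 p 1 is the null lift of a point p of S^3. *)
Lemma lift5_stereo_inv x :
  lift5 (stereo_inv x) 1 = (2 / (1 + dot x x)) *: light x.
Proof.
rewrite /light lift5Z !mk4Z /stereo_inv mk4Z scalerA.
have := dot1D_neq0 x => d0; congr (lift5 (mk4 _ _) _).
- by rewrite mulrC.
- by field; rewrite d0.
- by field; rewrite d0.
Qed.

Lemma stereo_inv_S3 x : S3 (@stereo_inv R x).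
Proof.
have : lorentz (lift5 (stereo_inv x) 1) (lift5 (stereo_inv x) 1) = 0.
  by rewrite lift5_stereo_inv !lorentz_bilin light_null !mulr0.
by rewrite lift5_lorentz mulr1 => /eqP; rewrite subr_eq0 => /eqP.
Qed.

Section Derivatives.
Context {V : normedModType R}.

Lemma differentiable_row_mx n1 n2 (f : V -> 'rV[R]_n1) (g : V -> 'rV[R]_n2) p :
  differentiable f p -> differentiable g p ->
  differentiable (fun z => row_mx (f z) (g z)) p.
Proof.
move=> df dg; apply: differentiable_row => j.
case: (split_ordP j) => i ->.
  by under eq_fun do rewrite row_mxEl; exact: differentiable_coord_comp.
by under eq_fun do rewrite row_mxEr; exact: differentiable_coord_comp.
Qed.

Lemma derive_row_mx n1 n2 (f : V -> 'rV[R]_n1) (g : V -> 'rV[R]_n2) p v :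
  differentiable f p -> differentiable g p ->
  'D_v (fun z => row_mx (f z) (g z)) p = row_mx ('D_v f p) ('D_v g p).
Proof.
move=> df dg; have dfg := differentiable_row_mx df dg.
apply/rowP => j; rewrite derive_coord //; case: (split_ordP j) => i ->.
  by rewrite row_mxEl derive_coord //; under eq_fun do rewrite row_mxEl.
by rewrite row_mxEr derive_coord //; under eq_fun do rewrite row_mxEr.
Qed.

Lemma differentiable_scalar_mx (s : V -> R) p : differentiable s p ->
  differentiable (fun z => (s z)%:M : 'rV[R]_1) p.
Proof.
move=> ds; apply: differentiable_row => j.
by under eq_fun do rewrite mxE ord1 mulr1n.
Qed.

Lemma derive_scalar_mx (s : V -> R) p v : differentiable s p ->
  'D_v (fun z => (s z)%:M : 'rV[R]_1) p = ('D_v s p)%:M.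
Proof.
move=> ds; have dm := differentiable_scalar_mx ds.
apply/rowP => j; rewrite derive_coord // mxE ord1 mulr1n.
by under eq_fun do rewrite mxE mulr1n.
Qed.

Lemma differentiable_mk4 (f : V -> 'rV[R]_3) (s : V -> R) p :
  differentiable f p -> differentiable s p -> differentiable (fun z => mk4 (f z) (s z)) p.
Proof.
move=> df ds; apply: (@differentiable_row_mx 3 1 f (fun z => (s z)%:M)) => //.
exact: differentiable_scalar_mx.
Qed.

Lemma derive_mk4 (f : V -> 'rV[R]_3) (s : V -> R) p v :
  differentiable f p -> differentiable s p ->
  'D_v (fun z => mk4 (f z) (s z)) p = mk4 ('D_v f p) ('D_v s p).
Proof.
move=> df ds; have dm := differentiable_scalar_mx ds.
rewrite -[RHS]/(row_mx _ _) -derive_scalar_mx //.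
exact: (@derive_row_mx 3 1 f (fun z => (s z)%:M)).
Qed.

Lemma derive_lift5 (f : V -> 'rV[R]_4) (s : V -> R) p v :
  differentiable f p -> differentiable s p ->
  'D_v (fun z => lift5 (f z) (s z)) p = lift5 ('D_v f p) ('D_v s p).
Proof.
move=> df ds; have dm := differentiable_scalar_mx ds.
rewrite -[RHS]/(row_mx _ _) -derive_scalar_mx //.
exact: (@derive_row_mx 4 1 f (fun z => (s z)%:M)).
Qed.

Lemma row_smooth_row_mx n1 n2 U (f : V -> 'rV[R]_n1) (g : V -> 'rV[R]_n2) :
  row_smooth U f -> row_smooth U g -> row_smooth U (fun z => row_mx (f z) (g z)).
Proof.
move=> fU gU j; case: (split_ordP j) => i ->.
  by under eq_fun do rewrite row_mxEl; exact: fU.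
by under eq_fun do rewrite row_mxEr; exact: gU.
Qed.

Lemma row_smooth_scalar U (s : V -> R) :
  smooth U s -> row_smooth U (fun z => (s z)%:M : 'rV[R]_1).
Proof. by move=> sU j; under eq_fun do rewrite mxE ord1 mulr1n. Qed.

Lemma row_smooth_mk4 U (f : V -> 'rV[R]_3) (s : V -> R) :
  row_smooth U f -> smooth U s -> row_smooth U (fun z => mk4 (f z) (s z)).
Proof.
move=> fU sU; apply: (@row_smooth_row_mx 3 1) => //; exact: row_smooth_scalar.
Qed.

Lemma row_smooth_lift5 U (f : V -> 'rV[R]_4) (s : V -> R) :
  row_smooth U f -> smooth U s -> row_smooth U (fun z => lift5 (f z) (s z)).
Proof.
move=> fU sU; apply: (@row_smooth_row_mx 4 1) => //; exact: row_smooth_scalar.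
Qed.

Lemma row_smooth_light U (f : V -> 'rV[R]_3) : open U ->
  row_smooth U f -> row_smooth U (fun z => light (f z)).
Proof.
move=> oU fU; have dU := smooth_dot oU fU fU.
by apply: row_smooth_lift5; [apply: row_smooth_mk4 => //|]; apply: smoothM => //;
  rewrite ?/GRing.add /=; try exact: smooth_cst; apply: smoothD => //; exact: smooth_cst.
Qed.

Lemma derive_light U (f : V -> 'rV[R]_3) p v : open U -> row_smooth U f -> U p ->
  'D_v (fun z => light (f z)) p =
    lift5 (mk4 ('D_v f p) (dot ('D_v f p) (f p))) (dot ('D_v f p) (f p)).
Proof.
move=> oU fU Up; have df := row_smooth_differentiable fU Up.
have dU := smooth_dot oU fU fU.
have dd a : differentiable (fun z => (dot (f z) (f z) + a) / 2) p.
  apply: (smooth_differentiable (U := U)) => //; apply: smoothM => //; last exact: smooth_cst.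
  by apply: smoothD => //; exact: smooth_cst.
have D a : 'D_v (fun z => (dot (f z) (f z) + a) / 2) p = dot ('D_v f p) (f p).
  rewrite deriveMr; last first.
    apply: diff_derivable; apply: (smooth_differentiable (U := U)) => //.
    by apply: smoothD => //; exact: smooth_cst.
  rewrite deriveD; [|exact: diff_derivable (smooth_differentiable dU Up)|exact: derivable_cst].
  rewrite derive_cst addr0 derive_dot // (dotC (f p)).
  by rewrite /GRing.scale /=; field.
rewrite derive_lift5 //; last exact: differentiable_mk4.
by rewrite derive_mk4 // !D.
Qed.

Lemma derive2_light U (f : V -> 'rV[R]_3) p v w : open U -> row_smooth U f -> U p ->
  let s := dot ('D_w ('D_v f) p) (f p) + dot ('D_v f p) ('D_w f p) in
  'D_w ('D_v (fun z => light (f z))) p = lift5 (mk4 ('D_w ('D_v f) p) s) s.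
Proof.
move=> oU fU Up s; have fvU := row_smooth_derive oU v fU.
have df := row_smooth_differentiable fU Up.
have dfv := row_smooth_differentiable fvU Up.
have ds : differentiable (fun z => dot ('D_v f z) (f z)) p.
  exact: smooth_differentiable (smooth_dot oU fvU fU) Up.
apply: (etrans (derive_eq_on w oU Up (fun q Uq => derive_light v oU fU Uq))).
by rewrite derive_lift5 // ?derive_mk4 // ?derive_dot //; exact: differentiable_mk4.
Qed.

End Derivatives.
End ConeLift.

(** * Flat immersions into the light cone and Liouville's theorem *)

Section NullFrame.
Context {R : realType}.

(* The Gram matrix of m, a 0, a 1, a 2, n is invertible. *)
Lemma null_frame_nondegenerate (m n y : 'rV[R]_5) (a : 'I_3 -> 'rV[R]_5) :
  lorentz m m = 0 -> (forall i, lorentz m (a i) = 0) -> lorentz m n = -1 ->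
  (forall i j, lorentz (a i) (a j) = (i == j)%:R) ->
  (forall i, lorentz (a i) n = 0) ->
  lorentz y m = 0 -> (forall i, lorentz y (a i) = 0) -> lorentz y n = 0 -> y = 0.
Proof.
move=> mm ma mn aa an ym ya yn; pose B := frame m (a 0) (a 1) (a 2) n.
have rowB (u : 'rV[R]_5) (i : 'I_5) : (u *m gram_mx 4 *m B^T) 0 i = lorentz u (row i B).
  rewrite lorentzE [LHS]mxE [RHS]mxE; apply: eq_bigr => k _.
  by congr (_ * _); rewrite !mxE.
have yB : y *m gram_mx 4 *m B^T = 0.
  apply/rowP => i; rewrite rowB rowK mxE.
  by case: i => [[|[|[|[|[|i]]]]] i5] //=; rewrite ?ym ?ya ?yn.
pose g i j : R := nth 0 (nth [::] [:: [:: 0; 0; 0; 0; -1]; [:: 0; 1; 0; 0; 0];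
  [:: 0; 0; 1; 0; 0]; [:: 0; 0; 0; 1; 0]; [:: -1; 0; 0; 0; lorentz n n]] i) j.
have BJ : B *m gram_mx 4 *m B^T = \matrix_(i < 5, j < 5) g i j.
  apply/matrixP => i j.
  have -> : (B *m gram_mx 4 *m B^T) i j = (row i B *m gram_mx 4 *m B^T) 0 j.
    by rewrite -!row_mul [RHS]mxE.
  rewrite rowB !rowK mxE /g.
  have am k : lorentz (a k) m = 0 by rewrite lorentzC.
  have na k : lorentz n (a k) = 0 by rewrite lorentzC.
  have nm : lorentz n m = -1 by rewrite lorentzC.
  by case: i j => [[|[|[|[|[|i]]]]] i5] // [[|[|[|[|[|j]]]]] j5] //=;
    rewrite ?mm ?ma ?mn ?aa ?an ?am ?na ?nm.
have dB : \det (B *m gram_mx 4 *m B^T) = -1.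
  by rewrite BJ -[LHS]/(detn 5 g) detn5 /det5s /det4s /det3s /bump /g /=; ring.
have uB : B *m gram_mx 4 *m B^T \in unitmx by rewrite unitmxE dB unitrN1.
have uBT : gram_mx 4 *m B^T \in unitmx.
  by move: uB; rewrite -mulmxA unitmx_mul => /andP[].
by rewrite -(mulmxK uBT y) mulmxA yB mul0mx.
Qed.

(** As <m, n> = -1, the product with [m] gives minus the coefficient of [n], and the product with
    [n] then fixes the coefficient of [m]. The difference of the two sides is orthogonal to the
    whole frame. *)
Lemma null_frame_expand (m n y : 'rV[R]_5) (a : 'I_3 -> 'rV[R]_5) (d : R) :
  lorentz m m = 0 -> (forall i, lorentz m (a i) = 0) -> lorentz m n = -1 ->
  (forall i j, lorentz (a i) (a j) = (i == j)%:R) ->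
  (forall i, lorentz (a i) n = 0) ->
  lorentz y m = - d -> (forall i, lorentz y (a i) = 0) ->
  y = d *: n - (lorentz y n - d * lorentz n n) *: m.
Proof.
move=> mm ma mn aa an ym ya; apply/eqP; rewrite -subr_eq0; apply/eqP.
apply: (null_frame_nondegenerate mm ma mn aa an) => [|i|]; rewrite !lorentz_bilin.
- by rewrite (lorentzC n m) mm mn ym; ring.
- by rewrite (lorentzC n) ma an ya; ring.
- by rewrite mn; ring.
Qed.

(** The algebra of the symmetry of third derivatives, separated from the derivatives: [m], [a], [c]
    stand for the immersion and two orthogonal first derivatives, [n] and [n'] for derivatives of
    its Hessian vector. *)
Lemma third_pairing (n n' a c m : 'rV[R]_5) (d d' t t' s s' : R) :
  d *: n + (t *: c + s *: m) = d' *: n' + (t' *: a + s' *: m) ->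
  lorentz c c = 1 -> lorentz a c = 0 -> lorentz m c = 0 ->
  d * lorentz n c + t = d' * lorentz n' c.
Proof.
move=> /(congr1 (fun y => lorentz y c)); rewrite !lorentz_bilin => E cc ac mc.
by move: E; rewrite cc ac mc !mulr0 !addr0 mulr1.
Qed.

(** The last two coordinates of [light x] have sum |x|^2 and difference 1, so with these rows
    [light x] is sent to m + sum_i x_i a_i + (|x|^2 / 2) n: the quadratic map with value [m], first
    derivatives [a] and Hessian [n] times the identity at 0. *)
Definition null_frame_mx (m n : 'rV[R]_5) (a : 'I_3 -> 'rV[R]_5) : 'M[R]_5 :=
  frame (a 0) (a 1) (a 2) (2^-1 *: n - m) (2^-1 *: n + m).

Lemma null_frame_mxE m n a (x0 x1 x2 x3 x4 : R) :
  rowl 5 [:: x0; x1; x2; x3; x4] *m null_frame_mx m n a =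
  x0 *: a 0 + x1 *: a 1 + x2 *: a 2 + (x3 + x4) / 2 *: n + (x4 - x3) *: m.
Proof.
apply/rowP => j; rewrite mxE !big_ord_recl big_ord0 !mxE /= ?mxE; by field.
Qed.

(** With [n] null too, n/2 - m has square 1 and n/2 + m has square -1, so the rows are an
    orthonormal basis of R^{4,1}. *)
Lemma null_frame_mx_isom (m n : 'rV[R]_5) (a : 'I_3 -> 'rV[R]_5) :
  lorentz m m = 0 -> (forall i, lorentz m (a i) = 0) -> lorentz m n = -1 ->
  (forall i j, lorentz (a i) (a j) = (i == j)%:R) ->
  (forall i, lorentz (a i) n = 0) -> lorentz n n = 0 ->
  lorentz_isom (null_frame_mx m n a).
Proof.
move=> mm ma mn aa an nn u v; have [x0 [x1 [x2 [x3 [x4 ->]]]]] := row5E u.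
have [y0 [y1 [y2 [y3 [y4 ->]]]]] := row5E v; rewrite !null_frame_mxE lorentz_rowl5.
have am k : lorentz (a k) m = 0 by rewrite lorentzC.
have na k : lorentz n (a k) = 0 by rewrite lorentzC.
have nm : lorentz n m = -1 by rewrite lorentzC.
by rewrite !lorentz_bilin !(ma, am, na, an, aa, nm, mn, nn, mm) /=; field.
Qed.

End NullFrame.

Section FlatConeImmersion.
Context {R : realType} (M : 'rV[R]_3 -> 'rV[R]_5).
Hypothesis M_smooth : row_smooth setT M.
Hypothesis M_null : forall x, lorentz (M x) (M x) = 0.
Hypothesis M_isometric : forall x u v, lorentz ('D_u M x) ('D_v M x) = dot u v.

Local Notation D u := (derive^~ u).
Local Notation e a := (delta_mx 0 a : 'rV[R]_3).

Let smoothD1 u := row_smooth_derive openT u M_smooth.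
Let smoothD2 u v := row_smooth_derive openT v (smoothD1 u).

Lemma row_derive_swap (L : 'rV[R]_3 -> 'rV[R]_5) x u v : row_smooth setT L ->
  'D_v ('D_u L) x = 'D_u ('D_v L) x.
Proof.
move=> LU; have dL q := row_smooth_differentiable LU (I : setT q).
have dDL w q := row_smooth_differentiable (row_smooth_derive openT w LU) (I : setT q).
have E w j : (fun x => 'D_w L x 0 j) = 'D_w (fun x => L x 0 j).
  by apply/funext => q; rewrite (derive_coord _ _ (dL q)).
have C w w' j : 'D_w ('D_w' L) x 0 j = 'D_w ('D_w' (fun x => L x 0 j)) x.
  exact: etrans (derive_coord w j (dDL w' x)) (congr1 (fun f => 'D_w f x) (E w' j)).
apply/rowP => j; exact: etrans (C v u j) (etrans (derive_swap x u v (LU j)) (esym (C u v j))).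
Qed.

Let dM x : differentiable M x. Proof. exact: row_smooth_differentiable M_smooth I. Qed.
Let dM1 u x : differentiable ('D_u M) x.
Proof. exact: row_smooth_differentiable (smoothD1 u) I. Qed.
Let dM2 u v x : differentiable ('D_v ('D_u M)) x.
Proof. exact: row_smooth_differentiable (smoothD2 u v) I. Qed.

Lemma derive_cst_fun (f : 'rV[R]_3 -> R) c x v : (forall y, f y = c) -> 'D_v f x = 0.
Proof. by move=> fc; rewrite (_ : f = fun=> c) ?derive_cst //; exact/funext. Qed.

Lemma M_orth1 x u : lorentz ('D_u M x) (M x) = 0.
Proof.
have := derive_cst_fun x u M_null.
by rewrite (derive_lorentz _ (dM x) (dM x)) lorentzC -mulr2n => /eqP; rewrite mulrn_eq0 => /eqP.
Qed.

Lemma M_second x u v : lorentz ('D_v ('D_u M) x) (M x) = - dot u v.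
Proof.
have := derive_cst_fun x v (fun y => M_orth1 y u).
by rewrite (derive_lorentz _ (dM1 u x) (dM x)) (M_isometric x u v) => /eqP; rewrite addr_eq0 => /eqP.
Qed.

(* Koszul: the form is symmetric in u, v and antisymmetric in u, w. *)
Lemma M_christoffel x u v w : lorentz ('D_v ('D_u M) x) ('D_w M x) = 0.
Proof.
pose T v u w := lorentz ('D_v ('D_u M) x) ('D_w M x).
have T12 a b c : T a b c = T b a c by rewrite /T (row_derive_swap x b a M_smooth).
have T23 a b c : T a b c = - T a c b.
  have := derive_cst_fun x a (fun y => M_isometric y b c).
  rewrite (derive_lorentz _ (dM1 b x) (dM1 c x)) (lorentzC ('D_b M x)) => /eqP.
  by rewrite addr_eq0 => /eqP.
rewrite -/(T v u w); have : T v u w = - T v u w.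
  by rewrite {1}T23 T12 T23 T12 !opprK T23 T12.
by move=> /eqP; rewrite -addr_eq0 -mulr2n mulrn_eq0 => /eqP.
Qed.

(** The fifth vector of the moving frame formed with [M] and its first derivatives. The choice of
    the direction [e 0] is immaterial in the end, by [M_hessian_basis]. *)
Let N := 'D_(e 0) ('D_(e 0) M).

Lemma dot_delta n (i j : 'I_n) : dot (delta_mx 0 i) (delta_mx 0 j) = (i == j)%:R :> R.
Proof.
rewrite /dot (bigD1 i) //= big1 => [|k ki]; first by rewrite !mxE !eqxx mul1r addr0.
by rewrite !mxE (negPf ki) andbF mul0r.
Qed.

Let t u v x := - (lorentz ('D_v ('D_u M) x) (N x) - dot u v * lorentz (N x) (N x)).

(** The products of ['D_v ('D_u M) x] with [M x] and with the first derivatives are those of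
    [dot u v *: N x], so the frame expansion leaves only a multiple of [M x] free. *)
Lemma M_hessian u v x : 'D_v ('D_u M) x = dot u v *: N x + t u v x *: M x.
Proof.
have M1 a : lorentz (M x) ('D_(e a) M x) = 0 by rewrite lorentzC M_orth1.
have MN : lorentz (M x) (N x) = -1 by rewrite lorentzC M_second dot_delta.
have M2 a b : lorentz ('D_(e a) M x) ('D_(e b) M x) = (a == b)%:R.
  by rewrite (M_isometric x (e a) (e b)) dot_delta.
have M3 a : lorentz ('D_(e a) M x) (N x) = 0 by rewrite lorentzC M_christoffel.
have := null_frame_expand (M_null x) M1 MN M2 M3 (M_second x u v)
  (fun a => M_christoffel x u v (e a)).
by rewrite -scaleNr.
Qed.

Let t_smooth u v : smooth setT (t u v).
Proof.
apply: (smoothN openT); apply: (smoothB openT).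
  exact: (smooth_lorentz openT (smoothD2 u v) (smoothD2 _ _)).
apply: (smoothM openT); first exact: smooth_cst.
exact: (smooth_lorentz openT (smoothD2 _ _) (smoothD2 _ _)).
Qed.

Lemma M_third u v w x : 'D_w ('D_v ('D_u M)) x =
  dot u v *: 'D_w N x + (t u v x *: 'D_w M x + 'D_w (t u v) x *: M x).
Proof.
have -> : 'D_v ('D_u M) = fun x => dot u v *: N x + t u v x *: M x.
  by apply/funext => y; exact: M_hessian.
have dt := smooth_differentiable (t_smooth u v) (I : setT x).
have dN : differentiable N x by exact: dM2.
rewrite deriveD; last 2 first.
- by apply: diff_derivable; exact: differentiableZ.
- apply: diff_derivable; apply: row_smooth_differentiable (I : setT x).
  exact: (row_smoothZ openT (t_smooth u v) M_smooth).
by rewrite deriveZ ?derive_scale //; exact: diff_derivable.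
Qed.

Lemma M_third_sym u v w x : 'D_w ('D_v ('D_u M)) x = 'D_u ('D_v ('D_w M)) x.
Proof.
have E a b : 'D_a ('D_b M) = 'D_b ('D_a M).
  by apply/funext => y; exact: row_derive_swap.
have E1 := row_derive_swap x v w (smoothD1 u).
have E2 : 'D_v ('D_w ('D_u M)) x = 'D_v ('D_u ('D_w M)) x := congr1 (fun f => 'D_v f x) (E w u).
have E3 := row_derive_swap x u v (smoothD1 w).
exact: (etrans E1 (etrans E2 E3)).
Qed.

Let p c x := lorentz ('D_(e c) N x) ('D_(e c) M x).

(* The symmetry of the third derivatives in e a and e c, paired with the
   derivative of M along e c. *)
Lemma M_third_pairing a b c x : a != c -> exists q,
  (a == b)%:R * p c x + t (e a) (e b) x = (c == b)%:R * q.
Proof.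
move=> ac; have E := M_third_sym (e a) (e b) (e c) x.
have E' := etrans (esym (M_third (e a) (e b) (e c) x))
  (etrans E (M_third (e c) (e b) (e a) x)).
exists (lorentz ('D_(e a) N x) ('D_(e c) M x)).
rewrite -(dot_delta a b) -(dot_delta c b).
apply: (third_pairing E').
- by rewrite (M_isometric x (e c) (e c)) dot_delta eqxx.
- by rewrite (M_isometric x (e a) (e c)) dot_delta (negPf ac).
- by rewrite lorentzC M_orth1.
Qed.

(* Dimension at least 3 is used here and in t_eq0, through a third index c. *)
Lemma t_offdiag a b x : a != b -> t (e a) (e b) x = 0.
Proof.
move=> ab; have [c /andP[ca cb]] : exists c : 'I_3, (c != a) && (c != b).
  by move: a b ab => [[|[|[|]]] // ?] [[|[|[|]]] // ?] _ //;
    first [by exists 0|by exists 1|by exists 2].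
have [|q] := @M_third_pairing a b c x; first by rewrite eq_sym.
by rewrite (negPf ab) (negPf cb) !mulr0n !mul0r add0r.
Qed.

Lemma t_diag a b x : a != b -> p b x + t (e a) (e a) x = 0.
Proof.
move=> ab; have [q] := @M_third_pairing a a b x ab.
by rewrite eqxx eq_sym (negPf ab) mul1r mul0r.
Qed.

(** The choice of [N] makes the coefficient with both indices 0 vanish. [t_diag] transfers this to
    [p c] for an index [c] different from 0 and [a], and from [p c] to the diagonal coefficient at
    [a]. *)
Lemma t_eq0 a b x : t (e a) (e b) x = 0.
Proof.
have [<-|] := eqVneq a b; last exact: t_offdiag.
have t0 : t (e 0) (e 0) x = 0 by rewrite /t dot_delta eqxx mul1r subrr oppr0.
have [->//|a0] := eqVneq a 0.
have [c /andP[c0 ca]] : exists c : 'I_3, (0 != c) && (a != c).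
  by move: a a0 => [[|[|[|]]] // ?] _; first [by exists 1|by exists 2].
have := t_diag x c0; rewrite t0 addr0 => N0.
by have := t_diag x ca; rewrite N0 add0r.
Qed.

Lemma M_hessian_basis a b x : 'D_(e b) ('D_(e a) M) x = (a == b)%:R *: N x.
Proof. by rewrite M_hessian t_eq0 scale0r addr0 dot_delta. Qed.

(** [N] is also the second derivative along any [e a] with [a] different from [b]; moving the
    derivative along [e b] inside makes the mixed derivative appear, and that one vanishes. *)
Lemma N_derive_eq0 b x : 'D_(e b) N x = 0.
Proof.
have [a ab] : exists a : 'I_3, a != b.
  by move: b => [[|[|[|]]] // ?]; first [by exists 0|by exists 1].
have Na : N = 'D_(e a) ('D_(e a) M).
  by apply/funext => y; rewrite M_hessian_basis eqxx scale1r.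
have Z : 'D_(e a) ('D_(e b) M) = fun=> 0.
  by apply/funext => y; rewrite M_hessian_basis eq_sym (negPf ab) scale0r.
have E1 := M_third_sym (e a) (e a) (e b) x.
have E2 := congr1 (fun f => 'D_(e b) f x) Na.
have E3 := congr1 (fun f => 'D_(e a) f x) Z.
exact: (etrans E2 (etrans E1 (etrans E3 (derive_cst _ _ _)))).
Qed.

Lemma row_derive_basis_eq0_cst (L : 'rV[R]_3 -> 'rV[R]_5) : row_smooth setT L ->
  (forall a x, 'D_(e a) L x = 0) -> forall x y, L x = L y.
Proof.
move=> LU L0 x y; apply/rowP => j.
apply: (derive_eq0_cst (f := fun x => L x 0 j)) => [q|q v].
  exact: smooth_differentiable (LU j) I.
have dq := row_smooth_differentiable LU (I : setT q).
rewrite -(derive_coord v j dq) derive_row_sum // big1 ?mxE // => i _.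
by rewrite L0 scaler0.
Qed.

Lemma derive_light_id x v : 'D_v (@light R) x = lift5 (mk4 v (dot v x)) (dot v x).
Proof.
have := @derive_light R _ setT id x v openT (@row_smooth_id R 3 setT) I.
by rewrite derive_id.
Qed.

Theorem flat_cone_immersion : exists2 A : 'M[R]_5, lorentz_isom A &
  forall x, M x = light x *m A.
Proof.
have N_cst x : N x = N 0.
  by apply: row_derive_basis_eq0_cst => // *; [exact: smoothD2|exact: N_derive_eq0].
(* Since [N] is constant, each first derivative of [M] minus its expected linear part has zero
   gradient. *)
have M1E a x : 'D_(e a) M x = 'D_(e a) M 0 + x 0 a *: N 0.
  pose g x := 'D_(e a) M x - x 0 a *: N 0.
  have cU : smooth setT (fun x : 'rV[R]_3 => - x 0 a).
    by apply: (smoothN openT); exact: row_smooth_id.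
  have zU : row_smooth setT (fun x : 'rV[R]_3 => - x 0 a *: N 0).
    exact: (row_smoothZ openT cU (row_smooth_cst _)).
  have gE : g = (fun x => 'D_(e a) M x + (- x 0 a) *: N 0).
    by apply/funext => y; rewrite /g scaleNr.
  have gU : row_smooth setT g by rewrite gE; exact: (row_smoothD openT (smoothD1 _) zU).
  have g0 b y : 'D_(e b) g y = 0.
    have dc := smooth_differentiable cU (I : setT y).
    rewrite gE deriveD; last 2 first.
    - exact: diff_derivable (dM1 _ _).
    - exact: diff_derivable (row_smooth_differentiable zU I).
    rewrite M_hessian_basis N_cst derive_scale // derive_cst scaler0 add0r.
    rewrite deriveN; last exact: diff_derivable (differentiable_coord _ _ _).
    have -> : 'D_(e b) (fun x : 'rV[R]_3 => x 0 a) y = (a == b)%:R.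
      have di := row_smooth_differentiable (@row_smooth_id R 3 setT) (I : setT y).
      have := derive_coord (e b) a di; rewrite derive_id => <-.
      by rewrite mxE eqxx.
    by rewrite scaleNr subrr.
  have := row_derive_basis_eq0_cst gU g0 x 0; rewrite /g mxE scale0r subr0.
  by move=> <-; rewrite subrK.
have M1 a : lorentz (M 0) ('D_(e a) M 0) = 0 by rewrite lorentzC M_orth1.
have MN : lorentz (M 0) (N 0) = -1 by rewrite lorentzC M_second dot_delta.
have M2 a b : lorentz ('D_(e a) M 0) ('D_(e b) M 0) = (a == b)%:R.
  by rewrite (M_isometric 0 (e a) (e b)) dot_delta.
have M3 a : lorentz ('D_(e a) M 0) (N 0) = 0 by rewrite lorentzC M_christoffel.
(* Differentiating <N, D_0 M> = 0 along [e 0] gives <N, N> = 0, because [N] is constant and D_0 D_0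
   M is [N]. *)
have NN : lorentz (N 0) (N 0) = 0.
  have := derive_cst_fun 0 (e 0) (fun y => M_christoffel y (e 0) (e 0) (e 0)).
  rewrite (derive_lorentz _ (dM2 _ _ _) (dM1 _ _)) -/N N_derive_eq0 lorentz0l add0r.
  by [].
pose h a := 'D_(e a) M 0.
have iA : lorentz_isom (null_frame_mx (M 0) (N 0) h).
  exact: null_frame_mx_isom (M_null 0) M1 MN M2 M3 NN.
have AE := @null_frame_mxE R (M 0) (N 0) h.
move: (null_frame_mx _ _ _) iA AE => A iA AE.
exists A => //.
pose P x := M x - light x *m A.
have lU : row_smooth setT (@light R).
  exact: (row_smooth_light openT (@row_smooth_id R 3 setT)).
have lAU : row_smooth setT (fun x => - (light x *m A)).
  move=> j; apply: (smooth_eq openT (f := fun x => - (light x *m A) 0 j)).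
    by move=> q _; rewrite [RHS]mxE.
  have lA := row_smooth_mulmx openT A lU; exact: (smoothN openT (lA j)).
have PU : row_smooth setT P by exact: (row_smoothD openT M_smooth lAU).
(* The derivative of [light] along [e a] is (e_a, x_a, x_a); its last two entries contribute x_a to
   the coefficient of [N 0] and nothing to that of [M 0], in agreement with [M1E]. *)
have P0 a x : 'D_(e a) P x = 0.
  have dl := row_smooth_differentiable lU (I : setT x).
  have dlA := row_smooth_differentiable (row_smooth_mulmx openT A lU) (I : setT x).
  rewrite deriveB; [|exact: diff_derivable (dM _)|exact: diff_derivable dlA].
  rewrite derive_mulmx // derive_light_id M1E.
  have xa : dot (e a) x = x 0 a.
    rewrite /dot (bigD1 a) //= big1 => [|k ka]; first by rewrite mxE !eqxx mul1r addr0.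
    by rewrite mxE (negPf ka) andbF mul0r.
  have -> : lift5 (mk4 (e a) (dot (e a) x)) (dot (e a) x) =
      rowl 5 [:: (a == 0)%:R; (a == 1)%:R; (a == 2)%:R; x 0 a; x 0 a].
    rewrite xa (_ : e a = rowl 3 [:: (a == 0)%:R; (a == 1)%:R; (a == 2)%:R]).
      by rewrite mk4_rowl lift5_rowl.
    by apply/rowP => -[[|[|[|]]] // j3]; rewrite !mxE /= eq_sym.
  have ha (k : 'I_3 -> 'rV[R]_5) :
      (a == 0)%:R *: k 0 + (a == 1)%:R *: k 1 + (a == 2)%:R *: k 2 = k a.
    case: a {xa} => [[|[|[|]]] // i3]; rewrite -!val_eqE /= ?scale1r ?scale0r ?addr0 ?add0r;
      congr (k _); exact/val_inj.
  have -> : rowl 5 [:: (a == 0)%:R; (a == 1)%:R; (a == 2)%:R; x 0 a; x 0 a] *m A =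
      'D_(e a) M 0 + x 0 a *: N 0.
    have G (k m n : 'rV[R]_5) (y : R) : k + (y + y) / 2 *: n + (y - y) *: m = k + y *: n.
      by rewrite subrr scale0r addr0 (_ : (y + y) / 2 = y) //; field.
    exact: etrans (AE _ _ _ _ _)
      (etrans (congr1 (fun k => k + _ *: N 0 + _ *: M 0) (ha h)) (G (h a) (M 0) (N 0) (x 0 a))).
  exact: subrr.
move=> x; apply/eqP; rewrite -subr_eq0; apply/eqP.
rewrite -[LHS]/(P x) (row_derive_basis_eq0_cst PU P0 x 0) /P.
have -> : light 0 = rowl 5 [:: 0; 0; 0; - 2^-1; 2^-1] :> 'rV[R]_5.
  rewrite /light dot0l (_ : 0 = rowl 3 [:: 0; 0; 0]) ?mk4_rowl ?lift5_rowl.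
    by rewrite sub0r mulNr mul1r add0r mul1r.
  by apply/rowP => -[[|[|[|]]] // j3]; rewrite !mxE.
rewrite AE; move: (h 0) (h 1) (h 2) (M 0) (N 0) => h0 h1 h2 m n.
rewrite !scale0r !add0r addNr mul0r scale0r add0r.
by rewrite (_ : 2^-1 - - 2^-1 = 1 :> R) ?scale1r ?subrr //; field.
Qed.

End FlatConeImmersion.

(** * From conformal maps of the sphere to flat immersions *)

Section Liouville.
Context {R : realType}.

Lemma derive_null (V : normedModType R) (U : set V) n (L : V -> 'rV[R]_n.+1) (c : R) p u :
  open U -> U p -> row_smooth U L -> (forall q, U q -> lorentz (L q) (L q) = c) ->
  lorentz ('D_u L p) (L p) = 0.
Proof.
move=> oU Up LU L0; have dL := row_smooth_differentiable LU Up.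
have := derive_eq_on u oU Up (g := fun=> c) L0.
rewrite derive_cst (derive_lorentz _ dL dL) lorentzC -mulr2n => /eqP.
by rewrite mulrn_eq0 => /eqP.
Qed.

(** Differentiating [r] only produces multiples of [L p], which are orthogonal to [L p] and to its
    derivatives; so rescaling a null lift changes the induced metric conformally. *)
Lemma lorentz_derive_scale_at (V : normedModType R) n (r : V -> R)
    (L : V -> 'rV[R]_n.+1) p u v :
  differentiable r p -> differentiable L p -> lorentz (L p) (L p) = 0 ->
  lorentz ('D_u L p) (L p) = 0 -> lorentz ('D_v L p) (L p) = 0 ->
  lorentz ('D_u (fun z => r z *: L z) p) ('D_v (fun z => r z *: L z) p) =
  r p ^+ 2 * lorentz ('D_u L p) ('D_v L p).
Proof.
move=> dr dL; rewrite (derive_scale u dr dL) (derive_scale v dr dL).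
move: ('D_u L p) ('D_v L p) (L p) ('D_u r p) ('D_v r p) => a b l s t ll al bl.
by rewrite !lorentz_bilin ll (lorentzC l b) al bl; ring.
Qed.

Lemma lorentz_derive_scale (V : normedModType R) (U : set V) n (r : V -> R)
    (L : V -> 'rV[R]_n.+1) p u v :
  open U -> U p -> smooth U r -> row_smooth U L ->
  (forall q, U q -> lorentz (L q) (L q) = 0) ->
  lorentz ('D_u (fun z => r z *: L z) p) ('D_v (fun z => r z *: L z) p) =
  r p ^+ 2 * lorentz ('D_u L p) ('D_v L p).
Proof.
move=> oU Up rU LU L0; have dL := row_smooth_differentiable LU Up.
have dr := smooth_differentiable rU Up.
apply: lorentz_derive_scale_at => //; first exact: L0.
  exact: derive_null oU Up LU L0.
exact: derive_null oU Up LU L0.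
Qed.

Lemma row_smooth_stereo_inv : row_smooth setT (@stereo_inv R).
Proof.
have idU := @row_smooth_id R 3 setT; have dU := smooth_dot openT idU idU.
have cU a : smooth (setT : set 'rV[R]_3) (fun=> a : R) by exact: smooth_cst.
apply: (row_smoothZ openT); last apply: row_smooth_mk4.
- apply: (smoothV openT) => [x _|]; first exact: dot1D_neq0.
  exact: (smoothD openT (cU 1) dU).
- exact: (row_smoothZ openT (cU 2) idU).
- exact: (smoothB openT dU (cU 1)).
Qed.

(** [light] induces the flat metric of R^3 on the cone, and the lift of [stereo_inv] is its
    rescaling by 2 / (1 + |x|^2). *)
Lemma derive_stereo_inv_dot x u v :
  dot ('D_u (@stereo_inv R) x) ('D_v (@stereo_inv R) x) =
  (2 / (1 + dot x x)) ^+ 2 * dot u v.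
Proof.
pose r (x : 'rV[R]_3) := 2 / (1 + dot x x).
have idU := @row_smooth_id R 3 setT; have dU := smooth_dot openT idU idU.
have cU a : smooth (setT : set 'rV[R]_3) (fun=> a : R) by exact: smooth_cst.
have rU : smooth setT r.
  apply: (smoothM openT (cU 2)); apply: (smoothV openT) => [y _|].
    exact: dot1D_neq0.
  exact: (smoothD openT (cU 1) dU).
have lU : row_smooth setT (@light R) by exact: (row_smooth_light openT idU).
have := lorentz_derive_scale u v openT (I : setT x) rU lU (fun q _ => light_null q).
have -> : (fun z => r z *: light z) = (fun z => lift5 (stereo_inv z) 1).
  by apply/funext => z; rewrite lift5_stereo_inv.
have dS := row_smooth_differentiable row_smooth_stereo_inv (I : setT x).
rewrite (derive_lift5 u dS (differentiable_cst _ _)) (derive_lift5 v dS (differentiable_cst _ _)).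
rewrite !derive_light_id !lift5_lorentz mk4_dot !derive_cst mulr0 subr0 => ->.
by rewrite addrK.
Qed.

Lemma derive_stereo_inv_tangent x u : dot ('D_u (@stereo_inv R) x) (stereo_inv x) = 0.
Proof.
have dS := row_smooth_differentiable row_smooth_stereo_inv (I : setT x).
have := derive_eq_on u openT (I : setT x) (g := fun=> 1 : R) (fun q _ => stereo_inv_S3 q).
rewrite derive_cst (derive_dot _ dS dS) dotC -mulr2n => /eqP.
by rewrite mulrn_eq0 => /eqP.
Qed.

Lemma open_preimage (V : normedModType R) n (f : V -> 'rV[R]_n) (U : set 'rV[R]_n) :
  row_smooth setT f -> open U -> open (f @^-1` U).
Proof.
move=> fs oU; apply: open_comp => // x _.
by apply: differentiable_continuous; exact: row_smooth_differentiable fs I.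
Qed.

Theorem liouville_S3 (f : 'rV[R]_4 -> 'rV[R]_4) : conformal_diffeo_S3 f ->
  exists2 A : 'M[R]_5, lorentz_isom A &
  forall x, exists2 r, r != 0 & lift5 (f (stereo_inv x)) 1 = r *: (light x *m A).
Proof.
move=> [fS _ fc _]; pose h x := f (stereo_inv x).
have sS := row_smooth_stereo_inv.
(* [f] is known to be smooth only through local extensions [F] of its restriction to S^3;
   [stereo_inv] takes values in S^3, so [F] composed with it is [h] near [x]. *)
have loc x : exists V F, [/\ open V, V x, row_smooth V h, row_smooth V (fun y => F (stereo_inv y))
    & forall y, V y -> h y = F (stereo_inv y)] /\ differentiable F (stereo_inv x) /\
  exists2 lam : R, 0 < lam & forall u w, dot u (stereo_inv x) = 0 ->
    dot w (stereo_inv x) = 0 -> dot ('D_u F (stereo_inv x)) ('D_w F (stereo_inv x)) = lam * dot u w.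
  have [U [F [[oU Ux FU FE] lamP]]] := fc _ (stereo_inv_S3 x).
  have FU' : row_smooth U F by apply/smooth_onP.
  have oV : open (@stereo_inv R @^-1` U) by exact: open_preimage.
  have FsU : row_smooth (@stereo_inv R @^-1` U) (fun y => F (stereo_inv y)).
    apply: (row_smooth_comp oV (W := U)) => //.
    exact: row_smooth_sub sS.
  have hE y : U (stereo_inv y) -> F (stereo_inv y) = h y.
    by move=> Uy; rewrite FE //; exact: stereo_inv_S3.
  exists (@stereo_inv R @^-1` U), F; split; last first.
    by split=> //; exact: row_smooth_differentiable FU' Ux.
  split=> //; first exact: row_smooth_eq FsU.
  by move=> y /hE.
have hU : row_smooth setT h.
  by apply: row_smooth_local => x _; have [V [F [[oV Vx hV _ _] _]]] := loc x; exists V.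
have h_conf x : exists2 c : R, 0 < c & forall u v, dot ('D_u h x) ('D_v h x) = c * dot u v.
  have [V [F [[oV Vx _ _ hE] [dF [lam lam0 FE]]]]] := loc x.
  have ds := row_smooth_differentiable sS (I : setT x).
  have Dh u : 'D_u h x = 'D_('D_u (@stereo_inv R) x) F (stereo_inv x).
    exact: etrans (derive_eq_on u oV Vx hE) (derive_comp u ds dF).
  exists (lam * (2 / (1 + dot x x)) ^+ 2).
    by rewrite mulr_gt0 // exprn_gt0 // divr_gt0 // ltr_wpDr // dot_ge0.
  move=> u v; rewrite !Dh FE; [|exact: derive_stereo_inv_tangent|exact: derive_stereo_inv_tangent].
  by rewrite derive_stereo_inv_dot mulrA.
(* Conformality gives a factor at each point separately; the squared length of the image of one unit
   vector exhibits it as a smooth function. *)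
pose e0 : 'rV[R]_3 := delta_mx 0 0.
pose mu x := dot ('D_e0 h x) ('D_e0 h x).
have muE x u v : dot ('D_u h x) ('D_v h x) = mu x * dot u v.
  have [c c0 hc] := h_conf x.
  by rewrite hc /mu hc dot_delta eqxx mulr1.
have mu0 x : 0 < mu x.
  by have [c c0 hc] := h_conf x; rewrite /mu hc dot_delta eqxx mulr1.
have muU : smooth setT mu.
  exact: (smooth_dot openT (row_smooth_derive openT _ hU) (row_smooth_derive openT _ hU)).
(* This multiple of the lift is isometric. *)
pose r x := (Num.sqrt (mu x))^-1.
have r0 x : r x != 0 by rewrite invr_eq0 gt_eqF // sqrtr_gt0.
have rU : smooth setT r.
  apply: (smoothV openT) => [x _|]; first by rewrite gt_eqF // sqrtr_gt0.
  exact: (smooth_sqrt openT (fun x _ => mu0 x) muU).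
pose K x := lift5 (h x) 1.
have KU : row_smooth setT K by exact: (row_smooth_lift5 hU (smooth_cst _)).
have K0 x : lorentz (K x) (K x) = 0.
  by rewrite lift5_lorentz (fS _ (stereo_inv_S3 x)) mulr1 subrr.
have DK x u : 'D_u K x = lift5 ('D_u h x) 0.
  have dh := row_smooth_differentiable hU (I : setT x).
  by rewrite (derive_lift5 u dh (differentiable_cst _ _)) derive_cst.
have [||x u v|A iA AE] := @flat_cone_immersion R (fun x => r x *: K x).
- exact: (row_smoothZ openT rU KU).
- by move=> x; rewrite !lorentz_bilin K0 !mulr0.
- rewrite (lorentz_derive_scale u v openT I rU KU (fun q _ => K0 q)) !DK lift5_lorentz mulr0 subr0.
  by rewrite muE /r exprVn sqr_sqrtr ?ltW // mulKf // gt_eqF.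
exists A => // x; exists (r x)^-1; first by rewrite invr_eq0.
by rewrite -AE scalerA mulVf // scale1r.
Qed.

End Liouville.

(** * Moebius transformations *)

Section Moebius.
Context {R : realType}.

Definition first4 (u : 'rV[R]_5) : 'rV[R]_4 := @lsubmx R 1 4 1 u.

Lemma first4_lift5 p t : first4 (lift5 p t) = p.
Proof. exact: row_mxKl. Qed.

(* A Lorentz transformation acting on S^3, seen as the projectivised light cone;
   it has junk values at the points p off S^3 where the last coordinate of u is 0. *)
Definition moebius (A : 'M[R]_5) (p : 'rV[R]_4) : 'rV[R]_4 :=
  let u := lift5 p 1 *m A in (u 0 ord_max)^-1 *: first4 u.

Lemma lift5_first4 (u : 'rV[R]_5) : lift5 (first4 u) (u 0 ord_max) = u.
Proof. by have [p [t ->]] := lift5_surj u; rewrite first4_lift5 lift5_max. Qed.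

Lemma lift5_moebius A p : (lift5 p 1 *m A) 0 ord_max != 0 ->
  lift5 (moebius A p) 1 = ((lift5 p 1 *m A) 0 ord_max)^-1 *: (lift5 p 1 *m A).
Proof.
move=> u0; rewrite -[in RHS](lift5_first4 (lift5 p 1 *m A)) lift5Z lift5_max.
by rewrite mulVf.
Qed.

Lemma lift5_projective_inj (p q : 'rV[R]_4) c : lift5 p 1 = c *: lift5 q 1 -> p = q.
Proof.
rewrite lift5Z => E; have := congr1 (fun u : 'rV[R]_5 => u 0 ord_max) E.
rewrite /= !lift5_max mulr1 => c1; move: (congr1 first4 E).
by rewrite !first4_lift5 -c1 scale1r.
Qed.

(** If the last coordinate of a null vector is zero, the others have Euclidean length zero. *)
Lemma null_max_neq0 (u : 'rV[R]_5) : u != 0 -> lorentz u u = 0 -> u 0 ord_max != 0.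
Proof.
have [p [t ->]] := lift5_surj u; rewrite lift5_lorentz lift5_max => u0 ut.
apply/eqP => t0; move: ut u0; rewrite t0 mulr0 subr0 => /dot_eq0 ->.
by have := @lift5Z R 0 0 0; rewrite scale0r scaler0 mulr0 => <-; rewrite eqxx.
Qed.

Lemma lift5_neq0 (p : 'rV[R]_4) t : t != 0 -> lift5 p t != 0.
Proof.
move=> t0; apply/eqP => /(congr1 (fun u : 'rV[R]_5 => u 0 ord_max)).
by rewrite /= lift5_max mxE => /eqP; rewrite (negPf t0).
Qed.

Lemma mulmx_isom_neq0 n (A : 'M[R]_n.+1) (u : 'rV_n.+1) : lorentz_isom A -> u != 0 -> u *m A != 0.
Proof.
move=> iA; apply: contra => /eqP uA.
by rewrite -(mulmxK (lorentz_isom_unit iA) u) uA mul0mx.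
Qed.

Lemma S3_null (p : 'rV[R]_4) : S3 p -> lorentz (lift5 p 1) (lift5 p 1) = 0.
Proof. by rewrite lift5_lorentz => ->; rewrite mulr1 subrr. Qed.

Lemma moebius_den (A : 'M[R]_5) p : lorentz_isom A -> S3 p -> (lift5 p 1 *m A) 0 ord_max != 0.
Proof.
move=> iA /S3_null pS; apply: null_max_neq0; last by rewrite iA.
by apply: mulmx_isom_neq0 => //; apply: lift5_neq0; exact: oner_neq0.
Qed.

Lemma moebius_S3 (A : 'M[R]_5) p : lorentz_isom A -> S3 p -> S3 (moebius A p).
Proof.
move=> iA pS; have u0 := moebius_den iA pS.
have : lorentz (lift5 (moebius A p) 1) (lift5 (moebius A p) 1) = 0.
  by rewrite lift5_moebius // !lorentz_bilin iA S3_null // !mulr0.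
by rewrite lift5_lorentz mulr1 => /eqP; rewrite subr_eq0 => /eqP.
Qed.

Lemma moebiusK (A : 'M[R]_5) p : lorentz_isom A -> S3 p -> moebius (invmx A) (moebius A p) = p.
Proof.
move=> iA pS; have uA := lorentz_isom_unit iA.
apply: lift5_projective_inj.
rewrite lift5_moebius; last exact: moebius_den (lorentz_isomV iA) (moebius_S3 iA pS).
rewrite [X in _ *: (X *m _)]lift5_moebius; last exact: moebius_den.
by rewrite -scalemxAl mulmxK // scalerA.
Qed.

Let lift1U : row_smooth setT (fun p : 'rV[R]_4 => lift5 p 1).
Proof. exact: (row_smooth_lift5 (@row_smooth_id R 4 setT) (smooth_cst _)). Qed.

Lemma row_smooth_moebius (A : 'M[R]_5) :
  row_smooth [set p | (lift5 p 1 *m A) 0 ord_max != 0] (moebius A) /\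
  open [set p | (lift5 p 1 *m A) 0 ord_max != 0].
Proof.
have uU := row_smooth_mulmx openT A lift1U.
set U := [set p | _]; have oU : open U.
  rewrite /U -[X in open X]/((fun p => (lift5 p 1 *m A) 0 ord_max) @^-1` [set x | x != 0]).
  apply: open_comp; last exact: open_neq.
  move=> p _; apply: differentiable_continuous; exact: smooth_differentiable (uU ord_max) I.
split=> //; have TU : U `<=` setT by [].
have cU := smoothV oU (fun x Ux => Ux) (smooth_sub TU (uU ord_max)).
move=> j; have := row_smoothZ oU cU (row_smooth_sub TU uU).
move=> /(_ (@lshift 4 1 j)).
apply: (smooth_eq oU) => q _; rewrite [LHS]mxE [RHS]mxE; congr (_ * _).
by rewrite /first4 [RHS]mxE.
Qed.

(** The lift of [moebius A p] is a rescaling of a linear isometric image of (p, 1), and a vector w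
    tangent to S^3 lifts to (w, 0), orthogonal to (p, 1) and of the same square; so the conformal
    factor is the square of the scaling. [moebius A] is its own local extension, on the open set
    where its denominator is nonzero. *)
Theorem moebius_conformal (A : 'M[R]_5) : lorentz_isom A -> conformal_diffeo_S3 (moebius A).
Proof.
have loc B p : lorentz_isom B -> S3 p -> exists2 U, local_extension (moebius B) p U (moebius B) &
    forall q, U q -> (lift5 q 1 *m B) 0 ord_max != 0.
  move=> iB pS; have [sU oU] := row_smooth_moebius B.
  exists [set p | (lift5 p 1 *m B) 0 ord_max != 0] => //.
  by split=> //; [exact: moebius_den|apply/smooth_onP].
have sm B : lorentz_isom B -> smooth_S3 (moebius B).
  by move=> iB p /(loc B p iB)[U ext _]; exists U, (moebius B).
move=> iA; have iV := lorentz_isomV iA; split=> [p|||].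
- exact: moebius_S3.
- exact: sm.
- move=> p pS; have [U ext Uden] := loc A p iA pS; exists U, (moebius A); split=> //.
  have [oU Up _ _] := ext; have u0 := moebius_den iA pS.
  have [sU oU'] := row_smooth_moebius A.
  have dm := row_smooth_differentiable sU u0.
  pose u (q : 'rV[R]_4) := lift5 q 1 *m A.
  pose r q := (u q 0 ord_max)^-1.
  have uU := row_smooth_mulmx openT A lift1U.
  have du := row_smooth_differentiable uU (I : setT p).
  have dr : differentiable r p.
    by apply: differentiableV => //; exact: smooth_differentiable (uU ord_max) I.
  have Dl w : 'D_w (fun q : 'rV[R]_4 => lift5 q 1) p = lift5 w 0.
    have di := row_smooth_differentiable (@row_smooth_id R 4 setT) (I : setT p).
    by rewrite (derive_lift5 w di (differentiable_cst _ _)) derive_id derive_cst.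
  have Du w : 'D_w u p = lift5 w 0 *m A.
    have dl := row_smooth_differentiable lift1U (I : setT p).
    by rewrite (derive_mulmx A w dl) Dl.
  have Dm w : lift5 ('D_w (moebius A) p) 0 = 'D_w (fun q => r q *: u q) p.
    have := derive_eq_on w oU' u0 (fun q Uq => lift5_moebius Uq).
    by rewrite (derive_lift5 w dm (differentiable_cst _ _)) derive_cst.
  have Du0 w : dot w p = 0 -> lorentz ('D_w u p) (u p) = 0.
    by move=> wp; rewrite Du iA lift5_lorentz wp mul0r subr0.
  exists (r p ^+ 2); first by rewrite exprn_even_gt0 //= invr_eq0.
  move=> v w vp wp; have uu : lorentz (u p) (u p) = 0 by rewrite iA S3_null.
  have := lorentz_derive_scale_at dr du uu (Du0 v vp) (Du0 w wp).
  by rewrite -!Dm !Du iA !lift5_lorentz mulr0 !subr0.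
- exists (moebius (invmx A)); split=> [p|||].
  + exact: moebius_S3.
  + exact: sm.
  + by move=> p; exact: moebiusK.
  + by move=> p pS; have := moebiusK iV pS; rewrite invmxK.
Qed.

(** For [moebius_oo]: its conjugate by the stereographic projection agrees with [moebius A] on S^3
    only. *)
Lemma conformal_diffeo_S3_eq (f g : 'rV[R]_4 -> 'rV[R]_4) :
  (forall p, S3 p -> g p = f p) -> conformal_diffeo_S3 f -> conformal_diffeo_S3 g.
Proof.
move=> gf [fS fs fc [k [kS ks kf fk]]].
have loc p U F : local_extension f p U F -> local_extension g p U F.
  by move=> [oU Up FU FE]; split=> // q qS Uq; rewrite FE // gf.
split.
- by move=> p pS; rewrite gf //; exact: fS.
- by move=> p /fs[U [F /loc]]; exists U, F.
- by move=> p /fc[U [F [/loc ext lamP]]]; exists U, F.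
- exists k; split=> //.
    by move=> p pS; rewrite gf //; exact: kf.
  by move=> p pS; rewrite gf; [exact: fk|exact: kS].
Qed.

Lemma stereo_ooK (x : 'rV[R]_3) : stereo_oo (@stereo_inv R x) = Some x.
Proof.
have d0 := dot1D_neq0 x; rewrite /stereo_oo /stereo_inv mk4Z mk4_max first3_mk4.
have e : 1 - (1 + dot x x)^-1 * (dot x x - 1) = 2 / (1 + dot x x) by field.
case: eqP => [E|_].
  move: e; rewrite E subrr => /esym/eqP.
  by rewrite mulf_eq0 invr_eq0 (negPf d0) pnatr_eq0.
congr Some; rewrite e !scalerA -[RHS]scale1r; congr (_ *: _).
by field; rewrite d0.
Qed.

Lemma stereo_inv_ooK (p : 'rV[R]_4) : S3 p -> stereo_inv_oo (@stereo_oo R p) = p.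
Proof.
have [x [t ->]] := mk4_surj p; rewrite /S3 /= mk4_dot /stereo_oo mk4_max first3_mk4 => xt.
case: eqP => [t1|/eqP t1] /=.
  move: xt; rewrite t1 mulr1 => /eqP; rewrite -subr_eq0 addrK => /eqP /dot_eq0 -> //.
have t1' : 1 - t != 0 by rewrite subr_eq0 eq_sym.
have dE : dot x x = (1 - t) * (1 + t).
  by move: xt => /(canRL (addrK _)) ->; ring.
have d2 : dot ((1 - t)^-1 *: x) ((1 - t)^-1 *: x) = (1 + t) / (1 - t).
  by rewrite dotZl dotZr dE; field.
have d3 : 1 + (1 + t) / (1 - t) = 2 / (1 - t) by field.
rewrite /stereo_inv d2 d3 mk4Z !scalerA; congr mk4.
  by rewrite -[RHS]scale1r; congr (_ *: _); field; rewrite t1'.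
by field; rewrite t1'.
Qed.

Definition moebius_oo (A : 'M[R]_5) : option 'rV[R]_3 -> option 'rV[R]_3 :=
  @stereo_oo R \o moebius A \o @stereo_inv_oo R.

Lemma moebius_oo_conformal (A : 'M[R]_5) : lorentz_isom A -> conformal_diffeo_R3oo (moebius_oo A).
Proof.
move=> iA; apply: conformal_diffeo_S3_eq (moebius_conformal iA) => p pS.
by rewrite /= stereo_inv_ooK // stereo_inv_ooK //; exact: moebius_S3.
Qed.

End Moebius.

(** * Mean curvatures in real coordinates *)

Section TripleProducts.
Context {K : comNzRingType}.

Definition unitl j : seq K := [seq (k == j)%:R | k <- iota 0 4].

Lemma cross4_entry (sa sb sc : seq K) (j : 'I_4) :
  cross4 (rowl 4 sa) (rowl 4 sb) (rowl 4 sc) 0 j =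
  det4s (fun i k => nth 0 (nth [::] [:: sa; sb; sc; unitl j] i) k).
Proof.
rewrite mxE -detn4 /detn; congr (\det _); apply/matrixP => i k; rewrite [RHS]mxE.
have deltaE : (delta_mx 0 j : 'rV[K]_4) 0 k = nth 0 (unitl j) k :> K.
  by rewrite mxE (nth_map 0%N) ?size_iota ?ltn_ord // nth_iota ?ltn_ord // add0n.
case: (split_ordP i) => i' ->; rewrite ?col_mxEu ?col_mxEd;
  by case: (split_ordP i') => i'' ->; rewrite ?col_mxEu ?col_mxEd ?ord1 -?deltaE ?mxE.
Qed.

Lemma cross4_rowl (a0 a1 a2 a3 b0 b1 b2 b3 c0 c1 c2 c3 : K) :
  cross4 (rowl 4 [:: a0; a1; a2; a3]) (rowl 4 [:: b0; b1; b2; b3]) (rowl 4 [:: c0; c1; c2; c3]) =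
  rowl 4 [::
   - (a1 * (b2 * c3 - b3 * c2) - a2 * (b1 * c3 - b3 * c1) + a3 * (b1 * c2 - b2 * c1));
   a0 * (b2 * c3 - b3 * c2) - a2 * (b0 * c3 - b3 * c0) + a3 * (b0 * c2 - b2 * c0);
   - (a0 * (b1 * c3 - b3 * c1) - a1 * (b0 * c3 - b3 * c0) + a3 * (b0 * c1 - b1 * c0));
   a0 * (b1 * c2 - b2 * c1) - a1 * (b0 * c2 - b2 * c0) + a2 * (b0 * c1 - b1 * c0)].
Proof.
apply/rowP => j; rewrite cross4_entry mxE /det4s /det3s /bump /unitl.
by case: j => -[|[|[|[|]]]] //= j4; ring.
Qed.

Lemma cross_rowl (a0 a1 a2 b0 b1 b2 : K) :
  cross (rowl 3 [:: a0; a1; a2]) (rowl 3 [:: b0; b1; b2]) =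
  rowl 3 [:: a1 * b2 - a2 * b1; a2 * b0 - a0 * b2; a0 * b1 - a1 * b0].
Proof. by apply/rowP => -[[|[|[|]]] // j3]; rewrite !mxE. Qed.

Lemma lcross4_rowl (a0 a1 a2 a3 b0 b1 b2 b3 c0 c1 c2 c3 : K) :
  lcross4 (rowl 4 [:: a0; a1; a2; a3]) (rowl 4 [:: b0; b1; b2; b3]) (rowl 4 [:: c0; c1; c2; c3]) =
  rowl 4 [::
   - (a1 * (b2 * c3 - b3 * c2) - a2 * (b1 * c3 - b3 * c1) + a3 * (b1 * c2 - b2 * c1));
   a0 * (b2 * c3 - b3 * c2) - a2 * (b0 * c3 - b3 * c0) + a3 * (b0 * c2 - b2 * c0);
   - (a0 * (b1 * c3 - b3 * c1) - a1 * (b0 * c3 - b3 * c0) + a3 * (b0 * c1 - b1 * c0));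
   - (a0 * (b1 * c2 - b2 * c1) - a1 * (b0 * c2 - b2 * c0) + a2 * (b0 * c1 - b1 * c0))].
Proof.
apply/rowP => j; rewrite mxE cross4_rowl !mxE.
by case: j => -[|[|[|[|]]]].
Qed.

(** With i the imaginary unit and b, c half the partial derivatives, the arguments are Phi_z and
    Phi_zbar. The same computation serves the triple products. *)
Lemma cross_isotropic (b c : 'rV[K]_3) (i : K) :
  cross (b - i *: c) (b + i *: c) = (2 * i) *: cross b c.
Proof. by apply/rowP => j; rewrite !mxE; ring. Qed.

Lemma cross4_isotropic (a b c : 'rV[K]_4) (i : K) :
  cross4 a (b - i *: c) (b + i *: c) = (2 * i) *: cross4 a b c.
Proof.
have [a0 [a1 [a2 [a3 ->]]]] := row4E a; have [b0 [b1 [b2 [b3 ->]]]] := row4E b.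
have [c0 [c1 [c2 [c3 ->]]]] := row4E c.
rewrite -scaleNr !rowl_scale !rowl_add //= !cross4_rowl rowl_scale /=.
by congr rowl; do ![congr (_ :: _)]; ring.
Qed.

Lemma lcross4_isotropic (a b c : 'rV[K]_4) (i : K) :
  lcross4 a (b - i *: c) (b + i *: c) = (2 * i) *: lcross4 a b c.
Proof.
have [a0 [a1 [a2 [a3 ->]]]] := row4E a; have [b0 [b1 [b2 [b3 ->]]]] := row4E b.
have [c0 [c1 [c2 [c3 ->]]]] := row4E c.
rewrite -scaleNr !rowl_scale !rowl_add //= !lcross4_rowl rowl_scale /=.
by congr rowl; do ![congr (_ :: _)]; ring.
Qed.

Lemma dot_isotropic n (b c : 'rV[K]_n) (i : K) : i * i = -1 ->
  dot (b - i *: c) (b + i *: c) = dot b b + dot c c.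
Proof.
move=> ii; rewrite !(dotDl, dotDr, dotNl, dotNr, dotZl, dotZr) (dotC c b).
by transitivity (dot b b - (i * i) * dot c c); [|rewrite ii]; ring.
Qed.

Lemma lorentz_isotropic n (b c : 'rV[K]_n.+1) (i : K) : i * i = -1 ->
  lorentz (b - i *: c) (b + i *: c) = lorentz b b + lorentz c c.
Proof.
move=> ii; rewrite !lorentz_bilin (lorentzC c b).
by transitivity (lorentz b b - (i * i) * lorentz c c); [|rewrite ii]; ring.
Qed.

End TripleProducts.

(** * Complex derivatives through real and imaginary parts *)

Section ComplexDerivatives.
Context {R : realType}.
Local Open Scope complex_scope.
Local Notation e0 := (delta_mx 0 0 : 'rV[R]_2).
Local Notation e1 := (delta_mx 0 1 : 'rV[R]_2).

Definition cx n (a b : 'rV[R]_n) : 'rV[R[i]]_n := toC a + Ic R *: toC b.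

Lemma Ic_sqr : Ic R * Ic R = -1.
Proof. by apply/eqP; rewrite eq_complex /= !mul0r !mulr0 !mulr1 sub0r addr0 oppr0 !eqxx. Qed.

Lemma cx_entry n (a b : 'rV[R]_n) j : cx a b 0 j = a 0 j +i* b 0 j.
Proof.
by rewrite !mxE; apply/eqP; rewrite eq_complex /= !(mul0r, mul1r, mulr0, sub0r, oppr0, addr0, add0r) !eqxx.
Qed.

Lemma reC_cx n (a b : 'rV[R]_n) : reC (cx a b) = a.
Proof. by apply/rowP => j; rewrite mxE cx_entry. Qed.

Lemma imC_cx n (a b : 'rV[R]_n) : imC (cx a b) = b.
Proof. by apply/rowP => j; rewrite mxE cx_entry. Qed.

Lemma toC_cx n (a : 'rV[R]_n) : toC a = cx a 0.
Proof. by rewrite /cx /toC map_mx0 scaler0 addr0. Qed.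

Lemma toC_scale n c (a : 'rV[R]_n) : toC (c *: a) = c%:C *: toC a.
Proof. exact: map_mxZ. Qed.

Lemma toC_dot n (a b : 'rV[R]_n) : dot (toC a) (toC b) = (dot a b)%:C.
Proof. by rewrite /dot rmorph_sum; apply: eq_bigr => i _; rewrite !mxE rmorphM. Qed.

Lemma toC_lorentz n (a b : 'rV[R]_n.+1) : lorentz (toC a) (toC b) = (lorentz a b)%:C.
Proof.
rewrite /lorentz rmorphB rmorph_sum rmorphM !mxE; congr (_ - _).
by apply: eq_bigr => i _; rewrite !mxE rmorphM.
Qed.

Lemma toC_rowl n (s : seq R) : toC (rowl n s) = rowl n (map (fun x => x%:C) s).
Proof.
apply/rowP => j; rewrite !mxE; have [js|js] := ltnP j (size s).
  by rewrite (nth_map 0).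
by rewrite !nth_default ?size_map.
Qed.

Lemma toC_cross (a b : 'rV[R]_3) : cross (toC a) (toC b) = toC (cross a b).
Proof. by apply/rowP => j; rewrite !mxE rmorphB !rmorphM. Qed.

Lemma toC_cross4 (a b c : 'rV[R]_4) : cross4 (toC a) (toC b) (toC c) = toC (cross4 a b c).
Proof.
have [a0 [a1 [a2 [a3 ->]]]] := row4E a; have [b0 [b1 [b2 [b3 ->]]]] := row4E b.
have [c0 [c1 [c2 [c3 ->]]]] := row4E c.
rewrite cross4_rowl !toC_rowl /= cross4_rowl.
by congr rowl; do ![congr (_ :: _)]; rewrite !(rmorphN, rmorphD, rmorphM).
Qed.

Lemma toC_lcross4 (a b c : 'rV[R]_4) : lcross4 (toC a) (toC b) (toC c) = toC (lcross4 a b c).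
Proof.
have [a0 [a1 [a2 [a3 ->]]]] := row4E a; have [b0 [b1 [b2 [b3 ->]]]] := row4E b.
have [c0 [c1 [c2 [c3 ->]]]] := row4E c.
rewrite lcross4_rowl !toC_rowl /= lcross4_rowl.
by congr rowl; do ![congr (_ :: _)]; rewrite !(rmorphN, rmorphD, rmorphM).
Qed.

Lemma partialC_cx n k (a b : 'rV[R]_2 -> 'rV[R]_n) z :
  partialC k (fun z => cx (a z) (b z)) z =
  cx ('D_(delta_mx 0 k) a z) ('D_(delta_mx 0 k) b z).
Proof.
have ra : @reC R n \o (fun z => cx (a z) (b z)) = a.
  by apply/funext => y /=; rewrite reC_cx.
have ib : @imC R n \o (fun z => cx (a z) (b z)) = b.
  by apply/funext => y /=; rewrite imC_cx.
by rewrite /partialC ra ib.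
Qed.

Lemma dz_cx n (a b : 'rV[R]_2 -> 'rV[R]_n) z :
  dz (fun z => cx (a z) (b z)) z =
  cx (2^-1 *: ('D_e0 a z + 'D_e1 b z)) (2^-1 *: ('D_e0 b z - 'D_e1 a z)).
Proof.
rewrite /dz !partialC_cx; move: ('D_e0 a z) ('D_e1 a z) ('D_e0 b z) ('D_e1 b z) => ax ay bx by_.
apply/rowP => j; rewrite cx_entry mxE [X in _ * X]mxE cx_entry [X in _ + X]mxE [X in - X]mxE cx_entry !mxE.
have -> : 2^-1 = (2^-1)%:C :> R[i] by rewrite fmorphV rmorph_nat.
by apply/eqP; rewrite eq_complex /= ; apply/andP; split; apply/eqP; ring.
Qed.

Lemma dzbar_cx n (a b : 'rV[R]_2 -> 'rV[R]_n) z :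
  dzbar (fun z => cx (a z) (b z)) z =
  cx (2^-1 *: ('D_e0 a z - 'D_e1 b z)) (2^-1 *: ('D_e0 b z + 'D_e1 a z)).
Proof.
rewrite /dzbar !partialC_cx; move: ('D_e0 a z) ('D_e1 a z) ('D_e0 b z) ('D_e1 b z) => ax ay bx by_.
apply/rowP => j; rewrite cx_entry mxE [X in _ * X]mxE cx_entry [X in _ + X]mxE cx_entry !mxE.
have -> : 2^-1 = (2^-1)%:C :> R[i] by rewrite fmorphV rmorph_nat.
by apply/eqP; rewrite eq_complex /= ; apply/andP; split; apply/eqP; ring.
Qed.

Lemma dz_real n (f : 'rV[R]_2 -> 'rV[R]_n) :
  dz (@toC R n \o f) = (fun z => cx (2^-1 *: 'D_e0 f z) (- 2^-1 *: 'D_e1 f z)).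
Proof.
apply/funext => z; have -> : @toC R n \o f = fun z => cx (f z) ((fun=> 0) z).
  by apply/funext => y /=; rewrite toC_cx.
by rewrite dz_cx !derive_cst addr0 sub0r scalerN scaleNr.
Qed.

Lemma dzbar_real n (f : 'rV[R]_2 -> 'rV[R]_n) :
  dzbar (@toC R n \o f) = (fun z => cx (2^-1 *: 'D_e0 f z) (2^-1 *: 'D_e1 f z)).
Proof.
apply/funext => z; have -> : @toC R n \o f = fun z => cx (f z) ((fun=> 0) z).
  by apply/funext => y /=; rewrite toC_cx.
by rewrite dzbar_cx !derive_cst subr0 add0r.
Qed.

Lemma dz_dzbar_real n (f : 'rV[R]_2 -> 'rV[R]_n) z :
  (forall u v, derivable ('D_u f) z v) ->
  dz (dzbar (@toC R n \o f)) z =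
  cx (4^-1 *: ('D_e0 ('D_e0 f) z + 'D_e1 ('D_e1 f) z))
     (4^-1 *: ('D_e0 ('D_e1 f) z - 'D_e1 ('D_e0 f) z)).
Proof.
move=> df; rewrite dzbar_real dz_cx.
have D u v : 'D_v (fun z => 2^-1 *: 'D_u f z) z = 2^-1 *: 'D_v ('D_u f) z.
  exact: deriveZ.
have cxE (p q r s a b c d : 'rV[R]_n) : p = 2^-1 *: a -> q = 2^-1 *: b ->
    r = 2^-1 *: c -> s = 2^-1 *: d ->
    cx (2^-1 *: (p + q)) (2^-1 *: (r - s)) = cx (4^-1 *: (a + b)) (4^-1 *: (c - d)).
  by move=> -> -> -> ->; congr cx; apply/rowP => j; rewrite !mxE; field.
exact: cxE (D _ _) (D _ _) (D _ _) (D _ _).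
Qed.

Lemma dz_dz_real n (f : 'rV[R]_2 -> 'rV[R]_n) z :
  (forall u v, derivable ('D_u f) z v) ->
  dz (dz (@toC R n \o f)) z =
  cx (4^-1 *: ('D_e0 ('D_e0 f) z - 'D_e1 ('D_e1 f) z))
     (- 4^-1 *: ('D_e0 ('D_e1 f) z + 'D_e1 ('D_e0 f) z)).
Proof.
move=> df; rewrite dz_real dz_cx.
have D (c : R) u v : 'D_v (fun z => c *: 'D_u f z) z = c *: 'D_v ('D_u f) z.
  exact: deriveZ.
have cxE (p q r s a b c d : 'rV[R]_n) : p = 2^-1 *: a -> q = - 2^-1 *: b ->
    r = - 2^-1 *: c -> s = 2^-1 *: d ->
    cx (2^-1 *: (p + q)) (2^-1 *: (r - s)) = cx (4^-1 *: (a - b)) (- 4^-1 *: (c + d)).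
  by move=> -> -> -> ->; congr cx; apply/rowP => j; rewrite !mxE; field.
exact: cxE (D _ _ _) (D _ _ _) (D _ _ _) (D _ _ _).
Qed.

End ComplexDerivatives.

Section MeanFormulas.
Context {R : realType}.
Local Open Scope complex_scope.

(* pd is sealed because the unifier would otherwise try to identify two distinct
   partial derivatives by unfolding the limits that define them. *)
Fact pd_key : unit. Proof. exact: tt. Qed.

Definition pd n : 'I_2 -> ('rV[R]_2 -> 'rV[R]_n) -> 'rV[R]_2 -> 'rV[R]_n :=
  locked_with pd_key (fun k f z => 'D_(delta_mx 0 k) f z).

Lemma pdE n k (f : 'rV[R]_2 -> 'rV[R]_n) z : pd k f z = 'D_(delta_mx 0 k) f z.
Proof. by rewrite /pd unlock. Qed.

Lemma pd_funE n k (f : 'rV[R]_2 -> 'rV[R]_n) : pd k f = 'D_(delta_mx 0 k) f.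
Proof. by apply/funext => z; exact: pdE. Qed.

Definition laplacian n (f : 'rV[R]_2 -> 'rV[R]_n) z := pd 0 (pd 0 f) z + pd 1 (pd 1 f) z.

Lemma Ic_neq0 : Ic R != 0.
Proof. by apply/eqP => E; have := @Ic_sqr R; rewrite E mul0r => /eqP; rewrite eq_sym oppr_eq0 oner_eq0. Qed.

(** The factor 2i of [cross_isotropic] cancels the i in the definition of the unit normal, so that
    the normal is real. *)
Lemma Ic_scale (e : R) : (Ic R * e%:C)^-1 * (2 * Ic R) = (2 / e)%:C.
Proof.
rewrite invfM rmorphM rmorph_nat fmorphV mulrC -mulrA; congr (_ * _).
by rewrite mulrA mulfV ?mul1r // Ic_neq0.
Qed.

Lemma Re_scale (e x y : R) : complex.Re ((e%:C)^-1 * (x%:C + Ic R * y%:C)) = e^-1 * x.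
Proof. by rewrite -fmorphV /=; ring. Qed.

Lemma dz_real_at n (f : 'rV[R]_2 -> 'rV[R]_n) z :
  dz (@toC R n \o f) z = toC (2^-1 *: pd 0 f z) - Ic R *: toC (2^-1 *: pd 1 f z).
Proof. by rewrite dz_real !pdE /cx scaleNr /toC map_mxN scalerN. Qed.

Lemma dzbar_real_at n (f : 'rV[R]_2 -> 'rV[R]_n) z :
  dzbar (@toC R n \o f) z = toC (2^-1 *: pd 0 f z) + Ic R *: toC (2^-1 *: pd 1 f z).
Proof. by rewrite dzbar_real !pdE. Qed.

(** The imaginary part [q] is a multiple of the commutator of the partial derivatives. It stays
    unspecified because the real part taken in the mean curvatures discards it. *)
Lemma dz_dzbar_real_at n (f : 'rV[R]_2 -> 'rV[R]_n) z :
  (forall u v, derivable ('D_u f) z v) -> exists q,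
  dz (dzbar (@toC R n \o f)) z = cx (4^-1 *: laplacian f z) q.
Proof.
move=> df; exists (4^-1 *: ('D_(delta_mx 0 0) ('D_(delta_mx 0 1) f) z -
  'D_(delta_mx 0 1) ('D_(delta_mx 0 0) f) z)).
apply: (etrans (dz_dzbar_real df)); congr (cx (_ *: (_ + _)) _).
  exact: esym (etrans (pdE _ _ _) (congr1 (fun g => 'D_(delta_mx 0 0) g z) (pd_funE _ _))).
exact: esym (etrans (pdE _ _ _) (congr1 (fun g => 'D_(delta_mx 0 1) g z) (pd_funE _ _))).
Qed.

Lemma toC_dot_isotropic n (a b : 'rV[R]_n) :
  dot (toC a - Ic R *: toC b) (toC a + Ic R *: toC b) = (dot a a + dot b b)%:C.
Proof. by rewrite (dot_isotropic _ _ (@Ic_sqr R)) !toC_dot -rmorphD. Qed.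

Lemma toC_lorentz_isotropic n (a b : 'rV[R]_n.+1) :
  lorentz (toC a - Ic R *: toC b) (toC a + Ic R *: toC b) = (lorentz a a + lorentz b b)%:C.
Proof. by rewrite (lorentz_isotropic _ _ (@Ic_sqr R)) !toC_lorentz -rmorphD. Qed.

Lemma conf_factor_real (Phi : 'rV[R]_2 -> 'rV[R]_3) z :
  conf_factor Phi z = ((dot (pd 0 Phi z) (pd 0 Phi z) + dot (pd 1 Phi z) (pd 1 Phi z)) / 4)%:C.
Proof.
rewrite /conf_factor dz_real_at dzbar_real_at toC_dot_isotropic.
move: (pd 0 Phi z) (pd 1 Phi z) => a b; congr (_%:C); rewrite !(dotZl, dotZr); by field.
Qed.

Lemma gaussC_real (Phi : 'rV[R]_2 -> 'rV[R]_3) z :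
  gaussC Phi z = toC ((2 / (dot (pd 0 Phi z) (pd 0 Phi z) + dot (pd 1 Phi z) (pd 1 Phi z)))
    *: cross (pd 0 Phi z) (pd 1 Phi z)).
Proof.
rewrite /gaussC conf_factor_real dz_real_at dzbar_real_at cross_isotropic toC_cross scalerA Ic_scale -toC_scale.
move: (pd 0 Phi z) (pd 1 Phi z) => a b; congr toC.
apply/rowP => j; rewrite !mxE invfM invrK; move: (dot a a + dot b b)^-1 => k; by field.
Qed.

Lemma gauss_real (Phi : 'rV[R]_2 -> 'rV[R]_3) z :
  gauss Phi z = (2 / (dot (pd 0 Phi z) (pd 0 Phi z) + dot (pd 1 Phi z) (pd 1 Phi z)))
    *: cross (pd 0 Phi z) (pd 1 Phi z).
Proof. by rewrite /gauss gaussC_real toC_cx reC_cx. Qed.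

Lemma dot_cx_toC n (p q m : 'rV[R]_n) :
  dot (cx p q) (toC m) = (dot p m)%:C + Ic R * (dot q m)%:C.
Proof. by rewrite /cx dotDl dotZl !toC_dot. Qed.

Lemma lorentz_cx_toC n (p q m : 'rV[R]_n.+1) :
  lorentz (cx p q) (toC m) = (lorentz p m)%:C + Ic R * (lorentz q m)%:C.
Proof. by rewrite /cx lorentzDl lorentzZl !toC_lorentz. Qed.

Lemma mean_real (Phi : 'rV[R]_2 -> 'rV[R]_3) z :
  (forall u v, derivable ('D_u Phi) z v) ->
  mean Phi z = 2 * dot (laplacian Phi z) (cross (pd 0 Phi z) (pd 1 Phi z)) /
    (dot (pd 0 Phi z) (pd 0 Phi z) + dot (pd 1 Phi z) (pd 1 Phi z)) ^+ 2.
Proof.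
move=> /dz_dzbar_real_at[q qE]; rewrite /mean /meanC conf_factor_real gaussC_real qE dotZl dot_cx_toC.
rewrite Re_scale.
move: (laplacian Phi z) (pd 0 Phi z) (pd 1 Phi z) => l a b.
(* The inverse is generalised to a variable, so the identity also covers a vanishing denominator,
   under the convention 0^-1 = 0. *)
rewrite dotZl dotZr !(invfM, invrK, expr2); move: (dot a a + dot b b)^-1 => k; by field.
Qed.

Lemma mean_S3_real (X : 'rV[R]_2 -> 'rV[R]_4) z :
  (forall u v, derivable ('D_u X) z v) ->
  mean_S3 X z = 2 * dot (laplacian X z) (cross4 (X z) (pd 0 X z) (pd 1 X z)) /
    (dot (pd 0 X z) (pd 0 X z) + dot (pd 1 X z) (pd 1 X z)) ^+ 2.
Proof.
move=> /dz_dzbar_real_at[q qE]; rewrite /mean_S3 qE dz_real_at dzbar_real_at.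
rewrite toC_dot_isotropic cross4_isotropic.
rewrite /= toC_cross4 scalerA Ic_scale -toC_scale dotZl dot_cx_toC.
rewrite Re_scale.
move: (laplacian X z) (pd 0 X z) (pd 1 X z) => l a b.
have -> : cross4 (X z) (2^-1 *: a) (2^-1 *: b) = 4^-1 *: cross4 (X z) a b.
  have [a0 [a1 [a2 [a3 ->]]]] := row4E a; have [b0 [b1 [b2 [b3 ->]]]] := row4E b.
  have [c0 [c1 [c2 [c3 ->]]]] := row4E (X z).
  rewrite !rowl_scale /= !cross4_rowl rowl_scale /=.
  by congr rowl; do ![congr (_ :: _)]; field.
have -> : dot (2^-1 *: a) (2^-1 *: a) + dot (2^-1 *: b) (2^-1 *: b) =
    (dot a a + dot b b) / 4 by rewrite !(dotZl, dotZr); field.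
rewrite !(dotZl, dotZr) !(invfM, invrK, expr2); move: (dot a a + dot b b)^-1 => k; by field.
Qed.

Lemma mean_H3_real (Z : 'rV[R]_2 -> 'rV[R]_4) z :
  (forall u v, derivable ('D_u Z) z v) ->
  mean_H3 Z z = 2 * lorentz (laplacian Z z) (lcross4 (Z z) (pd 0 Z z) (pd 1 Z z)) /
    (lorentz (pd 0 Z z) (pd 0 Z z) + lorentz (pd 1 Z z) (pd 1 Z z)) ^+ 2.
Proof.
move=> /dz_dzbar_real_at[q qE]; rewrite /mean_H3 qE dz_real_at dzbar_real_at.
rewrite toC_lorentz_isotropic lcross4_isotropic.
rewrite /= toC_lcross4 scalerA Ic_scale -toC_scale lorentzZl lorentz_cx_toC.
rewrite Re_scale.
move: (laplacian Z z) (pd 0 Z z) (pd 1 Z z) => l a b.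
have -> : lcross4 (Z z) (2^-1 *: a) (2^-1 *: b) = 4^-1 *: lcross4 (Z z) a b.
  have [a0 [a1 [a2 [a3 ->]]]] := row4E a; have [b0 [b1 [b2 [b3 ->]]]] := row4E b.
  have [c0 [c1 [c2 [c3 ->]]]] := row4E (Z z).
  rewrite !rowl_scale /= !lcross4_rowl rowl_scale /=.
  by congr rowl; do ![congr (_ :: _)]; field.
have -> : lorentz (2^-1 *: a) (2^-1 *: a) + lorentz (2^-1 *: b) (2^-1 *: b) =
    (lorentz a a + lorentz b b) / 4 by rewrite !lorentz_bilin; field.
rewrite !lorentz_bilin !(invfM, invrK, expr2); move: (lorentz a a + lorentz b b)^-1 => k; by field.
Qed.

End MeanFormulas.

(** * The conformally invariant curvature form *)

Section CurvatureForm.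
Context {R : realType}.

Definition energy (L : 'rV[R]_2 -> 'rV[R]_5) z :=
  lorentz (pd 0 L z) (pd 0 L z) + lorentz (pd 1 L z) (pd 1 L z).

(* The vector dual to v |-> curvature_form L z v is normal to L and to its first
   derivatives and Laplacian. Multiplying L by a function r multiplies both the
   determinant and the square of the energy by r ^+ 4. *)
Definition curvature_form (L : 'rV[R]_2 -> 'rV[R]_5) z v :=
  2 * \det (frame (L z) (pd 0 L z) (pd 1 L z) (laplacian L z) v) / energy L z ^+ 2.

Section Local.
Context {U : set 'rV[R]_2} (oU : open U).

Lemma pd_eq_on n k (f g : 'rV[R]_2 -> 'rV[R]_n) z : U z ->
  (forall q, U q -> f q = g q) -> pd k f z = pd k g z.
Proof. by move=> Uz fg; rewrite !pdE; exact: derive_eq_on oU Uz fg. Qed.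

Lemma laplacian_eq_on n (f g : 'rV[R]_2 -> 'rV[R]_n) z : U z ->
  (forall q, U q -> f q = g q) -> laplacian f z = laplacian g z.
Proof.
move=> Uz fg; have E k : pd k (pd k f) z = pd k (pd k g) z.
  by apply: (pd_eq_on _ Uz) => q Uq; exact: (pd_eq_on _ Uq).
by rewrite /laplacian (E 0) (E 1).
Qed.

Lemma curvature_form_eq_on L L' z v : U z -> (forall q, U q -> L q = L' q) ->
  curvature_form L z v = curvature_form L' z v.
Proof.
move=> Uz LL; rewrite /curvature_form /energy !(pd_eq_on _ Uz LL).
by rewrite (laplacian_eq_on Uz LL) LL.
Qed.

Lemma pd_smooth n k (f : 'rV[R]_2 -> 'rV[R]_n) : row_smooth U f -> row_smooth U (pd k f).
Proof. by move=> fU; rewrite pd_funE; exact: row_smooth_derive. Qed.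

Lemma laplacian_smooth n (f : 'rV[R]_2 -> 'rV[R]_n) :
  row_smooth U f -> row_smooth U (laplacian f).
Proof.
by move=> fU; apply: (row_smoothD oU); do 2![apply: pd_smooth].
Qed.

Lemma pd_mulmx m n k (f : 'rV[R]_2 -> 'rV[R]_n) (A : 'M[R]_(n, m)) z :
  row_smooth U f -> U z -> pd k (fun z => f z *m A) z = pd k f z *m A.
Proof.
by move=> fU Uz; rewrite !pdE derive_mulmx //; exact: row_smooth_differentiable fU Uz.
Qed.

Lemma laplacian_mulmx m n (f : 'rV[R]_2 -> 'rV[R]_n) (A : 'M[R]_(n, m)) z :
  row_smooth U f -> U z -> laplacian (fun z => f z *m A) z = laplacian f z *m A.
Proof.
move=> fU Uz; have E k : pd k (pd k (fun z => f z *m A)) z = pd k (pd k f) z *m A.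
  rewrite -(pd_mulmx k A (pd_smooth k fU) Uz); apply: (pd_eq_on _ Uz) => q Uq.
  exact: pd_mulmx.
by rewrite /laplacian !E mulmxDl.
Qed.

(** Writing v = (v A^-1) A factors [A] out of all five rows of the frame, and the energy is
    unchanged by an isometry. *)
Lemma curvature_form_mulmx (A : 'M[R]_5) L z v : lorentz_isom A ->
  row_smooth U L -> U z ->
  curvature_form (fun z => L z *m A) z v = \det A * curvature_form L z (v *m invmx A).
Proof.
move=> iA LU Uz; rewrite /curvature_form /energy !(pd_mulmx _ A LU Uz).
rewrite (laplacian_mulmx A LU Uz).
move: (L z) (pd 0 L z) (pd 1 L z) (laplacian L z) => l a b d.
rewrite !iA -{1}(mulmxKV (lorentz_isom_unit iA) v).
rewrite frame_mulmx det_mulmx !mulrA; congr (_ / _).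
by rewrite [in RHS](mulrC (\det A)) -!mulrA; congr (_ * _); rewrite mulrC.
Qed.

Lemma pd_scale k (r : 'rV[R]_2 -> R) (L : 'rV[R]_2 -> 'rV[R]_5) z :
  smooth U r -> row_smooth U L -> U z ->
  pd k (fun z => r z *: L z) z = r z *: pd k L z + 'D_(delta_mx 0 k) r z *: L z.
Proof.
move=> rU LU Uz; rewrite !pdE; apply: derive_scale.
  exact: smooth_differentiable rU Uz.
exact: row_smooth_differentiable LU Uz.
Qed.

(** The coefficient of [L z] is left unspecified since the determinant does not see it. *)
Lemma pd2_scale k (r : 'rV[R]_2 -> R) (L : 'rV[R]_2 -> 'rV[R]_5) z :
  smooth U r -> row_smooth U L -> U z -> exists c,
  pd k (pd k (fun z => r z *: L z)) z =
  r z *: pd k (pd k L) z + (2 * 'D_(delta_mx 0 k) r z) *: pd k L z + c *: L z.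
Proof.
move=> rU LU Uz; pose r' := 'D_(delta_mx 0 k) r.
have r'U : smooth U r' by exact: smooth_derive.
have kU := pd_smooth k LU.
exists ('D_(delta_mx 0 k) r' z).
have -> : pd k (pd k (fun z => r z *: L z)) z =
    pd k (fun z => r z *: pd k L z + r' z *: L z) z.
  by apply: (pd_eq_on _ Uz) => q Uq; exact: pd_scale.
rewrite pdE deriveD; last 2 first.
- exact: diff_derivable (row_smooth_differentiable (row_smoothZ oU rU kU) Uz).
- exact: diff_derivable (row_smooth_differentiable (row_smoothZ oU r'U LU) Uz).
rewrite -!pdE (pd_scale k rU kU Uz) (pd_scale k r'U LU Uz).
move: (pd k (pd k L) z) (pd k L z) (L z) => a b c.
change ('D_(delta_mx 0 k) r z) with (r' z).
move: (r z) (r' z) ('D_(delta_mx 0 k) r' z) => x y w.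
by apply/rowP => j; rewrite !mxE; ring.
Qed.

Lemma curvature_form_scale (r : 'rV[R]_2 -> R) L z v :
  smooth U r -> row_smooth U L -> (forall q, U q -> lorentz (L q) (L q) = 0) ->
  U z -> r z != 0 ->
  curvature_form (fun z => r z *: L z) z v = curvature_form L z v.
Proof.
move=> rU LU L0 Uz r0; rewrite /curvature_form /laplacian.
have [c0 ->] := pd2_scale 0 rU LU Uz; have [c1 ->] := pd2_scale 1 rU LU Uz.
have -> : energy (fun z => r z *: L z) z = r z ^+ 2 * energy L z.
  have E k : lorentz (pd k (fun z => r z *: L z) z) (pd k (fun z => r z *: L z) z) =
      r z ^+ 2 * lorentz (pd k L z) (pd k L z).
    by rewrite !pdE; exact: (lorentz_derive_scale _ _ oU Uz rU LU L0).
  by rewrite /energy (E 0) (E 1) [RHS]mulrDr.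
rewrite (pd_scale 0 rU LU Uz) (pd_scale 1 rU LU Uz).
set a := 'D_(delta_mx 0 0) r z; set b := 'D_(delta_mx 0 1) r z.
set s := r z in r0 *; move: (L z) (pd 0 L z) (pd 1 L z) (pd 0 (pd 0 L) z) (pd 1 (pd 1 L) z) (energy L z).
move=> l lx ly lxx lyy E; move: s a b r0 => s a b s0.
(* Delta (r L) = r Delta L + 2 (r_x L_x + r_y L_y) + (Delta r) L, brought to the shape required by
   [frame_scale]. *)
have -> : s *: lxx + (2 * a) *: lx + c0 *: l + (s *: lyy + (2 * b) *: ly + c1 *: l) =
    s *: (lxx + lyy) + ((2 * a) *: lx + (2 * b) *: ly) + (c0 + c1) *: l.
  by apply/rowP => j; rewrite !mxE; ring.
rewrite frame_scale exprMn invfM; move: (\det _) (E ^+ 2)^-1 => D k.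
by field.
Qed.

End Local.

Lemma curvature_form_transform (U : set 'rV[R]_2) (r : 'rV[R]_2 -> R) L L' (A : 'M[R]_5) z v :
  open U -> lorentz_isom A -> smooth U r -> row_smooth U L ->
  (forall q, U q -> lorentz (L q) (L q) = 0) -> U z -> r z != 0 ->
  (forall q, U q -> L' q = r q *: (L q *m A)) ->
  curvature_form L' z v = \det A * curvature_form L z (v *m invmx A).
Proof.
move=> oU iA rU LU L0 Uz r0 LL; rewrite (curvature_form_eq_on oU v Uz LL).
have LAU := row_smooth_mulmx oU A LU.
rewrite (curvature_form_scale oU v rU LAU) //; last by move=> q Uq; rewrite iA L0.
exact: (curvature_form_mulmx oU v iA LU Uz).
Qed.

End CurvatureForm.

(** * The three mean curvatures and the conformal Gauss map as values of the curvature form *)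

Section MeanAsCurvatureForm.
Context {R : realType} {U : set 'rV[R]_2} (oU : open U).

Lemma row_smooth_derivable2 n (f : 'rV[R]_2 -> 'rV[R]_n) z u v :
  row_smooth U f -> U z -> derivable ('D_u f) z v.
Proof.
by move=> fU Uz; exact: diff_derivable (row_smooth_differentiable (row_smooth_derive oU u fU) Uz).
Qed.

Section Light.
Variable Phi : 'rV[R]_2 -> 'rV[R]_3.
Hypothesis PhiU : row_smooth U Phi.
Let L z := light (Phi z).

Lemma pd_light k z : U z ->
  pd k L z = lift5 (mk4 (pd k Phi z) (dot (pd k Phi z) (Phi z))) (dot (pd k Phi z) (Phi z)).
Proof. by move=> Uz; rewrite !pdE; exact: (derive_light _ oU PhiU Uz). Qed.

Lemma pd2_light j k z : U z ->
  let s := dot (pd j (pd k Phi) z) (Phi z) + dot (pd k Phi z) (pd j Phi z) in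
  pd j (pd k L) z = lift5 (mk4 (pd j (pd k Phi) z) s) s.
Proof.
move=> Uz s; rewrite /s !pd_funE; exact: (derive2_light _ _ oU PhiU Uz).
Qed.

Lemma laplacian_light z : U z ->
  let s := dot (laplacian Phi z) (Phi z) +
    (dot (pd 0 Phi z) (pd 0 Phi z) + dot (pd 1 Phi z) (pd 1 Phi z)) in
  laplacian L z = lift5 (mk4 (laplacian Phi z) s) s.
Proof.
move=> Uz s; rewrite /s /laplacian (pd2_light 0 0 Uz) (pd2_light 1 1 Uz) lift5D mk4D.
by congr (lift5 (mk4 _ _) _); rewrite dotDl addrACA.
Qed.

Lemma energy_light z : U z ->
  energy L z = dot (pd 0 Phi z) (pd 0 Phi z) + dot (pd 1 Phi z) (pd 1 Phi z).
Proof.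
by move=> Uz; rewrite /energy (pd_light 0 Uz) (pd_light 1 Uz) !lift5_lorentz !mk4_dot; ring.
Qed.

(** After multiplication by 2 / E^2 the coefficient 2 <l, n> / E^2 is the mean curvature and 2 n / E
    is the unit normal, so the right side becomes - <Y, v>. *)
Lemma frame_light (p a b l : 'rV[R]_3) (v : 'rV[R]_5) :
  let E := dot a a + dot b b in let s := dot l p + E in let n := cross a b in
  \det (frame (light p) (lift5 (mk4 a (dot a p)) (dot a p)) (lift5 (mk4 b (dot b p)) (dot b p))
    (lift5 (mk4 l s) s) v) =
  - (dot l n * lorentz (light p) v + E * lorentz (lift5 (mk4 n (dot n p)) (dot n p)) v).
Proof.
move=> E s n; rewrite /light /s /n /E.
have [p0 [p1 [p2 ->]]] := row3E p; have [a0 [a1 [a2 ->]]] := row3E a.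
have [b0 [b1 [b2 ->]]] := row3E b; have [l0 [l1 [l2 ->]]] := row3E l.
have [v0 [v1 [v2 [v3 [v4 ->]]]]] := row5E v.
rewrite !cross_rowl !dot_rowl3 !mk4_rowl !lift5_rowl det_frame !lorentz_rowl5.
by rewrite /det5s /det4s /det3s /bump /=; field.
Qed.

(** In [frame_light] the vector (0, 1, 1) has product -1 with [light p] and product 0 with the
    vector built from the normal. *)
Lemma mean_curvature_form z : U z ->
  mean Phi z = curvature_form L z (lift5 (mk4 0 1) 1).
Proof.
move=> Uz; rewrite mean_real; last by move=> u v; exact: row_smooth_derivable2.
rewrite /curvature_form (energy_light Uz) (pd_light 0 Uz) (pd_light 1 Uz) (laplacian_light Uz) {1}/L.
move: (pd 0 Phi z) (pd 1 Phi z) (laplacian Phi z) (Phi z) => a b l p.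
rewrite frame_light !lift5_lorentz !mk4_dot !dot0r; congr (_ / _).
by field.
Qed.

Lemma conformal_gauss_curvature_form z v : U z ->
  lorentz (conformal_gauss Phi z) v = - curvature_form L z v.
Proof.
move=> Uz; have -> : conformal_gauss Phi z = mean Phi z *: light (Phi z) +
  lift5 (mk4 (gauss Phi z) (dot (gauss Phi z) (Phi z))) (dot (gauss Phi z) (Phi z)) by [].
rewrite gauss_real mean_real; last by move=> u w; exact: row_smooth_derivable2.
rewrite /curvature_form (energy_light Uz) (pd_light 0 Uz) (pd_light 1 Uz) (laplacian_light Uz) {1}/L.
move: (pd 0 Phi z) (pd 1 Phi z) (laplacian Phi z) (Phi z) => a b l p.
rewrite frame_light dotZl -mk4Z -lift5Z lorentzDl !lorentzZl.
(* For E = 0 both sides vanish because the inverse of 0 is 0. *)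
set E := dot a a + dot b b; have [->|E0] := eqVneq E 0.
  by rewrite expr0n /= !invr0; ring.
move: (lorentz (light p) v) (lorentz (lift5 _ _) v) (dot l _) => x y w.
by move: E E0 => E E0; field.
Qed.

End Light.

(** The last row of the frame is (0, 0, 0, 0, 1), so the determinant reduces to that of X, X_x, X_y,
    Delta X. The last coordinate of the lift being constant, the energy is that of X. *)
Lemma mean_S3_curvature_form (X : 'rV[R]_2 -> 'rV[R]_4) z : row_smooth U X -> U z ->
  mean_S3 X z = curvature_form (fun z => lift5 (X z) 1) z (lift5 0 1).
Proof.
move=> XU Uz; rewrite mean_S3_real; last by move=> u v; exact: row_smooth_derivable2.
have D (f : 'rV[R]_2 -> 'rV[R]_4) c k q : row_smooth U f -> U q ->
    pd k (fun z => lift5 (f z) c) q = lift5 (pd k f q) 0.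
  move=> fU Uq; rewrite !pdE.
  by rewrite (derive_lift5 _ (row_smooth_differentiable fU Uq) (differentiable_cst _ _)) derive_cst.
have D2 k : pd k (pd k (fun z => lift5 (X z) 1)) z = lift5 (pd k (pd k X) z) 0.
  rewrite -(D _ 0 k z (pd_smooth oU k XU) Uz); apply: (pd_eq_on oU _ Uz) => q Uq.
  exact: D.
rewrite /curvature_form /energy {2}/laplacian (D _ 1 0 z XU Uz) (D _ 1 1 z XU Uz) (D2 0) (D2 1).
rewrite lift5D addr0 -/(laplacian X z) !lift5_lorentz mulr0 !subr0; congr (2 * _ / _).
move: (X z) (pd 0 X z) (pd 1 X z) (laplacian X z) => x a b l.
have [x0 [x1 [x2 [x3 ->]]]] := row4E x; have [a0 [a1 [a2 [a3 ->]]]] := row4E a.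
have [b0 [b1 [b2 [b3 ->]]]] := row4E b; have [l0 [l1 [l2 [l3 ->]]]] := row4E l.
have -> : 0 = rowl 4 [:: 0; 0; 0; 0] :> 'rV[R]_4.
  by apply/rowP => -[[|[|[|[|]]]] // j4]; rewrite !mxE.
rewrite cross4_rowl dot_rowl4 !lift5_rowl det_frame.
by rewrite /det5s /det4s /det3s /bump /=; ring.
Qed.

(* The null lift of a point of the hyperboloid, proportional to light. *)
Definition hyp_lift (y : 'rV[R]_4) : 'rV[R]_5 :=
  lift5 (mk4 (first3 y) (-1)) (y 0 ord_max).

(** The last row is now (0, 0, 0, 1, 0), and the minus sign is the sign of its cofactor; the column
    deleted is the one holding the constant -1 of [hyp_lift]. *)
Lemma mean_H3_curvature_form (Z : 'rV[R]_2 -> 'rV[R]_4) z : row_smooth U Z -> U z ->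
  mean_H3 Z z = - curvature_form (fun z => hyp_lift (Z z)) z (lift5 (mk4 0 1) 0).
Proof.
move=> ZU Uz; rewrite mean_H3_real; last by move=> u v; exact: row_smooth_derivable2.
(* [P] inserts a zero as fourth coordinate, which makes [hyp_lift] linear up to a constant. *)
pose P : 'M[R]_(4, 5) := \matrix_(i < 4, j < 5) nth 0 (nth [::]
  [:: [:: 1; 0; 0; 0; 0]; [:: 0; 1; 0; 0; 0]; [:: 0; 0; 1; 0; 0]; [:: 0; 0; 0; 0; 1]] i) j.
have PE a b c d : rowl 4 [:: a; b; c; d] *m P = rowl 5 [:: a; b; c; 0; d].
  apply/rowP => j; rewrite mxE !big_ord_recl big_ord0 !mxE /=.
  by case: j => -[|[|[|[|[|]]]]] //= _; rewrite ?(mulr1, mulr0, addr0, add0r).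
have hypE y : hyp_lift y = y *m P + lift5 (mk4 0 (-1)) 0.
  have [x [t ->]] := mk4_surj y; rewrite /hyp_lift first3_mk4 mk4_max.
  have [a [b [c ->]]] := row3E x.
  have -> : 0 = rowl 3 [:: 0; 0; 0] :> 'rV[R]_3.
    by apply/rowP => -[[|[|[|]]] // j3]; rewrite !mxE.
  by rewrite !mk4_rowl !lift5_rowl PE rowl_add //= !addr0 add0r.
have D (f : 'rV[R]_2 -> 'rV[R]_4) c k q : row_smooth U f -> U q ->
    pd k (fun z => f z *m P + c) q = pd k f q *m P.
  move=> fU Uq; have fPU := row_smooth_mulmx oU P fU.
  rewrite -(pd_mulmx k P fU Uq) !pdE deriveD ?derive_cst ?addr0 //.
  exact: diff_derivable (row_smooth_differentiable fPU Uq).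
have D1 k q : U q -> pd k (fun z => hyp_lift (Z z)) q = pd k Z q *m P.
  move=> Uq; rewrite -(D _ (lift5 (mk4 0 (-1)) 0) k q ZU Uq).
  by apply: (pd_eq_on oU _ Uq) => y _; exact: hypE.
have D2 k : pd k (pd k (fun z => hyp_lift (Z z))) z = pd k (pd k Z) z *m P.
  rewrite -(pd_mulmx k P (pd_smooth oU k ZU) Uz).
  by apply: (pd_eq_on oU _ Uz) => q Uq; exact: D1.
rewrite /curvature_form /energy {2}/laplacian (D1 0 z Uz) (D1 1 z Uz) (D2 0) (D2 1).
rewrite -mulmxDl -/(laplacian Z z) hypE.
move: (Z z) (pd 0 Z z) (pd 1 Z z) (laplacian Z z) => x a b l.
have [x0 [x1 [x2 [x3 ->]]]] := row4E x; have [a0 [a1 [a2 [a3 ->]]]] := row4E a.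
have [b0 [b1 [b2 [b3 ->]]]] := row4E b; have [l0 [l1 [l2 [l3 ->]]]] := row4E l.
have -> : 0 = rowl 3 [:: 0; 0; 0] :> 'rV[R]_3.
  by apply/rowP => -[[|[|[|]]] // j3]; rewrite !mxE.
have lor4 (s0 s1 s2 s3 t0 t1 t2 t3 : R) : lorentz (rowl 4 [:: s0; s1; s2; s3])
    (rowl 4 [:: t0; t1; t2; t3]) = s0 * t0 + s1 * t1 + s2 * t2 - s3 * t3.
  by rewrite /lorentz !big_ord_recl big_ord0 !mxE /= addr0 !addrA.
rewrite lcross4_rowl !lor4 !mk4_rowl !lift5_rowl !PE rowl_add //= det_frame !lorentz_rowl5.
rewrite -mulNr -mulrN !mulr0 !addr0; congr (2 * _ / _).
by rewrite /det5s /det4s /det3s /bump /=; ring.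
Qed.

End MeanAsCurvatureForm.

(** * Spherical pieces are umbilic *)

Section Density.
Context {R : realType}.

Lemma open_disk : open (@disk R).
Proof.
have idU := @row_smooth_id R 2 setT; have dU := smooth_dot openT idU idU.
rewrite /disk -[X in open X]/((fun z : 'rV[R]_2 => dot z z) @^-1` [set x | x < 1]).
apply: open_comp; last exact: open_lt.
by move=> z _; apply: differentiable_continuous; exact: smooth_differentiable dU I.
Qed.

(* If w != 0 is orthogonal to a and b, then cross a b is a multiple of w. *)
Lemma dot_cross_eq0 (a b w x : 'rV[R]_3) : w != 0 -> dot a w = 0 -> dot b w = 0 ->
  dot x w = 0 -> dot x (cross a b) = 0.
Proof.
move=> w0 aw bw xw.
have E : dot w w * dot x (cross a b) = dot (cross a b) w * dot x w
    + dot a w * dot x (cross w b) - dot b w * dot x (cross w a).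
  clear w0 aw bw xw.
  have [a0 [a1 [a2 ->]]] := row3E a; have [b0 [b1 [b2 ->]]] := row3E b.
  have [w0 [w1 [w2 ->]]] := row3E w; have [x0 [x1 [x2 ->]]] := row3E x.
  by rewrite !cross_rowl !dot_rowl3; ring.
move: E; rewrite aw bw xw mulr0 !mul0r subr0 addr0 => /eqP.
rewrite mulf_eq0 => /orP[/eqP/dot_eq0/eqP|/eqP //].
by rewrite (negPf w0).
Qed.

Variable Phi : 'rV[R]_2 -> 'rV[R]_3.
Hypothesis Phi_immersion : smooth_conformal_immersion Phi.

Lemma immersion_smooth : row_smooth (@disk R) Phi.
Proof. by have [s _ _] := Phi_immersion; exact: (proj1 (smooth_onP _ open_disk) s). Qed.

Lemma pd_neq0 k z : disk z -> pd k Phi z != 0.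
Proof.
have [_ + _] := Phi_immersion => imm dz; rewrite pdE; apply: imm => //.
by apply/eqP => /rowP/(_ k)/eqP; rewrite !mxE !eqxx oner_eq0.
Qed.

(** These are the real and imaginary parts of <Phi_z, Phi_z> = 0, since 4 <Phi_z, Phi_z> = |Phi_x|^2
    - |Phi_y|^2 - 2 i <Phi_x, Phi_y>. *)
Lemma pd_conformal z : disk z ->
  dot (pd 0 Phi z) (pd 0 Phi z) = dot (pd 1 Phi z) (pd 1 Phi z) /\
  dot (pd 0 Phi z) (pd 1 Phi z) = 0.
Proof.
have [_ _ conf] := Phi_immersion => /conf; rewrite dz_real_at.
move: (pd 0 Phi z) (pd 1 Phi z) => a b.
have -> : toC (2^-1 *: a) - Ic R *: toC (2^-1 *: b) = cx (2^-1 *: a) (- 2^-1 *: b).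
  by rewrite /cx scaleNr /toC map_mxN scalerN.
have dcx (p q : 'rV[R]_3) : dot (cx p q) (cx p q) =
    ((dot p p - dot q q)%:C + Ic R * (2 * dot p q)%:C)%C.
  rewrite /cx !(dotDl, dotDr, dotZl, dotZr) !toC_dot (dotC q p) mulrA Ic_sqr.
  by rewrite !(rmorphB, rmorphM, rmorph_nat) /=; ring.
rewrite dcx => /eqP; rewrite eq_complex /= => /andP[/eqP E1 /eqP E2].
move: E1 E2; rewrite !(dotZl, dotZr) !mul0r !mul1r => E1 E2.
by split; apply/eqP; rewrite -subr_eq0; apply/eqP; lra.
Qed.

Let L z := light (Phi z).

(* The equation says that Phi z stays on the sphere or plane with normal v; then a + (s - t) Phi
   is a normal of constant square <v, v>: if it vanishes then Phi is constant, and
   otherwise all points of N are umbilic. *)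
Lemma no_open_zero (N : set 'rV[R]_2) (v : 'rV[R]_5) z0 :
  nowhere_dense (umbilic Phi) -> v != 0 -> open N -> N z0 -> (forall z, N z -> disk z) ->
  (forall z, N z -> lorentz (L z) v = 0) -> False.
Proof.
move=> nd v0 oN Nz0 Nd Lv.
have PN : row_smooth N Phi by apply: row_smooth_sub immersion_smooth => z /Nd.
have LN : row_smooth N L by exact: row_smooth_light.
have dv (f : 'rV[R]_2 -> 'rV[R]_5) k z : row_smooth N f ->
    (forall z, N z -> lorentz (f z) v = 0) -> N z -> lorentz (pd k f z) v = 0.
  move=> fN fv Nz; have df := row_smooth_differentiable fN Nz.
  have := derive_eq_on (delta_mx 0 k) oN Nz (g := fun=> 0 : R) fv.
  by rewrite derive_cst (derive_lorentz _ df (differentiable_cst _ _)) derive_cst lorentz0r addr0 -pdE.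
have L1 k z : N z -> lorentz (pd k L z) v = 0 by exact: dv.
have L2 j k z : N z -> lorentz (pd j (pd k L) z) v = 0.
  by move=> Nz; apply: dv => // [|q Nq]; [exact: pd_smooth|exact: L1].
have [p [t vE]] := lift5_surj v; have [a [s pE]] := mk4_surj p.
pose w z := a + (s - t) *: Phi z.
have w1 k z : N z -> dot (pd k Phi z) (w z) = 0.
  move=> Nz; have := L1 k z Nz.
  rewrite (pd_light oN PN k Nz) vE pE lift5_lorentz mk4_dot dotDr dotZr => <-.
  by ring.
have w2 j k z : N z -> dot (pd j (pd k Phi) z) (w z) = - (s - t) * dot (pd k Phi z) (pd j Phi z).
  move=> Nz; have := L2 j k z Nz.
  rewrite (pd2_light oN PN j k Nz) vE pE lift5_lorentz mk4_dot dotDr dotZr => E.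
  by apply/eqP; rewrite -subr_eq0 -E; apply/eqP; ring.
have ww z : N z -> dot (w z) (w z) = lorentz v v.
  move=> Nz; have := Lv z Nz.
  rewrite vE pE !lift5_lorentz !mk4_dot /w !(dotDl, dotDr, dotZl, dotZr) (dotC a) => E.
  apply/eqP; rewrite -subr_eq0; apply/eqP.
  transitivity ((s - t) * 2 * (dot (Phi z) a + (dot (Phi z) (Phi z) - 1) / 2 * s -
    (dot (Phi z) (Phi z) + 1) / 2 * t)); last by rewrite E mulr0.
  by field.
have [w00|w0] := eqVneq (w z0) 0.
  have v00 : lorentz v v = 0 by rewrite -(ww _ Nz0) w00 dot0l.
  have wN z : N z -> w z = 0 by move=> Nz; apply: dot_eq0; rewrite ww.
  have : (s - t) *: pd 0 Phi z0 = 0.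
    have D0 : 'D_(delta_mx 0 0) w z0 = 0.
      have := derive_eq_on (delta_mx 0 0) oN Nz0 (f := w) (g := fun=> 0) wN.
      by rewrite derive_cst.
    have dP := row_smooth_derivable (v := delta_mx 0 0) PN Nz0.
    have := deriveD (derivable_cst a z0 (delta_mx 0 0)) (derivableZ (k := s - t) dP).
    by rewrite [X in X = _]D0 derive_cst add0r deriveZ // -pdE => <-.
  move/eqP; rewrite scaler_eq0 (negPf (pd_neq0 0 (Nd _ Nz0))) orbF subr_eq0 => /eqP st.
  have a0 : a = 0 by rewrite -w00 /w st subrr scale0r addr0.
  have t0 : t = 0.
    have := Lv z0 Nz0; rewrite vE pE lift5_lorentz mk4_dot a0 dot0r st => E.
    by rewrite -[t]opprK -[RHS]oppr0 -E; congr (- _); field.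
  move: v0; rewrite vE pE a0 st t0 => /eqP; apply.
  have := @lift5Z R 0 (mk4 0 0) 0; rewrite scale0r mulr0 mk4Z scaler0 mulr0.
  by move=> ->.
have vv : lorentz v v != 0.
  by rewrite -(ww _ Nz0); apply: contra w0 => /eqP/dot_eq0 ->.
have wN z : N z -> w z != 0.
  by move=> Nz; apply: contra vv => /eqP wz; rewrite -(ww _ Nz) wz dot0l.
suff NU : N `<=` umbilic Phi.
  have : interior (closure (umbilic Phi)) z0.
    apply: (filterS (P := N)); last exact: open_nbhs_nbhs.
    by move=> z /NU Uz; exact: subset_closure.
  by rewrite nd.
move=> z Nz; split; first exact: Nd.
have [c1 c2] := pd_conformal (Nd _ Nz).
have n0 x : dot x (w z) = 0 -> dot x (cross (pd 0 Phi z) (pd 1 Phi z)) = 0.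
  by move=> xw; apply: dot_cross_eq0 (wN _ Nz) (w1 0 z Nz) (w1 1 z Nz) xw.
have df u v' : derivable ('D_u Phi) z v' by exact: (row_smooth_derivable2 oN PN Nz).
(* By [w2] the second derivatives have products with [w] proportional to the metric, so by
   conformality the real and imaginary parts of Phi_zz are orthogonal to [w], hence to the Gauss
   map. *)
have z1 : dot (pd 0 (pd 0 Phi) z - pd 1 (pd 1 Phi) z) (cross (pd 0 Phi z) (pd 1 Phi z)) = 0.
  by apply: n0; rewrite dotDl dotNl !w2 // c1 subrr.
have z2 : dot (pd 0 (pd 1 Phi) z + pd 1 (pd 0 Phi) z) (cross (pd 0 Phi z) (pd 1 Phi z)) = 0.
  by apply: n0; rewrite dotDl !w2 // c2 dotC c2 mulr0 addr0.
rewrite /tracefree (dz_dz_real df) gaussC_real dot_cx_toC.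
rewrite -!pd_funE -!pdE !dotZl !dotZr z1 z2 !mulr0.
by rewrite !(rmorph0, mulr0, addr0).
Qed.

End Density.

(** * The equivalences *)

Section Equivalence.
Context {R : realType} (Phi : 'rV[R]_2 -> 'rV[R]_3).
Hypothesis Phi_immersion : smooth_conformal_immersion Phi.
Hypothesis Phi_umbilic : nowhere_dense (umbilic Phi).
Let L z := light (Phi z).
Let PhiU := immersion_smooth Phi_immersion.
Let oD := @open_disk R.
Let LU : row_smooth (@disk R) L := row_smooth_light oD PhiU.

(** The real formulas express Y on the disk through derivatives of [Phi] divided by [E], positive
    for an immersion. The continuity obtained here is what extends equations across the points sent
    to infinity. *)
Lemma smooth_conformal_gauss v :
  smooth (@disk R) (fun z => lorentz (conformal_gauss Phi z) v).
Proof.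
pose E z := dot (pd 0 Phi z) (pd 0 Phi z) + dot (pd 1 Phi z) (pd 1 Phi z).
pose n z := cross (pd 0 Phi z) (pd 1 Phi z).
have p0 := pd_smooth oD 0 PhiU; have p1 := pd_smooth oD 1 PhiU.
have EU : smooth (@disk R) E.
  exact: (smoothD oD (smooth_dot oD p0 p0) (smooth_dot oD p1 p1)).
have E0 z : disk z -> E z != 0.
  move=> dz; rewrite gt_eqF // ltr_pwDl ?dot_ge0 // lt0r dot_ge0 andbT.
  by apply: contra (pd_neq0 Phi_immersion 0 dz) => /eqP/dot_eq0 ->.
have nU : row_smooth (@disk R) n.
  move=> j; rewrite /n; under eq_fun do rewrite mxE.
  by apply: (smoothB oD); apply: (smoothM oD); try exact: p0; exact: p1.
have iU := smoothV oD E0 EU.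
have cU c : smooth (@disk R) (fun=> c : R) by exact: smooth_cst.
pose g z := (2 * (E z)^-1) *: n z.
have gU : row_smooth (@disk R) g.
  exact: (row_smoothZ oD (smoothM oD (cU 2) iU) nU).
have lapU := laplacian_smooth oD PhiU.
pose m z := 2 * dot (laplacian Phi z) (n z) * ((E z)^-1 * (E z)^-1).
have mU : smooth (@disk R) m.
  exact: (smoothM oD (smoothM oD (cU 2) (smooth_dot oD lapU nU)) (smoothM oD iU iU)).
have gPU := smooth_dot oD gU PhiU.
have YU : row_smooth (@disk R) (fun z => m z *: L z +
    lift5 (mk4 (g z) (dot (g z) (Phi z))) (dot (g z) (Phi z))).
  apply: (row_smoothD oD); first exact: (row_smoothZ oD mU LU).
  exact: row_smooth_lift5 (row_smooth_mk4 gU gPU) gPU.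
apply: (smooth_eq oD) (smooth_lorentz oD YU (row_smooth_cst v)) => z dz.
congr (lorentz _ v).
have -> : conformal_gauss Phi z = mean Phi z *: light (Phi z) +
  lift5 (mk4 (gauss Phi z) (dot (gauss Phi z) (Phi z))) (dot (gauss Phi z) (Phi z)) by [].
rewrite gauss_real mean_real; last by move=> u w; exact: (row_smooth_derivable2 oD PhiU dz).
by rewrite /m expr2 invfM.
Qed.

(* The mean curvature gives no information where L z is orthogonal to v. *)
Lemma conformal_gauss_cst_dense (v : 'rV[R]_5) (c : R) : v != 0 ->
  (forall z, disk z -> lorentz (L z) v != 0 -> lorentz (conformal_gauss Phi z) v = c) ->
  forall z, disk z -> lorentz (conformal_gauss Phi z) v = c.
Proof.
move=> v0 Hc z dz; apply/eqP; apply: contrapT => /negP ne.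
pose g q := lorentz (conformal_gauss Phi q) v.
(* On this open set the equation fails, so <L, v> vanishes identically there, which [no_open_zero]
   excludes. *)
pose N := [set q | disk q /\ g q != c].
have oN : open N.
  have gU := smooth_conformal_gauss v.
  rewrite openE => q [dq gq].
  have : \forall x \near q, disk x /\ g x != c.
    have cg : {for q, continuous g}.
      by apply: differentiable_continuous; exact: smooth_differentiable gU dq.
    have n1 : \forall x \near q, disk x by exact: open_nbhs_nbhs.
    have n2 : \forall x \near q, g x != c.
      by apply: (cg [set x | x != c]); apply: open_nbhs_nbhs; split=> //; exact: open_neq.
    by apply: filterS2 n1 n2 => x.
  by [].
apply: (no_open_zero Phi_immersion Phi_umbilic v0 oN (z0 := z)) => // q [dq gq] //.
by apply/eqP; apply: contraNT gq => /(Hc q dq) E; rewrite /g E.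
Qed.

(** [good z] says that the transformed surface has a mean curvature at [z], and [m z] is its value.
    The sign [sigma] is that of the mean curvature formula of the model: 1 for R^3 and S^3, -1 for
    H^3. *)
Definition transforms_by (A : 'M[R]_5) (w0 : 'rV[R]_5) (good : 'rV[R]_2 -> Prop)
    (m : 'rV[R]_2 -> R) (sigma : R) : Prop :=
  forall z, disk z ->
    (good z <-> lorentz (L z *m A) w0 != 0) /\
    (good z -> m z = sigma * \det A * curvature_form L z (w0 *m invmx A)).

(** The argument common to the three geometries; [good] absorbs their different treatments of
    infinity. Both [fwd] and [bwd] multiply the constant by a factor, so the minimal case is the
    constant 0 of the same argument. *)
Lemma cmc_iff_hyperplane (T : Type) (conf : T -> Prop) (good : T -> 'rV[R]_2 -> Prop)
    (m : T -> 'rV[R]_2 -> R) (w0 : 'rV[R]_5) (sigma : R) (kind : 'rV[R]_5 -> Prop) :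
  sigma * sigma = 1 ->
  (forall phi, conf phi -> exists2 A, lorentz_isom A &
    transforms_by A w0 (good phi) (m phi) sigma) ->
  (forall A, lorentz_isom A -> exists2 phi, conf phi &
    transforms_by A w0 (good phi) (m phi) sigma) ->
  (forall v, kind v -> v != 0) ->
  (forall A, lorentz_isom A -> kind (w0 *m invmx A)) ->
  (forall v, kind v -> exists A c, [/\ lorentz_isom A, c != 0 & v *m A = c *: w0]) ->
  ((exists2 phi, conf phi & exists c, forall z, disk z -> good phi z -> m phi z = c) <->
    in_affine_hyperplane kind (conformal_gauss Phi)) /\
  ((exists2 phi, conf phi & forall z, disk z -> good phi z -> m phi z = 0) <->
    in_linear_hyperplane kind (conformal_gauss Phi)).
Proof.
move=> ss conf_isom isom_conf kind0 kindA kind_orbit.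
have fwd phi c : conf phi -> (forall z, disk z -> good phi z -> m phi z = c) ->
    exists2 v, kind v & exists2 s : R, s * s = 1 &
      forall z, disk z -> lorentz (conformal_gauss Phi z) v = s * c.
  move=> /conf_isom[A iA tA] mc; have dA := lorentz_isom_det iA.
  exists (w0 *m invmx A); first exact: kindA.
  (* The sign between the mean curvature and <Y, w0 A^-1>; the minus comes from
     [conformal_gauss_curvature_form]. *)
  exists (- (sigma * \det A)); first by rewrite mulrNN mulrACA ss dA mulr1.
  apply: conformal_gauss_cst_dense; first exact/kind0/kindA.
  move=> z dz; rewrite -lorentz_isom_adj // => /((tA z dz).1) gz.
  rewrite -(mc z dz gz) (proj2 (tA z dz) gz) (conformal_gauss_curvature_form oD PhiU) //.
  rewrite mulNr; congr (- _); rewrite mulrA -(mulrACA sigma) ss dA mulr1 mul1r //.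
have bwd v eta : kind v -> (forall z, disk z -> lorentz (conformal_gauss Phi z) v = eta) ->
    exists2 phi, conf phi & exists k, forall z, disk z -> good phi z -> m phi z = k * eta.
  move=> /kind_orbit[A [c [iA c0 vA]]] Yv.
  have [phi cphi tA] := isom_conf A iA; exists phi => //.
  (* Only the line of [w0] is reached from [v], whence the division by [c]. *)
  exists (- (sigma * \det A * c^-1)) => z dz gz; rewrite (proj2 (tA z dz) gz).
  have -> : w0 *m invmx A = c^-1 *: v.
    by rewrite -[v](mulmxK (lorentz_isom_unit iA)) vA -scalemxAl scalerA mulVf // scale1r.
  rewrite -(Yv z dz) -[curvature_form _ _ _]opprK.
  rewrite -(conformal_gauss_curvature_form oD PhiU) // lorentzZr.
  by rewrite mulrN mulNr mulrA.
split; split.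
- move=> [phi cphi [c mc]]; have [v kv [s _ Yv]] := fwd phi c cphi mc.
  by exists v => //; exists (s * c).
- move=> [v kv [eta Yv]]; have [phi cphi [k mk]] := bwd v eta kv Yv.
  by exists phi => //; exists (k * eta).
- move=> [phi cphi mc]; have [v kv [s _ Yv]] := fwd phi 0 cphi mc.
  by exists v => // z dz; rewrite Yv // mulr0.
- move=> [v kv Yv]; have [phi cphi [k mk]] := bwd v 0 kv Yv.
  by exists phi => // z dz gz; rewrite mk // mulr0.
Qed.

Definition represented_by (f : 'rV[R]_3 -> 'rV[R]_4) (A : 'M[R]_5) : Prop :=
  forall x, exists2 r, r != 0 & lift5 (f x) 1 = r *: (light x *m A).

Lemma moebius_represented (A : 'M[R]_5) : lorentz_isom A ->
  represented_by (fun x => moebius A (stereo_inv x)) A.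
Proof.
move=> iA x; have den := moebius_den iA (stereo_inv_S3 x).
exists (((lift5 (stereo_inv x) 1 *m A) 0 ord_max)^-1 * (2 / (1 + dot x x))).
  by rewrite mulf_neq0 ?invr_eq0 // mulf_neq0 ?pnatr_eq0 // invr_eq0 dot1D_neq0.
by rewrite lift5_moebius // {2}lift5_stereo_inv -scalemxAl scalerA.
Qed.

Lemma oo_represented phi (A : 'M[R]_5) :
  represented_by (fun x => (@stereo_inv_oo R \o phi \o @stereo_oo R) (stereo_inv x)) A ->
  represented_by (fun x => stereo_inv_oo (phi (Some x))) A.
Proof. by move=> rA x; have := rA x; rewrite /= stereo_ooK. Qed.

Lemma moebius_oo_represented (A : 'M[R]_5) : lorentz_isom A ->
  represented_by (fun x => stereo_inv_oo (moebius_oo A (Some x))) A.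
Proof.
move=> iA x; have [r r0 E] := moebius_represented iA x; exists r => //.
rewrite -E /moebius_oo /= stereo_inv_ooK //.
exact: moebius_S3 (stereo_inv_S3 x).
Qed.

End Equivalence.

(** * Transitivity of the Lorentz group on lines of each causal type *)

Section Orbits.
Context {R : realType}.

(** The normals of the three models: [light x] has product -1 with [par_pole], [lift5 p 1] with
    [time_pole], and every [hyp_lift] with [space_pole]. *)
Definition par_pole : 'rV[R]_5 := lift5 (mk4 0 1) 1.
Definition time_pole : 'rV[R]_5 := lift5 0 1.
Definition space_pole : 'rV[R]_5 := lift5 (mk4 0 1) 0.

Lemma par_pole_lorentz : lorentz par_pole par_pole = 0.
Proof. by rewrite lift5_lorentz mk4_dot dot0l; ring. Qed.

Lemma time_pole_lorentz : lorentz time_pole time_pole = -1.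
Proof. by rewrite lift5_lorentz dot0l; ring. Qed.

Lemma space_pole_lorentz : lorentz space_pole space_pole = 1.
Proof. by rewrite lift5_lorentz mk4_dot dot0l; ring. Qed.

Lemma lorentz_neq0 (v : 'rV[R]_5) : lorentz v v != 0 -> v != 0.
Proof. by apply: contra => /eqP ->; rewrite lorentz0l. Qed.

Lemma invmx_isom_lorentz (A : 'M[R]_5) w : lorentz_isom A ->
  lorentz (w *m invmx A) (w *m invmx A) = lorentz w w.
Proof. by move=> /lorentz_isomV ->. Qed.

(** The square root of the quotient rescales [w] to the square of [v]; the sign left open by
    [lorentz_transitive] goes into [c]. *)
Lemma nondegenerate_orbit (v w : 'rV[R]_5) : 0 < lorentz v v / lorentz w w ->
  exists A c, [/\ lorentz_isom A, c != 0 & v *m A = c *: w].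
Proof.
move=> vw; have w0 : lorentz w w != 0.
  by apply/eqP => w0; move: vw; rewrite w0 invr0 mulr0 ltxx.
pose k := Num.sqrt (lorentz v v / lorentz w w).
have k0 : 0 < k by rewrite sqrtr_gt0.
have kw : lorentz (k *: w) (k *: w) = lorentz v v.
  by rewrite !lorentz_bilin mulrA -expr2 sqr_sqrtr ?ltW // divfK.
have v0 : lorentz v v != 0.
  by apply/eqP => v0; move: vw; rewrite v0 mul0r ltxx.
have [A iA [vA|vA]] := lorentz_transitive (esym kw) v0.
  by exists A, k; split=> //; rewrite gt_eqF.
by exists A, (- k); split=> //; [rewrite oppr_eq0 gt_eqF|rewrite scaleNr].
Qed.

(** If [v] is not orthogonal to the pole, a reflection maps one to the other. Otherwise the two null
    vectors are proportional: orthogonality makes the last two coordinates of [v] equal, nullity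
    then kills the first three, and the identity matrix serves. *)
Lemma lightlike_orbit (v : 'rV[R]_5) : lightlike v ->
  exists A c, [/\ lorentz_isom A, c != 0 & v *m A = c *: par_pole].
Proof.
move=> [v0 vv]; have [vw|vw] := eqVneq (lorentz v par_pole) 0; last first.
  have [A iA vA] := lorentz_transitive_null vv par_pole_lorentz vw.
  by exists A, 1; split=> //; rewrite ?oner_eq0 ?scale1r.
have [p [t vE]] := lift5_surj v; have [a [s pE]] := mk4_surj p.
move: vw vv v0; rewrite vE pE !lift5_lorentz !mk4_dot dot0r add0r !mulr1 => /eqP.
rewrite subr_eq0 => /eqP -> /eqP; rewrite addrK => /eqP/dot_eq0 -> v0.
have E : lift5 (mk4 0 t) t = t *: par_pole.
  by rewrite /par_pole lift5Z mk4Z scaler0 !mulr1.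
exists 1%:M, t; split; [exact: lorentz_isom1| |by rewrite mulmx1].
by apply: contra v0 => /eqP t0; rewrite E t0 scale0r.
Qed.

End Orbits.

(** * The transformation law in each of the three geometries *)

Section Cases.
Context {R : realType} (Phi : 'rV[R]_2 -> 'rV[R]_3).
Hypothesis Phi_immersion : smooth_conformal_immersion Phi.
Let L z := light (Phi z).
Let PhiU := immersion_smooth Phi_immersion.
Let oD := @open_disk R.
Let LU : row_smooth (@disk R) L := row_smooth_light oD PhiU.

Lemma light_neq0 (x : 'rV[R]_3) : light x != 0.
Proof.
apply/eqP => E; have := lift5_lorentz (mk4 x ((dot x x - 1) / 2)) (mk4 0 1) ((dot x x + 1) / 2) 1.
rewrite -/(light x) E lorentz0l mk4_dot dot0r add0r !mulr1 => /eqP.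
rewrite eq_sym; have -> : (dot x x - 1) / 2 - (dot x x + 1) / 2 = -1 by field.
by rewrite oppr_eq0 oner_eq0.
Qed.

Lemma row_smooth_first4 (U : set 'rV[R]_2) (K : 'rV[R]_2 -> 'rV[R]_5) :
  row_smooth U K -> row_smooth U (fun z => first4 (K z)).
Proof. by move=> KU j; rewrite /first4; under eq_fun do rewrite mxE; exact: KU. Qed.

Lemma row_smooth_first3 (U : set 'rV[R]_2) (K : 'rV[R]_2 -> 'rV[R]_4) :
  row_smooth U K -> row_smooth U (fun z => first3 (K z)).
Proof. by move=> KU j; rewrite /first3; under eq_fun do rewrite mxE; exact: KU. Qed.

Section Transform.
Variable A : 'M[R]_5.
Hypothesis iA : lorentz_isom A.
Let u z := L z *m A.
Let uU : row_smooth (@disk R) u := row_smooth_mulmx oD A LU.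

Let dom w0 := [set z | disk z /\ lorentz (u z) w0 != 0].

Lemma open_dom w0 : open (dom w0).
Proof.
have gU : smooth (@disk R) (fun z => lorentz (u z) w0).
  exact: (smooth_lorentz oD uU (row_smooth_cst _)).
rewrite openE => q [dq gq].
have cg : {for q, continuous (fun z => lorentz (u z) w0)}.
  by apply: differentiable_continuous; exact: smooth_differentiable gU dq.
have n1 : \forall x \near q, disk x by exact: open_nbhs_nbhs.
have n2 : \forall x \near q, lorentz (u x) w0 != 0.
  by apply: (cg [set x | x != 0]); apply: open_nbhs_nbhs; split=> //; exact: open_neq.
by apply: filterS2 n1 n2 => x.
Qed.

(** The factor is the one for which L' has product -1 with [w0]; it is smooth and nonzero exactly
    because the points with <u, w0> = 0 have been removed. *)
Lemma dom_scaled_lift w0 (L' : 'rV[R]_2 -> 'rV[R]_5) :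
  (forall z, dom w0 z -> L' z = (- (lorentz (u z) w0)^-1) *: u z) ->
  row_smooth (dom w0) L' /\ forall z v, dom w0 z ->
    curvature_form L' z v = \det A * curvature_form L z (v *m invmx A).
Proof.
move=> LE; have oV := @open_dom w0.
have sub : dom w0 `<=` @disk R by move=> z [].
have LV : row_smooth (dom w0) L by exact: row_smooth_sub LU.
have uV : row_smooth (dom w0) u by exact: row_smooth_sub uU.
have rV : smooth (dom w0) (fun z => - (lorentz (u z) w0)^-1).
  apply: (smoothN oV); apply: (smoothV oV) => [z [] //|].
  exact: (smooth_lorentz oV uV (row_smooth_cst _)).
split=> [|z v Vz].
  apply: (row_smooth_eq oV) (row_smoothZ oV rV uV) => z Vz.
  by rewrite LE.
apply: (curvature_form_transform v oV iA rV LV) => // [q _|].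
  exact: light_null.
by case: Vz => _ d0; rewrite oppr_eq0 invr_eq0.
Qed.

Lemma S3_transforms (f : 'rV[R]_4 -> 'rV[R]_4) :
  represented_by (fun x => f (stereo_inv x)) A ->
  transforms_by Phi A time_pole (fun=> True) (mean_S3 (f \o (@stereo_inv R \o Phi))) 1.
Proof.
move=> fA; have pole (v : 'rV[R]_5) : lorentz v time_pole = - v 0 ord_max.
  by have [p [t ->]] := lift5_surj v; rewrite lift5_lorentz lift5_max dot0r mulr1 sub0r.
(* A nonzero null vector is never orthogonal to a timelike one, so in S^3 no point of the disk is
   lost. *)
have d0 z : lorentz (u z) time_pole != 0.
  rewrite pole oppr_eq0; apply: null_max_neq0; last by rewrite iA light_null.
  by apply: mulmx_isom_neq0 => //; exact: light_neq0.
have liftE z : lift5 (f (stereo_inv (Phi z))) 1 = (- (lorentz (u z) time_pole)^-1) *: u z.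
  have [r r0 E] := fA (Phi z); rewrite E; congr (_ *: _).
  have := congr1 (fun v : 'rV[R]_5 => v 0 ord_max) E; rewrite /= lift5_max mxE => r1.
  rewrite pole invrN opprK; apply: (mulIf (x := (u z) 0 ord_max)).
    by move: (d0 z); rewrite pole oppr_eq0.
  by rewrite -r1 mulVf //; move: (d0 z); rewrite pole oppr_eq0.
have [L'U cf] := dom_scaled_lift (fun z (_ : dom time_pole z) => liftE z).
(* Smoothness of the transformed surface is read off from its normalised lift. *)
have hU : row_smooth (dom time_pole) (f \o (@stereo_inv R \o Phi)).
  apply: (row_smooth_eq (open_dom (w0 := time_pole)) _ (row_smooth_first4 L'U)) => z _.
  by rewrite first4_lift5.
move=> z dz; split; first by split=> // _; exact: d0.
move=> _; have Vz : dom time_pole z by split; [|exact: d0].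
by rewrite (mean_S3_curvature_form (open_dom (w0 := time_pole)) hU Vz) mul1r -cf.
Qed.

Lemma par_pole_light (x : 'rV[R]_3) : lorentz (light x) par_pole = -1.
Proof. by rewrite lift5_lorentz mk4_dot dot0r; field. Qed.

(** The point at infinity has null lift [par_pole], which is orthogonal to itself, whereas finite
    points have product -1 with it up to scaling: so the value [None] occurs exactly where <u,
    par_pole> = 0. *)
Lemma R3_transforms (phi : option 'rV[R]_3 -> option 'rV[R]_3) :
  represented_by (fun x => stereo_inv_oo (phi (Some x))) A ->
  transforms_by Phi A par_pole (fun z => (phi \o Some \o Phi) z <> None)
    (mean (odflt 0 \o (phi \o Some \o Phi))) 1.
Proof.
move=> phiA; pose psi := phi \o Some \o Phi.
have rep z : exists2 r, r != 0 & lift5 (stereo_inv_oo (psi z)) 1 = r *: u z.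
  exact: phiA (Phi z).
have psiN z : psi z = None -> lorentz (u z) par_pole = 0.
  have [r r0 +] := rep z => /[swap] ->.
  move=> /(congr1 (fun v => lorentz v par_pole)); rewrite /= -/par_pole par_pole_lorentz lorentzZl.
  by move/esym/eqP; rewrite mulf_eq0 (negPf r0) => /eqP.
have psiS z y : psi z = Some y -> lorentz (u z) par_pole != 0 /\
    light y = (- (lorentz (u z) par_pole)^-1) *: u z.
  have [r r0 +] := rep z => /[swap] ->.
  rewrite lift5_stereo_inv => E.
  have t0 : 2 / (1 + dot y y) != 0.
    by rewrite mulf_neq0 ?pnatr_eq0 // invr_eq0 dot1D_neq0.
  have yE : light y = ((2 / (1 + dot y y))^-1 * r) *: u z.
    by rewrite -scalerA -E scalerA mulVf // scale1r.
  have := par_pole_light y; rewrite {1}yE lorentzZl => k1.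
  have d0 : lorentz (u z) par_pole != 0.
    apply/eqP => d0; move: k1; rewrite d0 mulr0 => /eqP.
    by rewrite eq_sym oppr_eq0 oner_eq0.
  split=> //; rewrite yE; congr (_ *: _); apply: (mulIf d0).
  by rewrite k1 mulNr mulVf.
have psi_dom z : psi z <> None <-> lorentz (u z) par_pole != 0.
  split; first by case E : (psi z) => [y|] // _; exact: (psiS z y E).1.
  by move=> d0 E; move: d0; rewrite psiN // eqxx.
have liftE z : dom par_pole z ->
    light ((odflt 0 \o psi) z) = (- (lorentz (u z) par_pole)^-1) *: u z.
  move=> [_ d0]; rewrite /comp; case E : (psi z) => [y|] /=; first exact: (psiS z y E).2.
  by move: d0; rewrite psiN // eqxx.
have [L'U cf] := dom_scaled_lift liftE.
move=> z dz; split; first exact: psi_dom.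
move=> psiz; have Vz : dom par_pole z by split=> //; exact/psi_dom.
have hU : row_smooth (dom par_pole) (odflt 0 \o psi).
  have := row_smooth_first3 (row_smooth_first4 L'U).
  by under eq_fun do rewrite /light first4_lift5 first3_mk4.
by rewrite (mean_curvature_form (open_dom (w0 := par_pole)) hU Vz) mul1r -cf.
Qed.

(** Both lifts are multiples of [light x], by 2 / (1 - |x|^2) and 2 / (1 + |x|^2). At infinity the
    hyperboloid point is (0, 0, 0, -1), which gives the factor -1. *)
Lemma hyp_lift_inv_oo (w : option 'rV[R]_3) : ~ on_unit_sphere w -> exists2 c, c != 0 &
  hyp_lift (hyp_inv_oo w) = c *: lift5 (stereo_inv_oo w) 1.
Proof.
case: w => [x|] /= xS; last first.
  exists (-1); first by rewrite oppr_eq0 oner_eq0.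
  by rewrite /hyp_lift first3_mk4 mk4_max lift5Z mk4Z scaler0 !mulr1.
have d0 : 1 - dot x x != 0 by rewrite subr_eq0 eq_sym; apply/eqP.
have d1 := dot1D_neq0 x.
exists ((1 + dot x x) / (1 - dot x x)); first by rewrite mulf_neq0 // invr_eq0.
rewrite lift5_stereo_inv /hyp_inv /hyp_lift mk4Z first3_mk4 mk4_max /light !scalerA.
rewrite lift5Z mk4Z; congr (lift5 (mk4 (_ *: _) _) _); field.
all: by rewrite ?d0 ?d1.
Qed.

Lemma space_pole_light (x : 'rV[R]_3) : lorentz (light x) space_pole = (dot x x - 1) / 2.
Proof. by rewrite lift5_lorentz mk4_dot dot0r; ring. Qed.

Lemma on_unit_sphereP (w : option 'rV[R]_3) :
  ~ on_unit_sphere w <-> lorentz (lift5 (stereo_inv_oo w) 1) space_pole != 0.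
Proof.
case: w => [x|] /=; last first.
  rewrite lift5_lorentz mk4_dot dot0r add0r mulr1 mulr0 subr0.
  by rewrite oner_eq0; split=> // _ [].
rewrite lift5_stereo_inv lorentzZl space_pole_light !mulf_eq0 invr_eq0.
rewrite !pnatr_eq0 ?invr_eq0 (negPf (dot1D_neq0 x)) /= ?orbF subr_eq0.
have -> : (2 == 0 :> R) = false by exact: pnatr_eq0.
by rewrite orbF; split=> [/eqP|/eqP].
Qed.

(** [psi] is compared with [phi] on the disk only, as [Phi] is recovered from Z by [hyp_oo] through
    the hypothesis that [Phi] maps the disk into the unit ball. *)
Lemma H3_transforms (phi : option 'rV[R]_3 -> option 'rV[R]_3)
    (psi : 'rV[R]_2 -> option 'rV[R]_3) :
  (forall z, disk z -> psi z = phi (Some (Phi z))) ->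
  represented_by (fun x => stereo_inv_oo (phi (Some x))) A ->
  transforms_by Phi A space_pole (fun z => ~ on_unit_sphere (psi z))
    (mean_H3 (@hyp_inv_oo R \o psi)) (-1).
Proof.
move=> psiE phiA.
have rep z : disk z -> exists2 r, r != 0 & lift5 (stereo_inv_oo (psi z)) 1 = r *: u z.
  by move=> dz; rewrite psiE //; exact: phiA (Phi z).
have dom_psi z : disk z -> ~ on_unit_sphere (psi z) <-> lorentz (u z) space_pole != 0.
  move=> /rep[r r0 E]; split.
    by move=> /on_unit_sphereP; rewrite E lorentzZl mulf_eq0 (negPf r0).
  by move=> d0; apply/on_unit_sphereP; rewrite E lorentzZl mulf_neq0.
have liftE z : dom space_pole z ->
    hyp_lift ((@hyp_inv_oo R \o psi) z) = (- (lorentz (u z) space_pole)^-1) *: u z.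
  move=> [dz d0]; have [r r0 E] := rep z dz.
  (* The fourth coordinate of [hyp_lift] is -1 on both sheets, so one normalisation covers both. *)
  have k1 : lorentz (hyp_lift (hyp_inv_oo (psi z))) space_pole = -1.
    by rewrite /hyp_lift lift5_lorentz mk4_dot dot0r; ring.
  have [c c0 E'] := hyp_lift_inv_oo (proj2 (dom_psi z dz) d0).
  rewrite /comp E' E scalerA; congr (_ *: _); apply: (mulIf d0).
  by rewrite -lorentzZl -scalerA -E -E' k1 mulNr mulVf.
have [L'U cf] := dom_scaled_lift liftE.
move=> z dz; split; first exact: dom_psi.
move=> psiz; have Vz : dom space_pole z by split=> //; exact/dom_psi.
have mk4_eta (y : 'rV[R]_4) : mk4 (first3 y) (y 0 ord_max) = y.
  by have [x [t ->]] := mk4_surj y; rewrite first3_mk4 mk4_max.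
have hU : row_smooth (dom space_pole) (@hyp_inv_oo R \o psi).
  have f3U := row_smooth_first3 (row_smooth_first4 L'U).
  apply: (row_smooth_eq (open_dom (w0 := space_pole)) _ (row_smooth_mk4 f3U (L'U ord_max))).
  by move=> q _; rewrite /hyp_lift first4_lift5 first3_mk4 lift5_max mk4_eta.
by rewrite (mean_H3_curvature_form (open_dom (w0 := space_pole)) hU Vz) mulN1r mulNr -cf.
Qed.

End Transform.
End Cases.

Theorem theorem1p3 (R : realType) (Phi : 'rV[R]_2 -> 'rV[R]_3)
    (X Z : 'rV[R]_2 -> 'rV[R]_4) (Y : 'rV[R]_2 -> 'rV[R]_5)
    (hPhi : smooth_conformal_immersion Phi)
    (hX : X = @stereo_inv R \o Phi)
    (hZ : Z = @hyp_inv R \o Phi)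
    (hY : Y = conformal_gauss Phi)
    (humb : nowhere_dense (umbilic Phi)) :
  [/\ (conformally_CMC_R3 Phi <-> in_affine_hyperplane (@lightlike R 4) Y) /\
      (conformally_minimal_R3 Phi <-> in_linear_hyperplane (@lightlike R 4) Y),
      (conformally_CMC_S3 X <-> in_affine_hyperplane (@timelike R 4) Y) /\
      (conformally_minimal_S3 X <-> in_linear_hyperplane (@timelike R 4) Y)
    & (forall z, disk z -> dot (Phi z) (Phi z) < 1) ->
      (conformally_CMC_H3 Z <-> in_affine_hyperplane (@spacelike R 4) Y) /\
      (conformally_minimal_H3 Z <-> in_linear_hyperplane (@spacelike R 4) Y)].
Proof.
rewrite {}hX {}hZ {}hY.
have liouville_oo phi : conformal_diffeo_R3oo phi -> exists2 A : 'M[R]_5, lorentz_isom A &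
    represented_by (fun x => stereo_inv_oo (phi (Some x))) A.
  move=> /liouville_S3[A iA fA]; exists A => //.
  exact: oo_represented.
split=> [||ball].
- apply: (cmc_iff_hyperplane hPhi humb (w0 := par_pole) (sigma := 1)
    (good := fun phi z => (phi \o Some \o Phi) z <> None)
    (m := fun phi => mean (odflt 0 \o (phi \o Some \o Phi)))).
  + exact: mulr1.
  + move=> phi /liouville_oo[A iA rA]; exists A => //; exact: R3_transforms.
  + move=> A iA; exists (moebius_oo A); first exact: moebius_oo_conformal.
    by apply: R3_transforms => //; exact: moebius_oo_represented.
  + by move=> v [].
  + move=> A iA; split; last by rewrite invmx_isom_lorentz // par_pole_lorentz.
    apply: (mulmx_isom_neq0 (lorentz_isomV iA)); apply: lift5_neq0; exact: oner_neq0.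
  + exact: lightlike_orbit.
- have [|||||cmc mini] := cmc_iff_hyperplane hPhi humb (w0 := time_pole) (sigma := 1)
    (conf := @conformal_diffeo_S3 R) (good := fun _ _ => True) (kind := @timelike R 4)
    (m := fun f => mean_S3 (f \o (@stereo_inv R \o Phi))) (mulr1 _).
  + move=> f /liouville_S3[A iA rA]; exists A => //; exact: S3_transforms.
  + move=> A iA; exists (moebius A); first exact: moebius_conformal.
    by apply: S3_transforms => //; exact: moebius_represented.
  + by move=> v [].
  + move=> A iA; split; last by rewrite invmx_isom_lorentz // time_pole_lorentz ltrN10.
    apply: (mulmx_isom_neq0 (lorentz_isomV iA)); apply: lift5_neq0; exact: oner_neq0.
  + move=> v [_ v0]; apply: nondegenerate_orbit.
    by rewrite time_pole_lorentz invrN1 mulrN1 oppr_gt0.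
  (* Since [good] is always true here, only a trivial side condition is added or removed. *)
  split; [apply: iff_trans cmc|apply: iff_trans mini]; split.
  + by move=> [f cf [c fc]]; exists f => //; exists c => z dz _; exact: fc.
  + by move=> [f cf [c fc]]; exists f => //; exists c => z dz; exact: fc.
  + by move=> [f cf fc]; exists f => // z dz _; exact: fc.
  + by move=> [f cf fc]; exists f => // z dz; exact: fc.
- have hypK z : disk z -> (@hyp_oo R \o (@hyp_inv R \o Phi)) z = Some (Phi z).
    move=> dz /=; have := ball z dz; move: (Phi z) => x x1.
    have d0 : 1 - dot x x != 0 by rewrite gt_eqF // subr_gt0.
    rewrite /hyp_oo /hyp_inv mk4Z mk4_max first3_mk4.
    (* This is the denominator of [hyp_oo]; being nonzero, it rules out the value infinity. *)
    have e : 1 + (1 - dot x x)^-1 * (dot x x + 1) = 2 / (1 - dot x x) by field.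
    case: eqP => [E|_].
      move: e; rewrite E subrr => /esym/eqP.
      by rewrite mulf_eq0 invr_eq0 (negPf d0) pnatr_eq0.
    congr Some; rewrite e !scalerA -[RHS]scale1r; congr (_ *: _).
    by field; rewrite d0.
  apply: (cmc_iff_hyperplane hPhi humb (w0 := space_pole) (sigma := -1)
    (good := fun phi z => ~ on_unit_sphere ((phi \o @hyp_oo R \o (@hyp_inv R \o Phi)) z))
    (m := fun phi => mean_H3 (@hyp_inv_oo R \o (phi \o @hyp_oo R \o (@hyp_inv R \o Phi))))).
  + by rewrite mulrNN mulr1.
  + move=> phi /liouville_oo[A iA rA]; exists A => //.
    by apply: (H3_transforms hPhi iA (phi := phi)) => // z dz; congr phi; exact: hypK.
  + move=> A iA; exists (moebius_oo A); first exact: moebius_oo_conformal.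
    apply: (H3_transforms hPhi iA (phi := moebius_oo A)) => [z dz|].
      by congr moebius_oo; exact: hypK.
    exact: moebius_oo_represented.
  + by move=> v [].
  + have k1 : 0 < lorentz (@space_pole R) space_pole by rewrite space_pole_lorentz ltr01.
    move=> A iA; split; last by rewrite invmx_isom_lorentz.
    apply: (mulmx_isom_neq0 (lorentz_isomV iA)); apply: lorentz_neq0.
    by rewrite gt_eqF.
  + move=> v [_ v0]; apply: nondegenerate_orbit.
    by rewrite space_pole_lorentz invr1 mulr1.
Qed.
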